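(* Let $\mathrm{R}$ be a real closed field, and let $\mathcal{Q},\mathcal{P}\subset \mathrm{R}[X_1,\dots,X_k]$ be finite subsets of polynomials such that $\deg(Q)\le d_0$ for all $Q\in\mathcal{Q}$, $\deg P=d_P$ for all $P\in\mathcal{P}$, and the real dimension of $\mathrm{Zer}(\mathcal{Q},\mathrm{R}^k)$ is $k'\le k$. Suppose also that $\mathrm{card}\,\mathcal{P}=s$, and for $\mathcal{I}\subseteq\mathcal{P}$ let $d_{\mathcal{I}}=\prod_{P\in\mathcal{I}}d_P$. Then $$\sum_{\sigma\in\{0,1,-1\}^{\mathcal{P}}} b_0\big(\mathcal{R}(\sigma,\mathrm{Zer}(\mathcal{Q},\mathrm{R}^k))\big)$$ is at most $$\sum_{\mathcal{I}\subset\mathcal{P},\ \#\mathcal{I}\le k'}4^{\#\mathcal{I}}\left(\binom{k+1}{k-k'+\#\mathcal{I}+1}(2d_0)^{k-k'}\,d_{\mathcal{I}}\,\max_{P\in\mathcal{I}}\{2d_0,d_P\}^{k'-\#\mathcal{I}}+2(k-\#\mathcal{I}+1)\right).$$ In particular, if $d_P\le d$ for all $P\in\mathcal{P}$, then $$\sum_{\sigma\in\{0,1,-1\}^{\mathcal{P}}} b_0\big(\mathcal{R}(\sigma,\mathrm{Zer}(\mathcal{Q},\mathrm{R}^k))\big)$$ is at most $$\sum_{j=0}^{k'}4^j\binom{s+1}{j}\left(\binom{k+1}{k-k'+j+1}(2d_0)^{k-k'}d^j\,\max\{2d_0,d\}^{k'-j}+2(k-j+1)\right).$$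
   Context: For a finite set $\mathcal{Q}\subset\mathrm{R}[X_1,\dots,X_k]$, $\mathrm{Zer}(\mathcal{Q},\mathrm{R}^k)=\{x\in\mathrm{R}^k \mid Q(x)=0 \text{ for all } Q\in\mathcal{Q}\}$. A sign condition on $\mathcal{P}$ is an element $\sigma\in\{0,1,-1\}^{\mathcal{P}}$; its realization in a semi-algebraic set $V\subset\mathrm{R}^k$ is $\mathcal{R}(\sigma,V)=\{x\in V\mid \mathrm{sign}(P(x))=\sigma(P)\text{ for all }P\in\mathcal{P}\}$. For a semi-algebraic set $X$, $b_0(X)$ is the dimension of the zeroth homology group $H_0(X,\mathbb{Z}_2)$, i.e. the number of semi-algebraically connected components of $X$ (so $b_0(\emptyset)=0$). The expression $\max_{P\in\mathcal{I}}\{2d_0,d_P\}$ is the maximum of $2d_0$ and all the $d_P$ with $P\in\mathcal{I}$. *)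

(* Defs.v *)
From HB Require Import structures.
From mathcomp Require Import all_boot all_order all_algebra.
From mathcomp Require Import finmap mpoly.
From mathcomp Require Import boolp classical_sets functions cardinality topology.
Set Implicit Arguments.
Unset Strict Implicit.
Unset Printing Implicit Defensive.
Import Order.TTheory GRing.Theory Num.Theory.
Import numFieldTopology.Exports.
Local Open Scope classical_set_scope.
Local Open Scope ring_scope.

(* Points of R^n are row vectors 'rV[R]_n. The topology used below is the     *)
(* library's topology on matrices, i.e. the Euclidean (order) topology of R^n.*)

(* Total degree, with the convention that the zero polynomial has degree 0.   *)
Definition tdeg (R : rcfType) (n : nat) (p : {mpoly R[n]}) : nat :=
  (msize p).-1.

Definition Zer (R : rcfType) (n : nat) (Q : {fset {mpoly R[n]}}) :
    set 'rV[R]_n :=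
  [set x | forall q, q \in Q -> q.@[x 0] = 0].

Definition signs : {fset int} := [fset 0; 1; -1]%fset.

Definition realization (R : rcfType) (n : nat) (P : {fset {mpoly R[n]}})
    (sigma : {ffun P -> signs}) (V : set 'rV[R]_n) : set 'rV[R]_n :=
  [set x | V x /\ forall p : P, sgz (val p).@[x 0] = val (sigma p)].

Inductive semialgebraic (R : rcfType) (n : nat) : set 'rV[R]_n -> Prop :=
| semialgebraic_eq0 (p : {mpoly R[n]}) :
    semialgebraic [set x | p.@[x 0] = 0]
| semialgebraic_gt0 (p : {mpoly R[n]}) :
    semialgebraic [set x | 0 < p.@[x 0]]
| semialgebraic_setU (A B : set 'rV[R]_n) :
    semialgebraic A -> semialgebraic B -> semialgebraic (A `|` B)
| semialgebraic_setI (A B : set 'rV[R]_n) :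
    semialgebraic A -> semialgebraic B -> semialgebraic (A `&` B)
| semialgebraic_setC (A : set 'rV[R]_n) :
    semialgebraic A -> semialgebraic (~` A).

Definition closed_in (T : topologicalType) (S A : set T) : Prop :=
  exists2 F : set T, closed F & A = F `&` S.

(* Over a general real closed field the order topology is totally             *)
(* disconnected unless R is Dedekind complete, so only semi-algebraic         *)
(* separations are considered.                                                *)
Definition semialg_connected (R : rcfType) (n : nat) (S : set 'rV[R]_n) :
    Prop :=
  semialgebraic S /\
  forall A B : set 'rV[R]_n, semialgebraic A -> semialgebraic B ->
    closed_in S A -> closed_in S B ->
    A `&` B = set0 -> A `|` B = S -> A = set0 \/ B = set0.

(* The semi-algebraically connected components of S: its maximal nonempty     *)
(* semi-algebraically connected subsets.                                      *)
Definition components (R : rcfType) (n : nat) (S : set 'rV[R]_n) :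
    set (set 'rV[R]_n) :=
  [set C | [/\ C !=set0, C `<=` S, semialg_connected C &
     forall D : set 'rV[R]_n,
       C `<=` D -> D `<=` S -> semialg_connected D -> D = C]].

(* fset_set is empty on infinite sets, so b0 S is meaningful only when        *)
(* components S is finite.                                                    *)
Definition b0 (R : rcfType) (n : nat) (S : set 'rV[R]_n) : nat :=
  #|` fset_set (components S)|.

Definition open_unit_cube (R : rcfType) (m : nat) : set 'rV[R]_m :=
  [set x | forall i, 0 < x 0 i < 1].

(* f is semi-algebraic on A: its graph is a semi-algebraic subset of R^(m+n). *)
Definition semialg_map (R : rcfType) (m n : nat) (A : set 'rV[R]_m)
    (f : 'rV[R]_m -> 'rV[R]_n) : Prop :=
  semialgebraic
    [set z : 'rV[R]_(m + n) | A (lsubmx z) /\ rsubmx z = f (lsubmx z)].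

Definition cube_embeds (R : rcfType) (n m : nat) (S : set 'rV[R]_n) : Prop :=
  exists f : 'rV[R]_m -> 'rV[R]_n,
    [/\ semialg_map (@open_unit_cube R m) f,
        set_inj (@open_unit_cube R m) f &
        f @` (@open_unit_cube R m) `<=` S].

(* real_dim S d: d is the dimension of S, the largest m such that (0,1)^m     *)
(* admits an injective semi-algebraic map into S; the empty set has           *)
(* dimension -1.                                                              *)
Definition real_dim (R : rcfType) (n : nat) (S : set 'rV[R]_n) (d : int) :
    Prop :=
  (S = set0 /\ d = -1) \/
  (exists m : nat, [/\ d = m%:Z, cube_embeds m S &
     forall m' : nat, cube_embeds m' S -> (m' <= m)%N]).

(* Main.v *)
Require Import Defs.
From HB Require Import structures.
From mathcomp Require Import all_boot all_order all_algebra.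
From mathcomp Require Import finmap mpoly.
From mathcomp Require Import boolp classical_sets functions cardinality topology.
From mathcomp Require Import polyrcf ordered_qelim qe_rcf.
From mathcomp Require Import ring lra zify.

(** Let Z be the zero set of [Q] and p its dimension. Replacing [Q] by the sum
    of the squares of its members makes Z the zero set of one nonnegative
    polynomial, of degree at most [2 * d0].

    Components are approached through pieces: every realization is split into
    finitely many nonempty pieces that are clopen in it. If the number of
    pieces of all realizations is bounded, then largest splittings exist, their
    pieces are connected, and every component is one of them
    ([components_bound]). So it suffices to bound the number of pieces, and for
    this to attach to each piece a point in a neighbourhood of its own that
    solves one of finitely many polynomial systems.

    Choose a point in each piece. As no cube of dimension p + 1 embeds in Z,
    there is a linear subspace of dimension q = k - p such that each chosen
    point is isolated in the section of Z by the parallel subspace through it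
    ([isolating_subspace]). Maximising a coordinate in such a section, under a
    bound on [Q] minus a small linear form, leads to q polynomials of degree at
    most [2 * d0], the polar equations f. For all c in a box of small values, the fibre
    f = c contains points close to all the chosen ones ([polar_fibers]), while
    it stays close to Z on bounded sets ([polar_decomp]).

    Give each member of [P] four thresholds, one pair around 0 and one pair
    farther away. In a compact neighbourhood of a piece, minimise the distance
    to a centre on the fibre f = c, subject to the thresholds that the sign
    condition of the piece imposes. The minimiser is a critical point of the
    distance, constrained by f = c and by the thresholds that it reaches: with
    an active set I of members of [P] and one of four thresholds for each, it
    solves a Lagrange system in the point and the multipliers. A penalised
    minimisation proves this for parameters that are dense in a box
    ([penalty_critical], [params_for_pieces]), and a dense semi-algebraic set
    contains an open dense one ([dense_generic]).

    For generic right-hand sides the Lagrange system has at most as many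
    solutions as its two-block Bezout number ([generic_fiber_bound],
    [cnt_lagrange]), which is at most the binomial coefficient of k and q + #I
    times the product of the degrees of the constraints and of a power of the
    largest degree; it vanishes if #I exceeds p. Summing over I and over the
    [4 ^ #|I|] choices of thresholds gives the bound ([count_critical],
    [count_realizations]). If p = k, the zero set of [Q] is treated as a
    hypersurface, with q = 1, or is the whole space, with q = 0.

    The Bezout bound itself is linear algebra. Modulo a system of products of
    affine forms the functions of given bidegree are generated by as many
    elements as the Bezout number says ([spans_linprod]). This persists under
    a generic deformation, where a dimension count yields, for every linear
    form, an algebraic relation of that degree over the values of the system;
    such a relation survives in the limit ([algebraic_relation]).

    Over a general real closed field all topological arguments are about
    semi-algebraic sets. These are closed under first-order definitions
    ([semialgebraicE]), and compactness is replaced by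
    [definable_compactness]. *)

Set Implicit Arguments.
Unset Strict Implicit.
Unset Printing Implicit Defensive.
Import Order.TTheory GRing.Theory Num.Theory.
Import numFieldTopology.Exports.
Local Open Scope classical_set_scope.
Local Open Scope ring_scope.

(** * Sets with a first-order definition are semi-algebraic *)

Section SemialgebraicClosure.
Variable R : rcfType.

Definition pt_env n (x : 'rV[R]_n) : seq R := [seq x 0 i | i <- enum 'I_n].

Lemma size_pt_env n (x : 'rV[R]_n) : size (pt_env x) = n.
Proof. by rewrite size_map size_enum_ord. Qed.

Lemma nth_pt_env n (x : 'rV[R]_n) (i : 'I_n) : nth 0 (pt_env x) i = x 0 i.
Proof. by rewrite (nth_map i) ?size_enum_ord // nth_ord_enum. Qed.

(** Definability by a first-order formula whose first free variables are the
    coordinates. *)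
Definition fdef n (A : set 'rV[R]_n) : Prop :=
  exists f : ord.formula R, forall x, A x <-> ord.holds (pt_env x) f.

Lemma term_of_mpoly n (p : {mpoly R[n]}) : exists t : GRing.term R,
  forall x : 'rV[R]_n, GRing.eval (pt_env x) t = p.@[x 0].
Proof.
elim/mpolyind: p => [|c m p _ _ [t tP]].
  by exists (GRing.Const 0) => x; rewrite meval0.
pose mon := foldr (fun i : 'I_n => GRing.Mul (GRing.Exp (GRing.Var R i) (m i)))
              (GRing.Const 1) (enum 'I_n).
exists (GRing.Add (GRing.Mul (GRing.Const c) mon) t) => x /=.
rewrite tP mevalD mevalZ mevalX; congr (_ * _ + _).
rewrite -big_enum /mon; elim: (enum 'I_n) => [|i s IH] /=.
  by rewrite big_nil.
by rewrite IH big_cons nth_pt_env.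
Qed.

Lemma mpoly_of_term n (t : GRing.term R) : GRing.rterm t ->
  exists p : {mpoly R[n]}, forall x : 'rV[R]_n, GRing.eval (pt_env x) t = p.@[x 0].
Proof.
elim: t => //=.
- move=> i _; case: (ltnP i n) => hi.
    by exists 'X_(Ordinal hi) => x; rewrite mevalXU -nth_pt_env.
  by exists 0 => x; rewrite meval0 nth_default // size_pt_env.
- by move=> c _; exists c%:MP => x; rewrite mevalC.
- by move=> k _; exists (k%:R)%:MP => x; rewrite mevalC.
- move=> t1 IH1 t2 IH2 /andP[/IH1[p1 h1] /IH2[p2 h2]].
  by exists (p1 + p2) => x; rewrite h1 h2 mevalD.
- by move=> t1 IH1 /IH1[p1 h1]; exists (- p1) => x; rewrite h1 mevalN.
- by move=> t1 IH1 k /IH1[p1 h1]; exists (p1 *+ k) => x; rewrite h1 mevalMn.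
- move=> t1 IH1 t2 IH2 /andP[/IH1[p1 h1] /IH2[p2 h2]].
  by exists (p1 * p2) => x; rewrite h1 h2 mevalM.
- by move=> t1 IH1 k /IH1[p1 h1]; exists (p1 ^+ k) => x; rewrite h1 rmorphXn.
Qed.

Lemma semialgebraic_ext n (A B : set 'rV[R]_n) :
  (forall x, A x <-> B x) -> semialgebraic A -> semialgebraic B.
Proof. by move=> AB; have -> : A = B by apply/seteqP; split => x /AB. Qed.

Lemma sa_true n : semialgebraic [set: 'rV[R]_n].
Proof.
apply: semialgebraic_ext (semialgebraic_eq0 0).
by move=> x; rewrite /= meval0.
Qed.

Lemma sa_and n (A B : set 'rV[R]_n) : semialgebraic A -> semialgebraic B ->
  semialgebraic (fun x => A x /\ B x).
Proof. exact: semialgebraic_setI. Qed.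

Lemma sa_or n (A B : set 'rV[R]_n) : semialgebraic A -> semialgebraic B ->
  semialgebraic (fun x => A x \/ B x).
Proof. exact: semialgebraic_setU. Qed.

Lemma sa_not n (A : set 'rV[R]_n) : semialgebraic A ->
  semialgebraic (fun x => ~ A x).
Proof. exact: semialgebraic_setC. Qed.

Lemma sa_imp n (A B : set 'rV[R]_n) : semialgebraic A -> semialgebraic B ->
  semialgebraic (fun x => A x -> B x).
Proof.
move=> sA sB; apply: semialgebraic_ext (sa_or (sa_not sA) sB) => x.
by split=> [[nA /nA //|//]|]; case: (pselect (A x)) => ax h; [right; exact: h|left].
Qed.

(** Quantifier elimination reduces a formula to a boolean combination of
    polynomial conditions. *)
Lemma semialgebraicE n (A : set 'rV[R]_n) : semialgebraic A <-> fdef A.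
Proof.
split.
  elim=> {A}.
  - move=> p; have [t tP] := term_of_mpoly p.
    exists (ord.Equal t (GRing.Const 0)) => x /=.
    by rewrite tP.
  - move=> p; have [t tP] := term_of_mpoly p.
    by exists (ord.Lt (GRing.Const 0) t) => x /=; rewrite tP.
  - by move=> A B _ [f fP] _ [g gP]; exists (ord.Or f g) => x /=; rewrite -fP -gP.
  - by move=> A B _ [f fP] _ [g gP]; exists (ord.And f g) => x /=; rewrite -fP -gP.
  - by move=> A _ [f fP]; exists (ord.Not f) => x /=; rewrite -fP.
move=> [f fP].
pose g := ord.quantifier_elim (@wproj R) (ord.to_rform f).
have /andP[qg rg] : ord.qf_form g && ord.rformula g.
  by apply: ord.quantifier_elim_wf (ord.to_rform_rformula f); exact: wf_QE_wproj.
have {}fP x : A x <-> ord.holds (pt_env x) g.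
  rewrite fP; apply: (iff_trans (rwP (rcf_satP (pt_env x) f))).
  by apply: iff_sym; apply: (iff_trans (rwP (ord.qf_evalP (pt_env x) qg))).
apply: (semialgebraic_ext (A := fun x => ord.holds (pt_env x) g)).
  by move=> x; rewrite fP.
elim: g qg rg {fP} => //=.
- case=> _ _; first by apply: semialgebraic_ext (sa_true n) => x; split.
  by apply: semialgebraic_ext (sa_not (sa_true n)) => x /=; split=> // h; case: h.
- move=> t1 t2 _ /andP[/(mpoly_of_term n)[p1 h1] /(mpoly_of_term n)[p2 h2]].
  apply: semialgebraic_ext (semialgebraic_eq0 (p1 - p2)) => x /=.
  by rewrite h1 h2 mevalB; split=> [/subr0_eq|->]; rewrite ?subrr.
- move=> t1 t2 _ /andP[/(mpoly_of_term n)[p1 h1] /(mpoly_of_term n)[p2 h2]].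
  apply: semialgebraic_ext (semialgebraic_gt0 (p2 - p1)) => x /=.
  by rewrite h1 h2 mevalB subr_gt0.
- move=> t1 t2 _ /andP[/(mpoly_of_term n)[p1 h1] /(mpoly_of_term n)[p2 h2]].
  apply: semialgebraic_ext (sa_not (semialgebraic_gt0 (p1 - p2))) => x /=.
  by rewrite h1 h2 mevalB subr_gt0 leNgt; split=> /negP.
- by move=> f1 IH1 f2 IH2 /andP[? ?] /andP[? ?]; apply: sa_and; auto.
- by move=> f1 IH1 f2 IH2 /andP[? ?] /andP[? ?]; apply: sa_or; auto.
- by move=> f1 IH1 f2 IH2 /andP[? ?] /andP[? ?]; apply: sa_imp; auto.
- by move=> f1 IH1 ? ?; apply: sa_not; auto.
Qed.

Fixpoint exists_block n m (f : ord.formula R) : ord.formula R :=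
  if m is m'.+1 then ord.Exists n (exists_block n.+1 m' f) else f.

Lemma holds_exists_block n m f (e : seq R) : size e = n ->
  ord.holds e (exists_block n m f) <->
  exists ys, size ys = m /\ ord.holds (e ++ ys) f.
Proof.
elim: m n e => [|m IH] n e se /=.
  split=> [h|[ys [/eqP/nilP ->]]]; last by rewrite cats0.
  by exists [::]; rewrite cats0.
have eS x : set_nth 0 e n x = rcons e x by rewrite -se; elim: e {se} => //= a e ->.
split=> [[x]|[[|x ys] [//= [sys] h]]].
  rewrite eS IH ?size_rcons ?se // => -[ys [sys h]].
  by exists (x :: ys); rewrite /= sys -cat_rcons.
by exists x; rewrite eS IH ?size_rcons ?se //; exists ys; rewrite cat_rcons.
Qed.

Lemma pt_env_row_mx n m (x : 'rV[R]_n) (y : 'rV[R]_m) :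
  pt_env (row_mx x y) = pt_env x ++ pt_env y.
Proof.
apply: (@eq_from_nth _ 0); rewrite ?size_cat !size_pt_env // => i hi.
rewrite -[i]/(val (Ordinal hi)) nth_pt_env nth_cat size_pt_env.
case: (fintype.splitP (Ordinal hi)) => j jE.
  by rewrite (_ : Ordinal hi = lshift m j) ?row_mxEl /= ?ltn_ord ?nth_pt_env //; apply: val_inj.
rewrite (_ : Ordinal hi = rshift n j) ?row_mxEr /= ?ltnNge ?leq_addr ?addKn ?nth_pt_env //.
exact: val_inj.
Qed.

(** An existential block in front of the formula that defines the relation. *)
Lemma sa_exV n m (P : 'rV[R]_n -> 'rV[R]_m -> Prop) :
  semialgebraic (fun z : 'rV[R]_(n + m) => P (lsubmx z) (rsubmx z)) ->
  semialgebraic (fun x => exists y, P x y).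
Proof.
move=> /semialgebraicE[f fP]; apply/semialgebraicE.
exists (exists_block n m f) => x; rewrite holds_exists_block ?size_pt_env //.
split=> [[y Pxy]|[ys [sys h]]].
  exists (pt_env y); rewrite size_pt_env -pt_env_row_mx; split=> //.
  by apply/fP; rewrite row_mxKl row_mxKr.
pose y : 'rV[R]_m := \row_i nth 0 ys i.
have yE : pt_env y = ys.
  apply: (@eq_from_nth _ 0); rewrite ?size_pt_env ?sys // => i hi.
  by rewrite -[i]/(val (Ordinal hi)) nth_pt_env mxE.
exists y; move: h; rewrite -yE -pt_env_row_mx => /fP.
by rewrite row_mxKl row_mxKr.
Qed.

Lemma sa_allV n m (P : 'rV[R]_n -> 'rV[R]_m -> Prop) :
  semialgebraic (fun z : 'rV[R]_(n + m) => P (lsubmx z) (rsubmx z)) ->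
  semialgebraic (fun x => forall y, P x y).
Proof.
move=> h; apply: (semialgebraic_ext _ (sa_not (sa_exV (P := fun x y => ~ P x y) (sa_not h)))).
move=> x; split=> [h1 y|h1 [y]]; last by apply; apply: h1.
by apply: contrapT => h2; apply: h1; exists y.
Qed.

Lemma sa_exR n (P : 'rV[R]_n -> R -> Prop) :
  semialgebraic (fun z : 'rV[R]_(n + 1) => P (lsubmx z) (rsubmx z 0 0)) ->
  semialgebraic (fun x => exists y, P x y).
Proof.
move=> h; apply: (semialgebraic_ext _ (sa_exV (P := fun x (y : 'rV[R]_1) => P x (y 0 0)) h)).
move=> x; split=> [[y h1]|[y h1]]; first by exists (y 0 0).
by exists (const_mx y); rewrite mxE.
Qed.

Lemma sa_allR n (P : 'rV[R]_n -> R -> Prop) :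
  semialgebraic (fun z : 'rV[R]_(n + 1) => P (lsubmx z) (rsubmx z 0 0)) ->
  semialgebraic (fun x => forall y, P x y).
Proof.
move=> h; apply: (semialgebraic_ext _ (sa_not (sa_exR (P := fun x y => ~ P x y) (sa_not h)))).
move=> x; split=> [h1 y|h1 [y]]; last by apply; apply: h1.
by apply: contrapT => h2; apply: h1; exists y.
Qed.

Lemma sa_cst n (P : Prop) : semialgebraic (fun _ : 'rV[R]_n => P).
Proof.
case: (pselect P) => h.
  by apply: semialgebraic_ext (sa_true n) => x; split.
by apply: semialgebraic_ext (sa_not (sa_true n)) => x; split=> // nt; case: nt.
Qed.

Lemma sa_all_seq n (T : eqType) (s : seq T) (P : T -> 'rV[R]_n -> Prop) :
  (forall i, semialgebraic (P i)) ->
  semialgebraic (fun x => forall i, i \in s -> P i x).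
Proof.
move=> h; elim: s => [|i s IH].
  by apply: semialgebraic_ext (sa_true n) => x; split.
apply: semialgebraic_ext (sa_and (h i) IH) => x; split.
  by move=> [hi hs] j; rewrite inE => /predU1P[->//|]; exact: hs.
by move=> hs; split=> [|j hj]; apply: hs; rewrite inE ?eqxx ?hj ?orbT.
Qed.

Lemma sa_all n (T : finType) (P : T -> 'rV[R]_n -> Prop) :
  (forall i, semialgebraic (P i)) -> semialgebraic (fun x => forall i, P i x).
Proof.
move=> h; apply: semialgebraic_ext (sa_all_seq (enum T) h) => x.
by split=> hx i => [|_]; apply: hx; rewrite mem_enum.
Qed.

Lemma sa_ex n (T : finType) (P : T -> 'rV[R]_n -> Prop) :
  (forall i, semialgebraic (P i)) -> semialgebraic (fun x => exists i, P i x).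
Proof.
move=> h; have hn i : semialgebraic (fun x => ~ P i x) by apply: sa_not.
apply: semialgebraic_ext (sa_not (sa_all hn)) => x; split.
  by move=> /existsNP[i /contrapT hi]; exists i.
by move=> [i hi] /(_ i).
Qed.

(** The coordinates form a tuple because this is what polynomials are composed
    with. *)
Definition pmap n m (F : 'rV[R]_n -> 'rV[R]_m) : Prop :=
  exists l : m.-tuple {mpoly R[n]}, forall x i, F x 0 i = (tnth l i).@[x 0].

Lemma pmapP n m (F : 'rV[R]_n -> 'rV[R]_m) :
  (forall i, exists p : {mpoly R[n]}, forall x, F x 0 i = p.@[x 0]) -> pmap F.
Proof.
move=> /choice[p hp]; exists [tuple p i | i < m] => x i.
by rewrite tnth_mktuple hp.
Qed.

Lemma sa_pmap n m (F : 'rV[R]_n -> 'rV[R]_m) (A : set 'rV[R]_m) :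
  pmap F -> semialgebraic A -> semialgebraic (fun x => A (F x)).
Proof.
move=> [l hl]; have hm p x : p.@[F x 0] = (p \mPo l).@[x 0].
  by rewrite comp_mpoly_meval; apply: meval_eq => i.
elim=> {A}.
- by move=> p; apply: semialgebraic_ext (semialgebraic_eq0 (p \mPo l)) => x /=; rewrite hm.
- by move=> p; apply: semialgebraic_ext (semialgebraic_gt0 (p \mPo l)) => x /=; rewrite hm.
- by move=> A B _ hA _ hB; apply: sa_or.
- by move=> A B _ hA _ hB; apply: sa_and.
- by move=> A _ hA; apply: sa_not.
Qed.

Lemma pmap_coord n m (F : 'rV[R]_n -> 'rV[R]_m) (s : 'I_m -> 'I_n) :
  (forall x i, F x 0 i = x 0 (s i)) -> pmap F.
Proof. by move=> h; apply: pmapP => i; exists 'X_(s i) => x; rewrite mevalXU h. Qed.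

Lemma pmap_id n : pmap (@id 'rV[R]_n).
Proof. exact: (@pmap_coord _ _ _ id). Qed.

Lemma pmap_comp n m l (F : 'rV[R]_m -> 'rV[R]_l) (G : 'rV[R]_n -> 'rV[R]_m) :
  pmap F -> pmap G -> pmap (fun x => F (G x)).
Proof.
move=> [lF hF] [lG hG]; apply: pmapP => i; exists (tnth lF i \mPo lG) => x.
by rewrite comp_mpoly_meval hF; apply: meval_eq => j.
Qed.

Lemma pmap_lsub n m l (F : 'rV[R]_n -> 'rV[R]_(m + l)) :
  pmap F -> pmap (fun x => lsubmx (F x)).
Proof.
move=> hF; apply: (@pmap_comp _ _ _ (@lsubmx R 1 m l)) => //.
by apply: (pmap_coord (s := lshift l)) => x i; rewrite mxE.
Qed.

Lemma pmap_rsub n m l (F : 'rV[R]_n -> 'rV[R]_(m + l)) :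
  pmap F -> pmap (fun x => rsubmx (F x)).
Proof.
move=> hF; apply: (@pmap_comp _ _ _ (@rsubmx R 1 m l)) => //.
by apply: (pmap_coord (s := @rshift m l)) => x i; rewrite mxE.
Qed.

(** The last coordinate of a point of the graph carries the value. *)
Definition safun n (f : 'rV[R]_n -> R) : Prop :=
  semialgebraic (fun z : 'rV[R]_(n + 1) => rsubmx z 0 0 = f (lsubmx z)).

Lemma sa_eq_mpoly n (p q : {mpoly R[n]}) :
  semialgebraic (fun x : 'rV[R]_n => p.@[x 0] = q.@[x 0]).
Proof.
apply: semialgebraic_ext (semialgebraic_eq0 (p - q)) => x /=.
by rewrite mevalB; split=> [/subr0_eq|->]; rewrite ?subrr.
Qed.

Lemma sa_lt_mpoly n (p q : {mpoly R[n]}) :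
  semialgebraic (fun x : 'rV[R]_n => p.@[x 0] < q.@[x 0]).
Proof.
apply: semialgebraic_ext (semialgebraic_gt0 (q - p)) => x /=.
by rewrite mevalB subr_gt0.
Qed.

Lemma pmap_mpoly n m (F : 'rV[R]_n -> 'rV[R]_m) (p : {mpoly R[m]}) : pmap F ->
  exists q : {mpoly R[n]}, forall x, p.@[F x 0] = q.@[x 0].
Proof.
move=> [l hl]; exists (p \mPo l) => x; rewrite comp_mpoly_meval.
by apply: meval_eq => i; rewrite hl.
Qed.

Lemma safun_meval n m (p : {mpoly R[m]}) (F : 'rV[R]_n -> 'rV[R]_m) : pmap F ->
  safun (fun x => p.@[F x 0]).
Proof.
move=> hF; have [q hq] := pmap_mpoly p hF; rewrite /safun.
have [q' hq'] := pmap_mpoly q (pmap_lsub (l := 1) (pmap_id (n + 1))).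
apply: semialgebraic_ext (sa_eq_mpoly 'X_(rshift n ord0) q') => z.
by rewrite mevalXU -hq' hq mxE.
Qed.

Lemma safun_coord n m (F : 'rV[R]_n -> 'rV[R]_m) i : pmap F ->
  safun (fun x => F x 0 i).
Proof.
move=> hF; have := safun_meval 'X_i hF.
by congr safun; apply: funext => x; rewrite mevalXU.
Qed.

Lemma safun_cst n (c : R) : safun (fun _ : 'rV[R]_n => c).
Proof.
have := safun_meval c%:MP (pmap_id n).
by congr safun; apply: funext => x; rewrite mevalC.
Qed.

(** The preimage is the projection of the part of the graph of [F] that lies
    over [A]. *)
Lemma sa_preim n m (F : 'rV[R]_n -> 'rV[R]_m) (A : set 'rV[R]_m) :
  (forall i, safun (fun x => F x 0 i)) -> semialgebraic A ->
  semialgebraic (fun x => A (F x)).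
Proof.
move=> hF hA.
have h : semialgebraic (fun z : 'rV[R]_(n + m) =>
    A (rsubmx z) /\ forall i, rsubmx z 0 i = F (lsubmx z) 0 i).
  apply: sa_and; first by apply: sa_pmap hA; apply: pmap_rsub (pmap_id _).
  apply: sa_all => i.
  pose G (z : 'rV[R]_(n + m)) : 'rV[R]_(n + 1) := row_mx (lsubmx z) (\row_j rsubmx z 0 i).
  have hG : pmap G.
    apply: (@pmap_coord _ _ G (fun j : 'I_(n + 1) =>
      match fintype.split j with inl j => lshift m j | inr _ => rshift n i end)).
    by move=> x j; rewrite mxE; case: (fintype.split j) => j'; rewrite !mxE.
  apply: semialgebraic_ext (sa_pmap hG (hF i)) => z.
  by rewrite /G row_mxKl row_mxKr mxE.
apply: semialgebraic_ext (sa_exV (P := fun x y => A y /\ forall i, y 0 i = F x 0 i) h).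
move=> x; split=> [[y [Ay hy]]|Ax]; last by exists (F x).
by have -> : F x = y by apply/rowP => i; rewrite hy.
Qed.

Lemma sa_eq n (f g : 'rV[R]_n -> R) : safun f -> safun g ->
  semialgebraic (fun x => f x = g x).
Proof.
move=> hf hg; pose F x : 'rV[R]_2 := \row_(i < 2) (if i == 0 then f x else g x).
have hF i : safun (fun x => F x 0 i).
  by case: (eqVneq i 0) => hi; [move: hf|move: hg]; congr safun; apply: funext => x;
   rewrite mxE ?hi ?eqxx // (negbTE hi).
apply: semialgebraic_ext (sa_preim hF (sa_eq_mpoly 'X_0 'X_1)) => x.
by rewrite !mevalXU !mxE.
Qed.

Lemma sa_lt n (f g : 'rV[R]_n -> R) : safun f -> safun g ->
  semialgebraic (fun x => f x < g x).
Proof.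
move=> hf hg; pose F x : 'rV[R]_2 := \row_(i < 2) (if i == 0 then f x else g x).
have hF i : safun (fun x => F x 0 i).
  by case: (eqVneq i 0) => hi; [move: hf|move: hg]; congr safun; apply: funext => x;
   rewrite mxE ?hi ?eqxx // (negbTE hi).
apply: semialgebraic_ext (sa_preim hF (sa_lt_mpoly 'X_0 'X_1)) => x.
by rewrite !mevalXU !mxE.
Qed.

Lemma sa_le n (f g : 'rV[R]_n -> R) : safun f -> safun g ->
  semialgebraic (fun x => f x <= g x).
Proof.
move=> hf hg; apply: semialgebraic_ext (sa_not (sa_lt hg hf)) => x.
by rewrite leNgt; split=> /negP.
Qed.

Lemma safun_pmap n m (f : 'rV[R]_m -> R) (F : 'rV[R]_n -> 'rV[R]_m) :
  pmap F -> safun f -> safun (fun x => f (F x)).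
Proof.
move=> hF hf; rewrite /safun.
pose G (z : 'rV[R]_(n + 1)) : 'rV[R]_(m + 1) := row_mx (F (lsubmx z)) (rsubmx z).
have hG : pmap G.
  have [l hl] := pmap_comp hF (pmap_lsub (l := 1) (pmap_id (n + 1))).
  apply: pmapP => j; case: (fintype.splitP j) => j' jE.
    by exists (tnth l j') => x; rewrite -hl (_ : j = lshift 1 j') ?row_mxEl //; apply: val_inj.
  exists 'X_(rshift n j') => x.
  by rewrite mevalXU (_ : j = rshift m j') ?row_mxEr ?mxE //; apply: val_inj.
apply: semialgebraic_ext (sa_pmap hG hf) => z.
by rewrite /G row_mxKl row_mxKr.
Qed.

Lemma safun_comp n m (f : 'rV[R]_m -> R) (F : 'rV[R]_n -> 'rV[R]_m) :
  (forall i, safun (fun x => F x 0 i)) -> safun f -> safun (fun x => f (F x)).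
Proof.
move=> hF hf; rewrite /safun.
pose G (z : 'rV[R]_(n + 1)) : 'rV[R]_(m + 1) := row_mx (F (lsubmx z)) (rsubmx z).
have hG j : safun (fun z => G z 0 j).
  case: (fintype.splitP j) => j' jE.
    have := safun_pmap (pmap_lsub (l := 1) (pmap_id (n + 1))) (hF j').
    congr safun; apply: funext => z; rewrite /G (_ : j = lshift 1 j') ?row_mxEl //.
    exact: val_inj.
  have := safun_coord j' (pmap_rsub (l := 1) (pmap_id (n + 1))).
  congr safun; apply: funext => z; rewrite /G (_ : j = rshift m j') ?row_mxEr //.
  exact: val_inj.
apply: semialgebraic_ext (sa_preim hG hf) => z.
by rewrite /G row_mxKl row_mxKr.
Qed.

Lemma safun_op2 n (p : {mpoly R[2]}) (f g : 'rV[R]_n -> R) : safun f -> safun g ->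
  safun (fun x => p.@[fun i => if i == 0 then f x else g x]).
Proof.
move=> hf hg; pose F x : 'rV[R]_2 := \row_(i < 2) (if i == 0 then f x else g x).
have hF i : safun (fun x => F x 0 i).
  by case: (eqVneq i 0) => hi; [move: hf|move: hg]; congr safun; apply: funext => x;
   rewrite mxE ?hi ?eqxx // (negbTE hi).
have := safun_comp hF (safun_meval p (pmap_id 2)).
by congr safun; apply: funext => x; apply: meval_eq => i; rewrite mxE.
Qed.

Lemma safun_add n (f g : 'rV[R]_n -> R) : safun f -> safun g -> safun (fun x => f x + g x).
Proof.
move=> hf hg; have := safun_op2 ('X_0 + 'X_1) hf hg.
by congr safun; apply: funext => x; rewrite mevalD !mevalXU.
Qed.

Lemma safun_mul n (f g : 'rV[R]_n -> R) : safun f -> safun g -> safun (fun x => f x * g x).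
Proof.
move=> hf hg; have := safun_op2 ('X_0 * 'X_1) hf hg.
by congr safun; apply: funext => x; rewrite mevalM !mevalXU.
Qed.

Lemma safun_opp n (f : 'rV[R]_n -> R) : safun f -> safun (fun x => - f x).
Proof.
move=> hf; have := safun_op2 (- 'X_0) hf hf.
by congr safun; apply: funext => x; rewrite mevalN !mevalXU.
Qed.

Lemma safun_exp n (f : 'rV[R]_n -> R) k : safun f -> safun (fun x => f x ^+ k).
Proof.
move=> hf; elim: k => [|k IH]; first exact: safun_cst.
by have := safun_mul hf IH; congr safun; apply: funext => x; rewrite exprS.
Qed.

Lemma safun_sum n (T : Type) (s : seq T) (P : pred T) (f : T -> 'rV[R]_n -> R) :
  (forall i, safun (f i)) -> safun (fun x => \sum_(i <- s | P i) f i x).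
Proof.
move=> hf; elim: s => [|i s IH].
  by have := safun_cst n 0; congr safun; apply: funext => x; rewrite big_nil.
case Pi: (P i); last first.
  by move: IH; congr safun; apply: funext => x; rewrite big_cons Pi.
by have := safun_add (hf i) IH; congr safun; apply: funext => x; rewrite big_cons Pi.
Qed.

Lemma safun_if n (b : 'rV[R]_n -> bool) (f g : 'rV[R]_n -> R) :
  semialgebraic (fun x => b x) -> safun f -> safun g ->
  safun (fun x => if b x then f x else g x).
Proof.
move=> hb hf hg; rewrite /safun.
have hb' := sa_pmap (pmap_lsub (l := 1) (pmap_id (n + 1))) hb.
apply: semialgebraic_ext (sa_or (sa_and hb' hf) (sa_and (sa_not hb') hg)) => z.
by case: (b (lsubmx z)); split=> [[[]|[]]|] //; by [left|right].
Qed.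

Lemma safun_max n (f g : 'rV[R]_n -> R) : safun f -> safun g ->
  safun (fun x => Num.max (f x) (g x)).
Proof.
by move=> hf hg; rewrite /Order.max; apply: safun_if; first exact: sa_lt.
Qed.

End SemialgebraicClosure.

Section SemialgebraicVectors.
Variable R : rcfType.

Definition savec n m (F : 'rV[R]_n -> 'rV[R]_m) : Prop :=
  forall i, safun (fun x => F x 0 i).

Lemma savec_id n : savec (fun x : 'rV[R]_n => x).
Proof. by move=> i; apply: safun_coord; apply: pmap_id. Qed.

Lemma savec_cst n m (v : 'rV[R]_m) : savec (fun _ : 'rV[R]_n => v).
Proof. by move=> i; apply: safun_cst. Qed.

Lemma savec_lsub n m l (F : 'rV[R]_n -> 'rV[R]_(m + l)) :
  savec F -> savec (fun x => lsubmx (F x)).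
Proof. by move=> hF i; have := hF (lshift l i); congr safun; apply: funext => x; rewrite mxE. Qed.

Lemma savec_rsub n m l (F : 'rV[R]_n -> 'rV[R]_(m + l)) :
  savec F -> savec (fun x => rsubmx (F x)).
Proof. by move=> hF i; have := hF (rshift m i); congr safun; apply: funext => x; rewrite mxE. Qed.

Lemma savec_row_mx n m l (F : 'rV[R]_n -> 'rV[R]_m) (G : 'rV[R]_n -> 'rV[R]_l) :
  savec F -> savec G -> savec (fun x => row_mx (F x) (G x)).
Proof.
move=> hF hG i; case: (fintype.splitP i) => j jE.
  have := hF j; congr safun; apply: funext => x.
  by rewrite (_ : i = lshift l j) ?row_mxEl //; apply: val_inj.
have := hG j; congr safun; apply: funext => x.
by rewrite (_ : i = rshift m j) ?row_mxEr //; apply: val_inj.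
Qed.

Lemma savec_add n m (F G : 'rV[R]_n -> 'rV[R]_m) :
  savec F -> savec G -> savec (fun x => F x + G x).
Proof.
move=> hF hG i; have := safun_add (hF i) (hG i).
by congr safun; apply: funext => x; rewrite mxE.
Qed.

Lemma savec_opp n m (F : 'rV[R]_n -> 'rV[R]_m) : savec F -> savec (fun x => - F x).
Proof.
move=> hF i; have := safun_opp (hF i).
by congr safun; apply: funext => x; rewrite mxE.
Qed.

Lemma savec_scale n m (c : 'rV[R]_n -> R) (F : 'rV[R]_n -> 'rV[R]_m) :
  safun c -> savec F -> savec (fun x => c x *: F x).
Proof.
move=> hc hF i; have := safun_mul hc (hF i).
by congr safun; apply: funext => x; rewrite mxE.
Qed.

Lemma savec_const_mx n m (f : 'rV[R]_n -> R) : safun f ->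
  savec (fun x => const_mx (f x) : 'rV[R]_m).
Proof. by move=> hf i; move: hf; congr safun; apply: funext => x; rewrite mxE. Qed.

Lemma savec_mulmx n m l (F : 'rV[R]_n -> 'rV[R]_m) (W : 'M[R]_(m, l)) :
  savec F -> savec (fun x => F x *m W).
Proof.
move=> hF i; have := safun_sum (index_enum 'I_m) xpredT
  (fun j => safun_mul (hF j) (safun_cst n (W j i))).
by congr safun; apply: funext => x; rewrite mxE.
Qed.

Lemma savec_row n m (f : 'I_m -> 'rV[R]_n -> R) : (forall i, safun (f i)) ->
  savec (fun x => \row_i f i x).
Proof. by move=> hf i; have := hf i; congr safun; apply: funext => x; rewrite mxE. Qed.

Lemma safun_entry n m (F : 'rV[R]_n -> 'rV[R]_m) i j : savec F ->
  safun (fun x => F x i j).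
Proof. by move=> hF; rewrite ord1; exact: hF. Qed.

Lemma safun_eval n m (p : {mpoly R[m]}) (F : 'rV[R]_n -> 'rV[R]_m) : savec F ->
  safun (fun x => p.@[F x 0]).
Proof. by move=> hF; exact (@safun_comp _ _ _ (fun y => p.@[y 0]) F hF (safun_meval p (pmap_id R m))). Qed.

Lemma safun_norm n (f : 'rV[R]_n -> R) : safun f -> safun (fun x => `|f x|).
Proof.
move=> hf; have := safun_max hf (safun_opp hf).
congr safun; apply: funext => x; case: (ger0P (f x)) => h.
  by apply/max_idPl; lra.
by apply/max_idPr; lra.
Qed.

Lemma sa_veq n m (F G : 'rV[R]_n -> 'rV[R]_m) : savec F -> savec G ->
  semialgebraic (fun x => F x = G x).
Proof.
move=> hF hG; have h : semialgebraic (fun x => forall i, F x 0 i = G x 0 i).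
  by apply: sa_all => i; apply: sa_eq.
by apply: semialgebraic_ext h => x; split=> [/rowP|->].
Qed.

(** Substitution into a relation given by its semi-algebraic graph, in the form
    needed for relations that are not yet applied to a single vector. *)
Lemma sa_rel n m l (P : 'rV[R]_n -> 'rV[R]_m -> Prop)
    (F : 'rV[R]_l -> 'rV[R]_n) (G : 'rV[R]_l -> 'rV[R]_m) :
  semialgebraic (fun z : 'rV[R]_(n + m) => P (lsubmx z) (rsubmx z)) ->
  savec F -> savec G -> semialgebraic (fun x => P (F x) (G x)).
Proof.
move=> hP hF hG; apply: semialgebraic_ext (sa_preim (savec_row_mx hF hG) hP) => x.
by rewrite row_mxKl row_mxKr.
Qed.

Lemma sa_relR n l (P : 'rV[R]_n -> R -> Prop) (F : 'rV[R]_l -> 'rV[R]_n)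
    (g : 'rV[R]_l -> R) :
  semialgebraic (fun z : 'rV[R]_(n + 1) => P (lsubmx z) (rsubmx z 0 0)) ->
  savec F -> safun g -> semialgebraic (fun x => P (F x) (g x)).
Proof.
move=> hP hF hg.
have := sa_rel (P := fun x (y : 'rV[R]_1) => P x (y 0 0)) hP hF (savec_const_mx (m := 1) hg).
by apply: semialgebraic_ext => x; rewrite mxE.
Qed.

End SemialgebraicVectors.

(** Every connective, quantifier and operation has its closure lemma; hypotheses
    on set and function variables settle the atoms. *)
Ltac sa_step :=
  match goal with
  | |- semialgebraic (fun x => _ /\ _) => apply: sa_and
  | |- semialgebraic (fun x => _ \/ _) => apply: sa_or
  | |- semialgebraic (fun x => ~ _) => apply: sa_not
  | |- semialgebraic (fun x => is_true (_ < _)) => apply: sa_lt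
  | |- semialgebraic (fun x => is_true (_ <= _)) => apply: sa_le
  | |- semialgebraic (fun x => @eq (matrix _ _ _) _ _) => apply: sa_veq
  | |- semialgebraic (fun x => @eq _ _ _) => apply: sa_eq
  | H : semialgebraic ?A |- semialgebraic (fun x => ?A (@?F x)) => apply: (@sa_preim _ _ _ F A)
  | |- semialgebraic (fun x => _ -> _) => apply: sa_imp
  | |- semialgebraic (fun x => exists y, _) =>
      first [apply: sa_ex => ? | apply: sa_exV | apply: sa_exR]
  | |- semialgebraic (fun x => forall y, _) =>
      first [apply: sa_all => ? | apply: sa_allV | apply: sa_allR]
  | |- semialgebraic (fun x => ?P) => apply: (sa_cst _ _ P)
  | |- safun (fun x => _ + _) => apply: safun_add
  | |- safun (fun x => _ * _) => apply: safun_mul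
  | |- safun (fun x => - _) => apply: safun_opp
  | |- safun (fun x => _ ^+ _) => apply: safun_exp
  | |- safun (fun x => `|_|) => apply: safun_norm
  | |- safun (fun x => Num.max _ _) => apply: safun_max
  | |- safun (fun x => ?c) => apply: (safun_cst _ c)
  | |- safun (fun x => bigop _ _ _) => apply: safun_sum => ?
  | |- safun (fun x => meval _ _) => apply: safun_eval
  | |- safun (fun x => fun_of_matrix _ _ _) => apply: safun_entry
  | H : safun ?f |- safun (fun x => ?f (@?F x)) => apply: (@safun_comp _ _ _ f F)
  | H : safun ?f |- safun ?f => exact: H
  | H : forall i, safun _ |- safun _ => solve [apply: H]
  | |- savec (fun x => x) => apply: savec_id
  | |- savec (fun x => ?c) => apply: (savec_cst _ c)
  | |- savec (fun x => lsubmx _) => apply: savec_lsub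
  | |- savec (fun x => rsubmx _) => apply: savec_rsub
  | |- savec (@lsubmx _ _ _ _) => apply: (savec_lsub (@savec_id _ _))
  | |- savec (@rsubmx _ _ _ _) => apply: (savec_rsub (@savec_id _ _))
  | |- savec (fun x => row_mx _ _) => apply: savec_row_mx
  | |- savec (fun x => _ + _) => apply: savec_add
  | |- savec (fun x => - _) => apply: savec_opp
  | |- savec (fun x => _ *: _) => apply: savec_scale
  | |- savec (fun x => _ *m _) => apply: savec_mulmx
  | |- savec (fun x => const_mx _) => apply: savec_const_mx
  | |- savec (fun x => \matrix_(i, j) _) => apply: savec_row => ?
  | |- forall i : ordinal _, safun (fun x => fun_of_matrix (@?F x) _ i) => change (savec F)
  | H : semialgebraic ?A |- semialgebraic ?A => exact: H
  end.
Ltac sa := repeat sa_step.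

(** * Boxes, continuity and closedness *)

Section Boxes.
Variable R : rcfType.

(** Boxes for the sup norm, written coordinatewise so that they are visibly
    first-order definable. *)
Definition bx n (x y : 'rV[R]_n) (e : R) : Prop := forall i, `|x 0 i - y 0 i| < e.

Lemma bx_refl n (x : 'rV[R]_n) e : 0 < e -> bx x x e.
Proof. by move=> h i; rewrite subrr normr0. Qed.

Lemma bx_le n (x y : 'rV[R]_n) d e : d <= e -> bx x y d -> bx x y e.
Proof. by move=> h h1 i; apply: lt_le_trans h. Qed.

(** Finitely many positive thresholds have a positive minimum; [P i] has to be
    stable under decreasing the threshold. *)
Lemma unif_seq (T : eqType) (s : seq T) (P : T -> R -> Prop) :
  (forall i d d', 0 < d' -> d' <= d -> P i d -> P i d') ->
  (forall i, i \in s -> exists d, 0 < d /\ P i d) ->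
  exists d, 0 < d /\ forall i, i \in s -> P i d.
Proof.
move=> mono; elim: s => [|i s IH] h; first by exists 1.
have [d1 [d1p h1]] := h i (mem_head _ _).
have [|d2 [d2p h2]] := IH; first by move=> j hj; apply: h; rewrite inE hj orbT.
have mp : 0 < Num.min d1 d2 by rewrite lt_min d1p.
exists (Num.min d1 d2); split=> // j; rewrite inE => /predU1P[->|hj].
  by apply: (mono _ d1) => //; rewrite ge_min lexx.
by apply: (mono _ d2) (h2 _ hj) => //; rewrite ge_min lexx orbT.
Qed.

Lemma unif_delta (T : finType) (P : T -> R -> Prop) :
  (forall i d d', 0 < d' -> d' <= d -> P i d -> P i d') ->
  (forall i, exists d, 0 < d /\ P i d) -> exists d, 0 < d /\ forall i, P i d.
Proof.
move=> mono h; have [|d [dp hd]] := unif_seq (s := enum T) mono; first by move=> i _.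
by exists d; split=> // i; apply: hd; rewrite mem_enum.
Qed.

Definition cont n (f : 'rV[R]_n -> R) : Prop :=
  forall x e, 0 < e -> exists d, 0 < d /\ forall y, bx x y d -> `|f x - f y| < e.

Definition contV n m (F : 'rV[R]_n -> 'rV[R]_m) : Prop :=
  forall i, cont (fun x => F x 0 i).

Lemma cont_cst n c : cont (fun _ : 'rV[R]_n => c).
Proof. by move=> x e e0; exists 1; split=> // y _; rewrite subrr normr0. Qed.

Lemma cont_add n (f g : 'rV[R]_n -> R) : cont f -> cont g -> cont (fun x => f x + g x).
Proof.
move=> hf hg x e e0; have e2 : 0 < e / 2 by lra.
have [d1 [d1p h1]] := hf x _ e2; have [d2 [d2p h2]] := hg x _ e2.
exists (Num.min d1 d2); split=> [|y hy]; first by rewrite lt_min d1p.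
have := h1 y (bx_le _ hy); have := h2 y (bx_le _ hy).
rewrite !ge_min !lexx orbT => /(_ isT) a2 /(_ isT) a1.
have -> : f x + g x - (f y + g y) = (f x - f y) + (g x - g y) by ring.
by apply: le_lt_trans (ler_normD _ _) _; lra.
Qed.

Lemma cont_opp n (f : 'rV[R]_n -> R) : cont f -> cont (fun x => - f x).
Proof.
move=> hf x e e0; have [d [dp h]] := hf x e e0; exists d; split=> // y hy.
by rewrite -opprD normrN; apply: h.
Qed.

Lemma cont_mul n (f g : 'rV[R]_n -> R) : cont f -> cont g -> cont (fun x => f x * g x).
Proof.
move=> hf hg x e e0; pose c := 1 + `|f x| + `|g x|.
have c0 : 0 < c by rewrite /c; have := normr_ge0 (f x); have := normr_ge0 (g x); lra.
pose h := Num.min 1 (e / c).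
have h0 : 0 < h by rewrite lt_min ltr01 divr_gt0.
have [d1 [d1p h1]] := hf x _ h0; have [d2 [d2p h2]] := hg x _ h0.
exists (Num.min d1 d2); split=> [|y hy]; first by rewrite lt_min d1p.
have := h1 y (bx_le _ hy); have := h2 y (bx_le _ hy).
rewrite !ge_min !lexx orbT => /(_ isT) a2 /(_ isT) a1.
have -> : f x * g x - f y * g y = (f x - f y) * g y + f x * (g x - g y) by ring.
have hh1 : h <= 1 by rewrite ge_min lexx.
have hhe : h * c <= e by rewrite -ler_pdivlMr // ge_min lexx orbT.
have gy : `|g y| <= `|g x| + 1.
  have -> : g y = g x - (g x - g y) by ring.
  by apply: le_trans (ler_normB _ _) _; lra.
apply: le_lt_trans (ler_normD _ _) _; rewrite !normrM.
have b1 : `|f x - f y| * `|g y| <= `|f x - f y| * (`|g x| + 1) by apply: ler_wpM2l.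
have b2 : `|f x - f y| * (`|g x| + 1) < h * (`|g x| + 1).
  by rewrite ltr_pM2r //; have := normr_ge0 (g x); lra.
have b3 : `|f x| * `|g x - g y| <= `|f x| * h by apply: ler_wpM2l => //; apply: ltW.
by move: hhe; rewrite /c; lra.
Qed.

Lemma cont_coord n i : cont (fun x : 'rV[R]_n => x 0 i).
Proof. by move=> x e e0; exists e; split=> // y /(_ i). Qed.

Lemma cont_norm n (f : 'rV[R]_n -> R) : cont f -> cont (fun x => `|f x|).
Proof.
move=> hf x e e0; have [d [dp h]] := hf x e e0; exists d; split=> // y hy.
exact: le_lt_trans (ler_dist_dist _ _) (h _ hy).
Qed.

Lemma cont_exp n (f : 'rV[R]_n -> R) k : cont f -> cont (fun x => f x ^+ k).
Proof.
move=> hf; elim: k => [|k IH]; first exact: cont_cst.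
by have := cont_mul hf IH; congr cont; apply: funext => x; rewrite exprS.
Qed.

Lemma cont_max n (f g : 'rV[R]_n -> R) : cont f -> cont g ->
  cont (fun x => Num.max (f x) (g x)).
Proof.
move=> hf hg.
have := cont_mul (cont_cst (1/2)) (cont_add (cont_add hf hg) (cont_norm (cont_add hf (cont_opp hg)))).
congr cont; apply: funext => x /=; case: (leP (f x) (g x)) => h.
  by rewrite ler0_norm; [field|lra].
by rewrite ger0_norm; [field|lra].
Qed.

Lemma cont_sum n (T : Type) (s : seq T) (P : pred T) (f : T -> 'rV[R]_n -> R) :
  (forall i, cont (f i)) -> cont (fun x => \sum_(i <- s | P i) f i x).
Proof.
move=> hf; elim: s => [|i s IH].
  by have := cont_cst (n := n) 0; congr cont; apply: funext => x; rewrite big_nil.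
case Pi: (P i); last first.
  by move: IH; congr cont; apply: funext => x; rewrite big_cons Pi.
by have := cont_add (hf i) IH; congr cont; apply: funext => x; rewrite big_cons Pi.
Qed.

Lemma cont_prod n (T : Type) (s : seq T) (P : pred T) (f : T -> 'rV[R]_n -> R) :
  (forall i, cont (f i)) -> cont (fun x => \prod_(i <- s | P i) f i x).
Proof.
move=> hf; elim: s => [|i s IH].
  by have := cont_cst (n := n) 1; congr cont; apply: funext => x; rewrite big_nil.
case Pi: (P i); last first.
  by move: IH; congr cont; apply: funext => x; rewrite big_cons Pi.
by have := cont_mul (hf i) IH; congr cont; apply: funext => x; rewrite big_cons Pi.
Qed.

Lemma cont_comp n m (f : 'rV[R]_m -> R) (F : 'rV[R]_n -> 'rV[R]_m) :
  contV F -> cont f -> cont (fun x => f (F x)).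
Proof.
move=> hF hf x e e0; have [d [dp h]] := hf (F x) e e0.
have [|i|d' [d'p h']] := @unif_delta 'I_m (fun i d' => forall y, bx x y d' -> `|F x 0 i - F y 0 i| < d).
- by move=> i d1 d2 _ d12 H y hy; apply/H/bx_le/hy.
- exact: hF.
by exists d'; split=> // y hy; apply: h => i; apply: h'.
Qed.

Lemma cont_meval n m (p : {mpoly R[m]}) (F : 'rV[R]_n -> 'rV[R]_m) : contV F ->
  cont (fun x => p.@[F x 0]).
Proof.
move=> hF; apply: (@cont_comp _ _ (fun y => p.@[y 0]) F hF).
have := cont_sum (msupp p) xpredT (fun m0 => cont_mul (cont_cst p@_m0)
  (cont_prod (index_enum 'I_m) xpredT (fun i => cont_exp (m0 i) (@cont_coord m i)))).
by congr cont; apply: funext => x; rewrite mevalE.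
Qed.

Lemma cont_entry n m (F : 'rV[R]_n -> 'rV[R]_m) i j : contV F -> cont (fun x => F x i j).
Proof. by move=> hF; rewrite ord1; exact: hF. Qed.

Lemma contV_id n : contV (fun x : 'rV[R]_n => x).
Proof. by move=> i; apply: cont_coord. Qed.

Lemma contV_cst n m (v : 'rV[R]_m) : contV (fun _ : 'rV[R]_n => v).
Proof. by move=> i; apply: cont_cst. Qed.

Lemma contV_lsub n m l (F : 'rV[R]_n -> 'rV[R]_(m + l)) :
  contV F -> contV (fun x => lsubmx (F x)).
Proof. by move=> hF i; have := hF (lshift l i); congr cont; apply: funext => x; rewrite mxE. Qed.

Lemma contV_rsub n m l (F : 'rV[R]_n -> 'rV[R]_(m + l)) :
  contV F -> contV (fun x => rsubmx (F x)).
Proof. by move=> hF i; have := hF (rshift m i); congr cont; apply: funext => x; rewrite mxE. Qed.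

Lemma contV_add n m (F G : 'rV[R]_n -> 'rV[R]_m) :
  contV F -> contV G -> contV (fun x => F x + G x).
Proof. by move=> hF hG i; have := cont_add (hF i) (hG i); congr cont; apply: funext => x; rewrite mxE. Qed.

Lemma contV_opp n m (F : 'rV[R]_n -> 'rV[R]_m) : contV F -> contV (fun x => - F x).
Proof. by move=> hF i; have := cont_opp (hF i); congr cont; apply: funext => x; rewrite mxE. Qed.

Lemma contV_scale n m (c : 'rV[R]_n -> R) (F : 'rV[R]_n -> 'rV[R]_m) :
  cont c -> contV F -> contV (fun x => c x *: F x).
Proof. by move=> hc hF i; have := cont_mul hc (hF i); congr cont; apply: funext => x; rewrite mxE. Qed.

Lemma contV_mulmx n m l (F : 'rV[R]_n -> 'rV[R]_m) (W : 'M[R]_(m, l)) :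
  contV F -> contV (fun x => F x *m W).
Proof.
move=> hF i; have := cont_sum (index_enum 'I_m) xpredT
  (fun j => cont_mul (hF j) (cont_cst (W j i))).
by congr cont; apply: funext => x; rewrite mxE.
Qed.

(** Sequences are avoided: over a general real closed field they need not reach
    the points of a closure. *)
Definition cl n (A : set 'rV[R]_n) : Prop :=
  forall x, (forall e, 0 < e -> exists y, A y /\ bx x y e) -> A x.

Definition bdd n (A : set 'rV[R]_n) : Prop :=
  exists M, forall x, A x -> forall i, `|x 0 i| <= M.

Lemma cl_and n (A B : set 'rV[R]_n) : cl A -> cl B -> cl (fun x => A x /\ B x).
Proof. by move=> hA hB x h; split; [apply: hA|apply: hB] => e /h[y [[? ?] ?]]; exists y. Qed.

Lemma cl_all n (T : Type) (A : T -> set 'rV[R]_n) :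
  (forall i, cl (A i)) -> cl (fun x => forall i, A i x).
Proof. by move=> hA x h i; apply: hA => e /h[y [? ?]]; exists y. Qed.

Lemma cl_cst n (P : Prop) : cl (fun _ : 'rV[R]_n => P).
Proof. by move=> x /(_ 1 ltr01)[y []]. Qed.

Lemma cl_imp n (P : Prop) (A : set 'rV[R]_n) : cl A -> cl (fun x => P -> A x).
Proof. by move=> hA x h p; apply: hA => e /h[y [? ?]]; exists y; split; auto. Qed.

Lemma cl_le n (f g : 'rV[R]_n -> R) : cont f -> cont g -> cl (fun x => f x <= g x).
Proof.
move=> hf hg x h; rewrite leNgt; apply/negP => lt.
have e0 : 0 < (f x - g x) by lra.
have [d [dp hd]] := cont_add hf (cont_opp hg) x e0.
have [y [hy1 hy2]] := h d dp.
by have := hd y hy2; rewrite ltr_norml => /andP[]; lra.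
Qed.

Lemma cl_eq n (f g : 'rV[R]_n -> R) : cont f -> cont g -> cl (fun x => f x = g x).
Proof.
move=> hf hg; have := cl_and (cl_le hf hg) (cl_le hg hf).
by congr cl; apply: funext => x; apply/propext; split=> [[a b]|->//]; apply/le_anti/andP.
Qed.

Lemma cl_preim n m (F : 'rV[R]_n -> 'rV[R]_m) (A : set 'rV[R]_m) :
  contV F -> cl A -> cl (fun x => A (F x)).
Proof.
move=> hF hA x h; apply: hA => e e0.
have [|i|d [dp hd]] := @unif_delta 'I_m (fun i d' => forall y, bx x y d' -> `|F x 0 i - F y 0 i| < e).
- by move=> i d1 d2 _ d12 H y hy; apply/H/bx_le/hy.
- exact: hF.
by have [y [Ay hy]] := h d dp; exists (F y); split=> // i; apply: hd.
Qed.

Lemma bdd_sub n (A B : set 'rV[R]_n) : (forall x, A x -> B x) -> bdd B -> bdd A.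
Proof. by move=> AB [M h]; exists M => x /AB; exact: h. Qed.

End Boxes.

Ltac ct_step :=
  match goal with
  | |- cl (fun x => _ /\ _) => apply: cl_and
  | |- cl (fun x => is_true (_ <= _)) => apply: cl_le
  | |- cl (fun x => @eq _ _ _) => apply: cl_eq
  | H : cl ?A |- cl (fun x => ?A (@?F x)) => apply: (@cl_preim _ _ _ F A)
  | H : cl ?A |- cl ?A => exact: H
  | |- cl (fun x => ?P -> _) => apply: cl_imp
  | |- cl (fun x => forall y, _) => apply: cl_all => ?
  | |- cl (fun x => ?P) => apply: (cl_cst P)
  | |- cont (fun x => _ + _) => apply: cont_add
  | |- cont (fun x => _ * _) => apply: cont_mul
  | |- cont (fun x => - _) => apply: cont_opp
  | |- cont (fun x => _ ^+ _) => apply: cont_exp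
  | |- cont (fun x => `|_|) => apply: cont_norm
  | |- cont (fun x => Num.max _ _) => apply: cont_max
  | |- cont (fun x => ?c) => apply: (cont_cst c)
  | |- cont (fun x => bigop _ _ _) => apply: cont_sum => ?
  | |- cont (fun x => meval _ _) => apply: cont_meval
  | |- cont (fun x => fun_of_matrix _ _ _) => apply: cont_entry
  | H : cont ?f |- cont (fun x => ?f (@?F x)) => apply: (@cont_comp _ _ _ f F)
  | H : cont ?f |- cont ?f => exact: H
  | |- contV (fun x => x) => apply: contV_id
  | |- contV (fun x => ?c) => apply: (contV_cst c)
  | |- contV (fun x => lsubmx _) => apply: contV_lsub
  | |- contV (fun x => rsubmx _) => apply: contV_rsub
  | |- contV (@lsubmx _ _ _ _) => apply: (contV_lsub (@contV_id _ _))
  | |- contV (@rsubmx _ _ _ _) => apply: (contV_rsub (@contV_id _ _))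
  | |- contV (fun x => _ + _) => apply: contV_add
  | |- contV (fun x => - _) => apply: contV_opp
  | |- contV (fun x => _ *: _) => apply: contV_scale
  | |- contV (fun x => _ *m _) => apply: contV_mulmx
  end.
Ltac ct := repeat ct_step.

(** * The line is definably complete *)

Section DefinableCompleteness.
Variable R : rcfType.

(** Restriction of [p] to the line through [x] in direction [v]. *)
Definition linepoly n (p : {mpoly R[n]}) (x v : 'rV[R]_n) : {poly R} :=
  mmap polyC (fun i => (x 0 i)%:P + (v 0 i)%:P * 'X) p.

Lemma horner_linepoly n (p : {mpoly R[n]}) (x v : 'rV[R]_n) t :
  (linepoly p x v).[t] = p.@[(x + t *: v) 0].
Proof.
rewrite mevalE /linepoly /mmap horner_sum; apply: eq_bigr => m _.
rewrite hornerM hornerC horner_prod; congr (_ * _); apply: eq_bigr => i _.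
by rewrite horner_exp !hornerE !mxE mulrC.
Qed.

Lemma sign_const_between_roots (g : {poly R}) a b :
  (forall z, a < z < b -> g.[z] != 0) ->
  forall x y, a < x < b -> a < y < b -> 0 < g.[x] -> 0 < g.[y].
Proof.
move=> hab x y hx hy gx; rewrite ltNge; apply/negP => gy.
have hz z : x <= z <= y \/ y <= z <= x -> g.[z] != 0.
  by move=> hz; apply: hab; case: hz => /andP[? ?]; move: hx hy => /andP[? ?] /andP[? ?];
     apply/andP; split; lra.
case: (leP x y) => xy.
  have [|z zi /rootP rz] := poly_ivt (p := - g) xy.
    by rewrite !hornerN oppr_le0 oppr_ge0 (ltW gx) gy.
  have /negP[] := hz z (or_introl zi).
  by rewrite -oppr_eq0 -hornerN rz.
have [|z zi /rootP rz] := poly_ivt (p := g) (ltW xy); first by rewrite gy (ltW gx).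
by have /negP[] := hz z (or_intror zi); rewrite rz.
Qed.

(** Membership only changes at roots of the polynomials in the definition of
    [A]; [g] is the product of those that are nonzero. *)
Lemma semialgebraic_line_roots (A : set 'rV[R]_1) : semialgebraic A ->
  exists g : {poly R}, g != 0 /\ forall a b, (forall z, a < z < b -> g.[z] != 0) ->
    forall x y, a < x < b -> a < y < b -> A (const_mx x) -> A (const_mx y).
Proof.
pose pp (p : {mpoly R[1]}) := linepoly p 0 (const_mx 1).
have gE p x : (pp p).[x] = p.@[(const_mx x : 'rV[R]_1) 0].
  by rewrite horner_linepoly; apply: meval_eq => i; rewrite !mxE; ring.
elim=> {A}.
- move=> p; have [g0|gn0] := eqVneq (pp p) 0.
    by exists 1; split=> [|a b _ x y _ _ _ /=]; rewrite ?oner_neq0 // -gE g0 horner0.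
  exists (pp p); split=> // a b hab x y hx hy /=; rewrite -gE => /eqP.
  by rewrite (negbTE (hab _ hx)).
- move=> p; have [g0|gn0] := eqVneq (pp p) 0.
    by exists 1; split=> [|a b _ x y _ _ /=]; rewrite ?oner_neq0 // -gE g0 horner0 ltxx.
  exists (pp p); split=> // a b hab x y hx hy /=; rewrite -!gE.
  exact: sign_const_between_roots hx hy.
- move=> A B _ [g1 [n1 h1]] _ [g2 [n2 h2]]; exists (g1 * g2); split; first by rewrite mulf_neq0.
  move=> a b hab x y hx hy [] Ax; [left; apply: h1 hx hy Ax|right; apply: h2 hx hy Ax] => z /hab;
  by rewrite hornerM mulf_eq0 negb_or => /andP[].
- move=> A B _ [g1 [n1 h1]] _ [g2 [n2 h2]]; exists (g1 * g2); split; first by rewrite mulf_neq0.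
  move=> a b hab x y hx hy [Ax Bx]; split; [apply: h1 hx hy Ax|apply: h2 hx hy Bx] => z /hab;
  by rewrite hornerM mulf_eq0 negb_or => /andP[].
- move=> A _ [g [n h]]; exists g; split=> // a b hab x y hx hy nAx Ay; apply: nAx.
  exact: h hy hx Ay.
Qed.

(** Each candidate [r] shrinks the interval that contains the cut of the up-set
    [U]. Once no candidate is left inside, membership is constant there and the
    cut is an end point. *)
Lemma cut_between (U : R -> Prop) (rs : seq R) : forall x u, x < u -> ~ U x -> U u ->
  (forall a b, U a -> a <= b -> U b) ->
  (forall a b, x <= a -> b <= u -> (forall z, a < z < b -> z \notin rs) ->
    forall y z, a < y < b -> a < z < b -> U y -> U z) ->
  exists s, (forall t, s < t -> U t) /\ (forall t, t < s -> ~ U t).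
Proof.
elim: rs => [|r rs IH] x u xu nUx Uu up hc.
  pose m := (x + u) / 2; have hm : x < m < u by apply/andP; split; rewrite /m; lra.
  have [Um|nUm] := pselect (U m).
    exists x; split=> t ht; last by move=> Ut; apply: nUx; apply: up Ut _; apply: ltW.
    case: (ltP t u) => tu; last exact: up tu.
    by apply: hc hm _ Um => //; rewrite ht tu.
  exists u; split=> t ht; first by apply: up Uu _; apply: ltW.
  move=> Ut; case: (ltP x t) => xt; last by apply: nUx; apply: up xt.
  by apply: nUm; apply: (hc x u) Ut => //; rewrite xt ht.
have [hr|hr] := boolP (x < r < u); last first.
  apply: (IH x u) => // a b xa bu hab; apply: hc => // z hz.
  rewrite inE negb_or hab // andbT; apply: contra hr => /eqP <-.
  by move: hz => /andP[? ?]; apply/andP; split; lra.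
have /andP[xr ru] := hr.
have [Ur|nUr] := pselect (U r).
  apply: (IH x r) => // a b xa br hab; apply: hc => //; first by lra.
  move=> z hz; rewrite inE negb_or hab // andbT.
  by move: hz => /andP[_ zb]; apply/eqP => zr; move: zb; rewrite zr; lra.
apply: (IH r u) => // a b ra bu hab; apply: hc => //; first by lra.
move=> z hz; rewrite inE negb_or hab // andbT.
by move: hz => /andP[za _]; apply/eqP => zr; move: za; rewrite zr; lra.
Qed.

(** The upper bounds of [A] form a semi-algebraic up-set, so its cut exists
    although the field need not be complete. *)
Lemma semialgebraic_sup (A : R -> Prop) :
  semialgebraic (fun x : 'rV[R]_1 => A (x 0 0)) -> (exists a, A a) ->
  (exists b, forall a, A a -> a <= b) ->
  exists s, (forall a, A a -> a <= s) /\ (forall t, t < s -> exists a, A a /\ t < a).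
Proof.
move=> hA [a0 Aa0] [b hb]; pose U (u : R) := forall a : R, A a -> a <= u.
have hU : semialgebraic (fun x : 'rV[R]_1 => U (x 0 0)).
  apply: sa_allR; apply: sa_imp; last by sa.
  have := sa_preim (F := fun z : 'rV[R]_(1 + 1) => rsubmx z) _ hA.
  by apply; apply: savec_rsub; apply: savec_id.
have [g [gn0 hg]] := semialgebraic_line_roots hU.
have up u v : U u -> u <= v -> U v by move=> h uv a /h; lra.
have [|||||s [s1 s2]] := @cut_between U (rootsR g) (a0 - 1) (Num.max b a0).
- by rewrite lt_max orbC; have -> : a0 - 1 < a0 by lra.
- by move=> /(_ _ Aa0); lra.
- by move=> a /hb h; rewrite le_max h.
- exact: up.
- move=> x y _ _ hxy u v hu hv Uu.
  have := hg x y _ u v hu hv; rewrite !mxE; apply=> // z /hxy.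
  by rewrite -(roots_on_rootsR gn0).
exists s; split=> [a Aa|t /s2 nUt].
  rewrite leNgt; apply/negP => sa.
  have /s1 : s < (s + a) / 2 by lra.
  by move=> /(_ a Aa); lra.
move: nUt => /existsNP[a /not_implyP[Aa /negP]]; rewrite -ltNge => ta.
by exists a.
Qed.

End DefinableCompleteness.

(** * Definable compactness *)

Section Compactness.
Variable R : rcfType.

(** The coordinates of the cluster point are found one after another, each as
    the supremum of the values that persist for all small [t]. This replaces the
    extraction of convergent subsequences. *)
Lemma definable_cluster n (K : 'rV[R]_n -> R -> Prop) :
  semialgebraic (fun z : 'rV[R]_(n + 1) => K (lsubmx z) (rsubmx z 0 0)) ->
  (forall t, 0 < t -> exists x, K x t) ->
  (forall s t x, 0 < s -> s <= t -> K x s -> K x t) ->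
  (exists M, forall t x, 0 < t -> K x t -> forall i, `|x 0 i| <= M) ->
  exists a, forall t e, 0 < t -> 0 < e -> exists x, K x t /\ bx a x e.
Proof.
move=> hK Kn Kd [M KM].
suff H : forall j, (j <= n)%N -> exists a : 'rV[R]_n, forall t e, 0 < t -> 0 < e ->
    exists x, K x t /\ forall i : 'I_n, (i < j)%N -> `|a 0 i - x 0 i| < e.
  have [a ha] := H n (leqnn n); exists a => t e t0 e0.
  by have [x [Kx hx]] := ha t e t0 e0; exists x; split=> // i; apply: hx.
elim=> [|j IH] jn; first by exists 0 => t e /Kn[x Kx] _; exists x.
have [a ha] := IH (ltnW jn); pose i0 := Ordinal jn.
(* Values of the next coordinate that are exceeded arbitrarily late in the
   family. *)
pose A (al : R) := forall t : R, 0 < t -> exists x : 'rV[R]_n,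
  K x t /\ (forall i : 'I_n, (i < j)%N -> `|a 0 i - x 0 i| < t) /\ al <= x 0 i0.
have hA : semialgebraic (fun x : 'rV[R]_1 => A (x 0 0)).
  rewrite /A; apply: sa_allR; apply: sa_imp; first by sa.
  apply: sa_exV; apply: sa_and; last by sa.
  by apply: (sa_relR hK); sa.
have [||s [s1 s2]] := semialgebraic_sup hA.
- exists (- M) => t t0; have [x [Kx hx]] := ha t t t0 t0; exists x; split=> //; split=> //.
  by have := KM t x t0 Kx i0; rewrite ler_norml => /andP[].
- exists M => al /(_ 1 ltr01)[x [Kx [_ hx]]]; apply: le_trans hx _.
  by have := KM 1 x ltr01 Kx i0; rewrite ler_norml => /andP[].
have key e : 0 < e -> forall t, 0 < t -> exists x, K x t /\
    (forall i : 'I_n, (i < j)%N -> `|a 0 i - x 0 i| < t) /\ `|s - x 0 i0| < e.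
  move=> e0 t t0; have [|al [Aal sal]] := s2 (s - e); first by lra.
  have /existsNP[t1 /not_implyP[t10 hn]] : ~ A (s + e / 2).
    by move=> /s1; lra.
  have mt0 : 0 < Num.min t t1 by rewrite lt_min t0.
  have [x [Kx [hx alx]]] := Aal _ mt0.
  have Kx' u : 0 < u -> Num.min t t1 <= u -> K x u by move=> _ h; apply: Kd h Kx.
  exists x; split; first by apply: Kx' => //; rewrite ge_min lexx.
  split=> [i ij|]; first by apply: lt_le_trans (hx i ij) _; rewrite ge_min lexx.
  have xs : x 0 i0 < s + e / 2.
    rewrite ltNge; apply/negP => sx; apply: hn; exists x; split.
      by apply: Kx' => //; rewrite ge_min lexx orbT.
    by split=> // i ij; apply: lt_le_trans (hx i ij) _; rewrite ge_min lexx orbT.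
  by rewrite ltr_norml; apply/andP; split; lra.
exists (\row_i if i == i0 then s else a 0 i) => t e t0 e0.
have mt0 : 0 < Num.min t e by rewrite lt_min t0.
have [x [Kx [hx hs]]] := key e e0 _ mt0.
exists x; split; first by apply: Kd Kx; rewrite // ge_min lexx.
move=> i; rewrite ltnS leq_eqVlt mxE => /predU1P[ij|ij].
  by rewrite (_ : i = i0) ?eqxx //; apply: val_inj.
case: eqP => [->//|_]; apply: lt_le_trans (hx i ij) _.
by rewrite ge_min lexx orbT.
Qed.

(** The form of compactness that survives over a general real closed field: a
    decreasing definable family of nonempty closed sets in a fixed box has a
    common point. *)
Lemma definable_compactness n (K : 'rV[R]_n -> R -> Prop) :
  semialgebraic (fun z : 'rV[R]_(n + 1) => K (lsubmx z) (rsubmx z 0 0)) ->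
  (forall t, 0 < t -> exists x, K x t) ->
  (forall s t x, 0 < s -> s <= t -> K x s -> K x t) ->
  (exists M, forall t x, 0 < t -> K x t -> forall i, `|x 0 i| <= M) ->
  (forall t, 0 < t -> cl (fun x => K x t)) ->
  exists a, forall t, 0 < t -> K a t.
Proof.
move=> hK Kn Kd Kb Kc; have [a ha] := definable_cluster hK Kn Kd Kb.
by exists a => t t0; apply: Kc => // e e0; apply: ha.
Qed.

(** A cluster point of the sets where [f x * t <= -1] would contradict
    continuity, so [f] is bounded below; compactness of the sublevel sets then
    gives a minimiser. *)
Lemma definable_min n (K : set 'rV[R]_n) (f : 'rV[R]_n -> R) :
  semialgebraic K -> cl K -> bdd K -> (exists x, K x) -> safun f -> cont f ->
  exists x, K x /\ forall y, K y -> f x <= f y.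
Proof.
move=> hK cK [M bK] nK hf cf.
have [m hm] : exists m, forall x, K x -> m <= f x.
  apply: contrapT => /forallNP nm.
  have [||||a ha] := @definable_cluster n (fun x t => K x /\ f x * t <= -1).
  - by sa.
  - move=> t t0; have /existsNP[x /not_implyP[Kx /negP]] := nm (- t^-1).
    rewrite -ltNge => h; exists x; split=> //.
    have -> : -1 = - t^-1 * t by rewrite mulNr mulVf ?gt_eqF.
    by apply: ltW; rewrite ltr_pM2r.
  - move=> s t x s0 st [Kx h]; split=> //; apply: (le_trans _ h).
    have fx : f x < 0.
      rewrite ltNge; apply/negP => fx; have := mulr_ge0 fx (ltW s0); lra.
    by rewrite ler_nM2l.
  - by exists M => t x _ [/bK h _].
  have [d [dp hd]] := cf a 1 ltr01.
  pose t := (1 + `|f a|)^-1 / 2.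
  have n0 : 0 < 1 + `|f a| by have := normr_ge0 (f a); lra.
  have t0 : 0 < t by rewrite divr_gt0 ?invr_gt0.
  have [x [[Kx h] hx]] := ha t d t0 dp.
  have := hd x hx; rewrite ltr_norml => /andP[h1 h2].
  have h3 : - (1 + `|f a|) <= f x by have := ler_norm (- f a); rewrite normrN; lra.
  have h4 : (1 + `|f a|) * t = 1 / 2 by rewrite /t; field; apply: lt0r_neq0.
  have h5 : - (1 + `|f a|) * t <= f x * t by rewrite ler_pM2r.
  by move: h5; rewrite mulNr h4; lra.
pose A (v : R) := exists x, K x /\ v = - f x.
have [|||s [s1 s2]] := @semialgebraic_sup R A.
- by apply: sa_exV; sa.
- by have [x Kx] := nK; exists (- f x), x.
- by exists (- m) => v [x [/hm h ->]]; lra.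
have [|||||a ha] := @definable_compactness n (fun x t => K x /\ f x <= - s + t).
- by sa.
- move=> t t0; have [|_ [[x [Kx ->]] hx]] := s2 (s - t); first by lra.
  by exists x; split=> //; lra.
- by move=> u t x _ ut [Kx h]; split=> //; lra.
- by exists M => t x _ [/bK h _].
- by move=> t _; ct.
exists a; have [Ka _] := ha 1 ltr01; split=> // y Ky.
have : - f y <= s by apply: s1; exists y.
suff : f a <= - s by lra.
rewrite leNgt; apply/negP => h.
by have [|_] := ha ((f a + s) / 2); lra.
Qed.

Lemma definable_max n (K : set 'rV[R]_n) (f : 'rV[R]_n -> R) :
  semialgebraic K -> cl K -> bdd K -> (exists x, K x) -> safun f -> cont f ->
  exists x, K x /\ forall y, K y -> f y <= f x.
Proof.
move=> hK cK bK nK hf cf.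
have [||x [Kx hx]] := definable_min hK cK bK nK (f := fun x => - f x); [by sa|by ct|].
by exists x; split=> // y /hx; lra.
Qed.

Definition lexlt n (x y : 'rV[R]_n) : Prop :=
  exists i : 'I_n, (forall l : 'I_n, (l < i)%N -> x 0 l = y 0 l) /\ x 0 i < y 0 i.

(** Picking the lexicographic minimum of a set is a choice that a first-order
    formula can express. *)
Definition lexmin n (K : set 'rV[R]_n) (x : 'rV[R]_n) : Prop :=
  K x /\ forall y, K y -> y = x \/ lexlt x y.

Lemma lexmin_uniq n (K : set 'rV[R]_n) x y : lexmin K x -> lexmin K y -> x = y.
Proof.
move=> [Kx hx] [Ky hy]; case: (hx y Ky) => [//|[i [h1 h2]]].
case: (hy x Kx) => [//|[j [g1 g2]]].
case: (ltngtP i j) => ij; first by move: h2; rewrite (g1 i ij) ltxx.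
  by move: g2; rewrite (h1 j ij) ltxx.
by have := lt_trans h2; rewrite (ord_inj ij) => /(_ _ g2); rewrite ltxx.
Qed.

Lemma lexmin_exists n (K : set 'rV[R]_n) :
  semialgebraic K -> cl K -> bdd K -> (exists x, K x) -> exists x, lexmin K x.
Proof.
move=> hK cK bK nK.
suff H : forall j, (j <= n)%N -> exists x, K x /\ forall y, K y ->
    (forall l : 'I_n, (l < j)%N -> y 0 l = x 0 l) \/ lexlt x y.
  have [x [Kx hx]] := H n (leqnn n); exists x; split=> // y /hx[h|]; last by right.
  by left; apply/rowP => i; apply: h.
elim=> [|j IH] jn; first by have [x Kx] := nK; exists x; split=> // y _; left.
have [x [Kx hx]] := IH (ltnW jn); pose i0 := Ordinal jn.
pose K' := fun y => K y /\ forall l : 'I_n, (l < j)%N -> y 0 l = x 0 l.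
have [|||||| z [[Kz zx] hz]] := @definable_min n K' (fun y => y 0 i0).
- by rewrite /K'; sa.
- by rewrite /K'; ct.
- by apply: bdd_sub bK => y [].
- by exists x.
- by sa.
- by ct.
exists z; split=> // y Ky.
have [h|[i [ij [h1 h2]]]] : (forall l : 'I_n, (l < j)%N -> y 0 l = x 0 l) \/
    exists i : 'I_n, (i < j)%N /\ (forall l : 'I_n, (l < i)%N -> x 0 l = y 0 l) /\ x 0 i < y 0 i.
  case: (hx y Ky) => [h|[i [h1 h2]]]; first by left.
  have [ij|ij] := ltnP i j; first by right; exists i.
  by left=> l lj; rewrite h1 //; apply: leq_trans lj ij.
  have := hz y (conj Ky h); rewrite le_eqVlt => /predU1P[e|lt].
    left=> l; rewrite ltnS leq_eqVlt => /predU1P[lj|lj]; last by rewrite h // zx.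
    by have -> : l = i0 by apply: val_inj.
  by right; exists i0; split=> // l lj; rewrite zx // h.
right; exists i; split=> [l li|]; last by rewrite zx.
by rewrite zx ?h1 //; apply: (ltn_trans li ij).
Qed.

End Compactness.

(** * Polynomial functions of bounded bidegree *)

Section Bidegree.
Variables (R : rcfType) (k m : nat).
Local Notation X := 'rV[R]_(k + m).
Local Notation fn := (X -> R).

(** Functions rather than formal polynomials: fibres only depend on values, and
    two blocks of variables need no iterated polynomial ring. *)
Inductive bideg : nat -> nat -> fn -> Prop :=
| bd_cst A B c : bideg A B (fun _ => c)
| bd_add A B f g : bideg A B f -> bideg A B g -> bideg A B (fun z => f z + g z)
| bd_mulx A B i f : bideg A B f -> bideg A.+1 B (fun z => z 0 (lshift m i) * f z)
| bd_mull A B j f : bideg A B f -> bideg A B.+1 (fun z => z 0 (rshift k j) * f z).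

Lemma bd_ext A B f g : f =1 g -> bideg A B f -> bideg A B g.
Proof. by move=> /funext ->. Qed.

Lemma bd_le A B A' B' f : (A <= A')%N -> (B <= B')%N -> bideg A B f -> bideg A' B' f.
Proof.
move=> hA hB h; elim: h A' B' hA hB => {A B f}.
- by move=> *; apply: bd_cst.
- by move=> A B f g _ IHf _ IHg A' B' hA hB; apply: bd_add; auto.
- by move=> A B i f _ IH [|A'] B' hA hB //; apply: bd_mulx; auto.
- by move=> A B i f _ IH A' [|B'] hA hB //; apply: bd_mull; auto.
Qed.

Lemma bd_mul A B A' B' f g : bideg A B f -> bideg A' B' g ->
  bideg (A + A') (B + B') (fun z => f z * g z).
Proof.
move=> hf hg; elim: hf => {A B f}.
- move=> A B c; elim: hg => {A' B' g}.
  + by move=> A' B' c'; apply: bd_cst.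
  + move=> A' B' f g _ IHf _ IHg; apply: bd_ext (bd_add IHf IHg) => z /=.
    by rewrite mulrDr.
  + move=> A' B' i f _ IH; rewrite addnS; apply: bd_ext (bd_mulx i IH) => z /=.
    by rewrite mulrCA.
  + move=> A' B' i f _ IH; rewrite [(B + _)%N]addnS; apply: bd_ext (bd_mull i IH) => z /=.
    by rewrite mulrCA.
- move=> A B f f' _ IHf _ IHf'; apply: bd_ext (bd_add IHf IHf') => z /=.
  by rewrite mulrDl.
- move=> A B i f _ IH; rewrite addSn; apply: bd_ext (bd_mulx i IH) => z /=.
  by rewrite mulrA.
- move=> A B i f _ IH; rewrite [(B.+1 + _)%N]addSn; apply: bd_ext (bd_mull i IH) => z /=.
  by rewrite mulrA.
Qed.

Lemma bd_scale A B c f : bideg A B f -> bideg A B (fun z => c * f z).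
Proof. exact: (bd_mul (bd_cst 0 0 c)). Qed.

Lemma bd_sum A B (T : Type) (s : seq T) (P : pred T) (f : T -> fn) :
  (forall i, bideg A B (f i)) -> bideg A B (fun z => \sum_(i <- s | P i) f i z).
Proof.
move=> hf; elim: s => [|i s IH].
  by apply: bd_ext (bd_cst A B 0) => z; rewrite big_nil.
case Pi: (P i); last by apply: bd_ext IH => z; rewrite big_cons Pi.
by apply: bd_ext (bd_add (hf i) IH) => z; rewrite big_cons Pi.
Qed.

Lemma bd_exp A B f n : bideg A B f -> bideg (n * A) (n * B) (fun z => f z ^+ n).
Proof.
move=> hf; elim: n => [|n IH]; first by apply: bd_ext (bd_cst 0 0 1).
by rewrite !mulSn; apply: bd_ext (bd_mul hf IH) => z; rewrite exprS.
Qed.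

Lemma bd_x i : bideg 1 0 (fun z => z 0 (lshift m i)).
Proof. by apply: bd_ext (bd_mulx i (bd_cst 0 0 1)) => z; rewrite mulr1. Qed.

Lemma bd_l j : bideg 0 1 (fun z => z 0 (rshift k j)).
Proof. by apply: bd_ext (bd_mull j (bd_cst 0 0 1)) => z; rewrite mulr1. Qed.

Lemma bd_coord i : bideg 1 1 (fun z : X => z 0 i).
Proof.
case: (fintype.splitP i) => j jE.
  by rewrite (_ : i = lshift m j); [apply: bd_le (bd_x j)|apply: val_inj].
by rewrite (_ : i = rshift k j); [apply: bd_le (bd_l j)|apply: val_inj].
Qed.

(** A basis of [U] that is dual to evaluation at the points [y]. *)
Definition interp_basis (U : fn -> Prop) (r : nat) (y : 'I_r -> X) (u : 'I_r -> fn) :=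
  [/\ forall i, U (u i), forall i j, u i (y j) = (i == j)%:R &
      forall f, U f -> forall z, f z = \sum_j f (y j) * u j z].

Definition spn (s : seq fn) (f : fn) : Prop :=
  exists c : nat -> R, forall z, f z = \sum_(i < size s) c i * nth (fun _ => 0) s i z.

Lemma spn_ext s f g : f =1 g -> spn s f -> spn s g.
Proof. by move=> /funext ->. Qed.

Lemma spn0 s : spn s (fun _ => 0).
Proof. by exists (fun _ => 0) => z; rewrite big1 // => i _; rewrite mul0r. Qed.

Lemma spn_add s f g : spn s f -> spn s g -> spn s (fun z => f z + g z).
Proof.
move=> [c hc] [d hd]; exists (fun i => c i + d i) => z.
by rewrite hc hd -big_split; apply: eq_bigr => i _; rewrite mulrDl.
Qed.

Lemma spn_scale s a f : spn s f -> spn s (fun z => a * f z).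
Proof.
move=> [c hc]; exists (fun i => a * c i) => z.
by rewrite hc mulr_sumr; apply: eq_bigr => i _; rewrite mulrA.
Qed.

Lemma spn_nth s i : (i < size s)%N -> spn s (nth (fun _ => 0) s i).
Proof.
move=> hi; exists (fun j => (j == i)%:R) => z.
rewrite (bigD1 (Ordinal hi)) //= eqxx mul1r big1 ?addr0 // => j ji.
by rewrite (_ : _ == i = false) ?mul0r //; apply: negbTE.
Qed.

Lemma spn_cons a s f : spn (a :: s) f <-> exists c g, spn s g /\ f = fun z => c * a z + g z.
Proof.
split=> [[c hc]|[c [g [[d hd] ->]]]].
  exists (c 0%N), (fun z => \sum_(i < size s) c i.+1 * nth (fun _ => 0) s i z).
  split; first by exists (fun i => c i.+1).
  by apply: funext => z; rewrite hc big_ord_recl.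
exists (fun i => if i is i'.+1 then d i' else c) => z.
by rewrite big_ord_recl /= hd.
Qed.

Lemma spn_sum s (T : Type) (r : seq T) (P : pred T) (f : T -> fn) :
  (forall i, P i -> spn s (f i)) -> spn s (fun z => \sum_(i <- r | P i) f i z).
Proof.
move=> hf; elim: r => [|i r IH].
  by apply: spn_ext (spn0 s) => z; rewrite big_nil.
case Pi: (P i); last by apply: spn_ext IH => z; rewrite big_cons Pi.
by apply: spn_ext (spn_add (hf i Pi) IH) => z; rewrite big_cons Pi.
Qed.

Lemma spn_sub s s' f : (forall i, (i < size s)%N -> spn s' (nth (fun _ => 0) s i)) ->
  spn s f -> spn s' f.
Proof.
move=> h [c hc]; apply: (spn_ext (f := fun z => \sum_(i < size s) c i * nth (fun _ => 0) s i z)).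
  by move=> z; rewrite hc.
by apply: spn_sum => i _; apply: spn_scale; apply: h.
Qed.

Lemma spn_catl s1 s2 f : spn s1 f -> spn (s1 ++ s2) f.
Proof.
apply: spn_sub => i hi; have := @spn_nth (s1 ++ s2) i.
by rewrite nth_cat hi size_cat; apply; apply: leq_trans hi (leq_addr _ _).
Qed.

Lemma spn_catr s1 s2 f : spn s2 f -> spn (s1 ++ s2) f.
Proof.
apply: spn_sub => i hi; have := @spn_nth (s1 ++ s2) (size s1 + i)%N.
by rewrite nth_cat [(_ < size s1)%N]ltnNge leq_addr addKn size_cat ltn_add2l; apply.
Qed.

Lemma spn_mul s h f : spn s f -> spn [seq (fun z => h z * g z) | g <- s] (fun z => h z * f z).
Proof.
move=> [c hc]; exists c => z; rewrite hc mulr_sumr size_map; apply: eq_bigr => i _.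
by rewrite (nth_map (fun _ => 0)) // mulrCA.
Qed.

Lemma spn_products n (h : 'I_n -> fn) (s : seq fn) (P : fn -> Prop) :
  (forall i j, (j < size s)%N -> P (fun z => h i z * nth (fun _ => 0) s j z)) ->
  exists s' : seq fn, (forall j, (j < size s')%N -> P (nth (fun _ => 0) s' j)) /\
    forall i f, spn s f -> spn s' (fun z => h i z * f z).
Proof.
move=> hP; pose F i := [seq (fun z : X => h i z * g z) | g <- s].
suff [s' [h1 h2]] : exists s' : seq fn, (forall j, (j < size s')%N -> P (nth (fun _ => 0) s' j)) /\
    forall i, i \in enum 'I_n -> forall f, spn (F i) f -> spn s' f.
  by exists s'; split=> // i f hf; apply: (h2 i); [rewrite mem_enum|exact: spn_mul].
elim: (enum 'I_n) => [|i r [s' [h1 h2]]]; first by exists [::].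
exists (F i ++ s'); split=> [j|j].
  rewrite size_cat nth_cat; case: (ltnP j (size (F i))) => hj; last first.
    by move=> hj'; apply: h1; rewrite -(ltn_add2l (size (F i))) subnKC.
  by move=> _; rewrite size_map in hj; rewrite (nth_map (fun _ => 0)) //; apply: hP.
rewrite inE => /predU1P[->|hj] f hf; first exact: spn_catl.
by apply: spn_catr; apply: h2 hf.
Qed.

Lemma bd_span A B : exists s : seq fn,
  (forall i, (i < size s)%N -> bideg A B (nth (fun _ => 0) s i)) /\
  forall f, bideg A B f -> spn s f.
Proof.
have [n] := ubnP (A + B); elim: n A B => // n IH A B; rewrite ltnS => hn.
have H1 : exists s : seq fn, (forall i, (i < size s)%N -> bideg A B (nth (fun _ => 0) s i)) /\
    forall A' f i, A = A'.+1 -> bideg A' B f -> spn s (fun z => z 0 (lshift m i) * f z).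
  case: A hn => [|A'] hn; first by exists [::].
  have [|s [s1 s2]] := IH A' B; first by rewrite -ltnS.
  have [|s' [h1 h2]] := @spn_products k (fun i z => z 0 (lshift m i)) s (bideg A'.+1 B).
    by move=> i j /s1; exact: bd_mulx.
  by exists s'; split=> // A'' f i [<-] /s2; exact: h2.
have H2 : exists s : seq fn, (forall i, (i < size s)%N -> bideg A B (nth (fun _ => 0) s i)) /\
    forall B' f i, B = B'.+1 -> bideg A B' f -> spn s (fun z => z 0 (rshift k i) * f z).
  case: B hn {H1} => [|B'] hn; first by exists [::].
  have [|s [s1 s2]] := IH A B'; first by rewrite -ltnS -addnS.
  have [|s' [h1 h2]] := @spn_products m (fun i z => z 0 (rshift k i)) s (bideg A B'.+1).
    by move=> i j /s1; exact: bd_mull.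
  by exists s'; split=> // B'' f i [<-] /s2; exact: h2.
have [s1 [b1 g1]] := H1; have [s2 [b2 g2]] := H2.
exists ((fun _ => 1) :: s1 ++ s2); split=> [[|i]|].
- by move=> _; apply: bd_cst.
- rewrite /= ltnS size_cat nth_cat; case: (ltnP i (size s1)) => hi; first by move=> _; apply: b1.
  by move=> hi'; apply: b2; rewrite -(ltn_add2l (size s1)) subnKC.
move=> f hf; move E1: A hf => A1 hf; move E2: B hf => B1 hf.
elim: hf E1 E2 => {A1 B1 f}.
- move=> ? ? c _ _; apply/spn_cons; exists c, (fun _ => 0); split; first exact: spn0.
  by apply: funext => z; rewrite mulr1 addr0.
- by move=> ? ? f g _ IHf _ IHg e1 e2; apply: spn_add; auto.
- move=> A' B' i f hf _ e1 e2; apply/spn_cons; exists 0, (fun z : X => z 0 (lshift m i) * f z).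
  split; first by apply: spn_catl; apply: g1 e1 _; rewrite e2.
  by apply: funext => z; rewrite mul0r add0r.
- move=> A' B' i f hf _ e1 e2; apply/spn_cons; exists 0, (fun z : X => z 0 (rshift k i) * f z).
  split; first by apply: spn_catr; apply: g2 e2 _; rewrite e1.
  by apply: funext => z; rewrite mul0r add0r.
Qed.

(** A new function is reduced by the interpolation formula for the previous
    ones; a point at which the remainder does not vanish becomes the next node. *)
Lemma interp_basis_spn (s : seq fn) : exists r y u, @interp_basis (spn s) r y u.
Proof.
elim: s => [|f s [r [y [u [h1 h2 h3]]]]].
  exists 0%N, (fun _ => 0), (fun _ _ => 0); split; try by case.
  by move=> f [c hc] z; rewrite hc !big_ord0.
pose f' z := f z - \sum_j f (y j) * u j z.
have sub g : spn s g -> spn (f :: s) g by move=> hg; apply: (@spn_catr [:: f]).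
have su j : spn s (u j) by exact: h1.
have hf' : spn (f :: s) f'.
  apply: spn_add; first exact: (@spn_nth (f :: s) 0).
  apply: (spn_ext (f := fun z => -1 * \sum_j f (y j) * u j z)); first by move=> z; rewrite mulN1r.
  by apply: spn_scale; apply: spn_sum => j _; apply: spn_scale; apply: sub.
have f'y j : f' (y j) = 0.
  rewrite /f' (bigD1 j) //= h2 eqxx mulr1 big1 ?addr0 ?subrr // => i ij.
  by rewrite h2 (negbTE ij) mulr0.
have [f'0|/existsNP[z0 /eqP f'z0]] := pselect (forall z, f' z = 0).
  exists r, y, u; split=> //; first by move=> i; apply: sub.
  move=> g /spn_cons[c [g' [hg' ->]]] z.
  have fz : f z = \sum_j f (y j) * u j z by apply/eqP; rewrite -subr_eq0; apply/eqP/f'0.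
  rewrite (h3 _ hg' z) {1}fz mulr_sumr -big_split; apply: eq_bigr => j _ /=.
  by rewrite mulrDl mulrA.
pose w z := f' z / f' z0.
pose y' (i : 'I_r.+1) := oapp y z0 (unlift ord0 i).
pose u' (i : 'I_r.+1) := oapp (fun j z => u j z - u j z0 * w z) w (unlift ord0 i).
have hw : spn (f :: s) w.
  by apply: spn_ext (spn_scale (f' z0)^-1 hf') => z; rewrite mulrC.
exists r.+1, y', u'; split.
- move=> i; rewrite /u'; case: (unlift ord0 i) => [j|] //=.
  apply: spn_add; first exact: sub.
  by apply: spn_ext (spn_scale (- u j z0) hw) => z; rewrite mulNr.
- move=> i j; rewrite /u' /y'; case: unliftP => [i'|] ->; case: unliftP => [j'|] -> /=.
  + by rewrite /w f'y mul0r mulr0 subr0 h2 (inj_eq lift_inj).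
  + by rewrite /w divff // mulr1 subrr.
  + by rewrite /w f'y mul0r.
  + by rewrite /w divff // eqxx.
- move=> g /spn_cons[c [g' [hg' ->]]] z.
  have y'0 : y' ord0 = z0 by rewrite /y' unlift_none.
  have u'0 : u' ord0 = w by rewrite /u' unlift_none.
  rewrite big_ord_recl y'0 u'0.
  under eq_bigr => j _.
    have -> : y' (lift ord0 j) = y j by rewrite /y' liftK.
    have -> : u' (lift ord0 j) z = u j z - u j z0 * w z by rewrite /u' liftK.
    over.
  rewrite /=.
  rewrite (h3 _ hg' z) (h3 _ hg' z0).
  have fz x : f x = f' x + \sum_j f (y j) * u j x by rewrite /f' subrK.
  have -> : \sum_j (c * f (y j) + g' (y j)) * (u j z - u j z0 * w z) =
     c * (\sum_j f (y j) * u j z) + \sum_j g' (y j) * u j z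
     - (c * (\sum_j f (y j) * u j z0) + \sum_j g' (y j) * u j z0) * w z.
    rewrite !mulr_sumr -!big_split /= mulr_suml -sumrB; apply: eq_bigr => j _; ring.
  rewrite (fz z) (fz z0); have -> : f' z = f' z0 * w z by rewrite /w mulrCA divff // mulr1.
  ring.
Qed.

Lemma bd_interp A B : exists r y u, @interp_basis (bideg A B) r y u.
Proof.
have [s [h1 h2]] := bd_span A B; have [r [y [u [g1 g2 g3]]]] := interp_basis_spn s.
exists r, y, u; split=> // [i|f hf z]; last by apply/g3/h2.
have [c hc] := g1 i.
apply: (bd_ext (f := fun z => \sum_(i < size s) c i * nth (fun _ => 0) s i z)).
  by move=> z; rewrite hc.
by apply: bd_sum => j; apply: bd_scale; apply: h1.
Qed.

End Bidegree.

(** * The Bezout number of a system of products of affine forms *)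

Section LinearProducts.
Variables (R : rcfType) (k m : nat).
Local Notation X := 'rV[R]_(k + m).
Local Notation fn := (X -> R).
Local Notation T := 'I_(k + m).
Local Notation bideg := (@bideg R k m).

(** Modulo the combinations of the [g t] with cofactors of the expected
    bidegree, [M] elements generate the functions of bidegree at most [(A, B)].
    This is a quantitative substitute for a bound on the dimension of a quotient
    ring. *)
Definition spans (st : T -> nat * nat) (g : T -> fn) A B M := exists S : 'I_M -> fn,
  (forall j, bideg A B (S j)) /\ forall f, bideg A B f ->
  exists (c : 'I_M -> R) (q : T -> fn),
    (forall t, bideg (A - (st t).1) (B - (st t).2) (q t)) /\
    forall z, f z = \sum_j c j * S j z + \sum_t q t z * g t z.

Definition node (t : T) : R := (t : nat)%:R.

Lemma node_inj : injective node.
Proof. by move=> s t /eqP; rewrite eqr_nat => /eqP/ord_inj. Qed.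

(** An affine form whose coefficients lie on a moment curve; different nodes put
    the forms in general position. *)
Definition mform n (u : 'I_n -> fn) (t : T) : fn := fun z =>
  \sum_(i < n) node t ^+ i * u i z + node t ^+ n.
Definition xform := mform (fun i z => z 0 (lshift m i)).
Definition lform := mform (fun j z => z 0 (rshift k j)).

Definition linprod (st : T -> nat * nat) (t : T) : fn := fun z =>
  xform t z ^+ (st t).1 * lform t z ^+ (st t).2.

Lemma bd_xform t : bideg 1 0 (xform t).
Proof.
apply: bd_add; last exact: bd_cst.
by apply: bd_sum => i; apply: bd_scale; apply: bd_x.
Qed.

Lemma bd_lform t : bideg 0 1 (lform t).
Proof.
apply: bd_add; last exact: bd_cst.
by apply: bd_sum => i; apply: bd_scale; apply: bd_l.
Qed.

Lemma bd_linprod st t : bideg (st t).1 (st t).2 (linprod st t).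
Proof.
have := bd_mul (bd_exp (st t).1 (bd_xform t)) (bd_exp (st t).2 (bd_lform t)).
by rewrite !muln0 !muln1 addn0 add0n.
Qed.

(** The weights are the entries of the inverse of the Vandermonde matrix of [K]
    of the nodes in [Y]. *)
Lemma vandermonde_weights (Y : {set T}) K : (K <= #|Y|)%N ->
  exists w : 'I_K -> T -> R, (forall i t, t \notin Y -> w i t = 0) /\
    forall (i : 'I_K) j, (j < K)%N -> \sum_t w i t * node t ^+ j = ((i : nat) == j)%:R.
Proof.
move=> hK; pose s (i : 'I_K) : T := enum_val (widen_ord hK i).
have s_inj : injective s.
  by move=> i j /enum_val_inj /(congr1 val) /= /ord_inj.
pose V := Vandermonde K (\row_(i < K) node (s i)).
have uV : V \in unitmx.
  rewrite unitmxE det_Vandermonde unitfE; apply/prodf_neq0 => i _; apply/prodf_neq0 => j ij.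
  rewrite !mxE subr_eq0; apply/eqP => /node_inj /s_inj e.
  by move: ij; rewrite e ltnn.
have [iV hiV] : exists iV : 'M[R]_K, V *m iV = 1%:M by exists (invmx V); rewrite mulmxV.
exists (fun i t => \sum_(a < K | s a == t) iV a i); split.
  move=> i t nt; rewrite big1 // => a /eqP sa; case/negP: nt; rewrite -sa.
  exact: enum_valP.
move=> i j hj.
have -> : \sum_t (\sum_(a < K | s a == t) iV a i) * node t ^+ j =
    \sum_(a < K) node (s a) ^+ j * iV a i.
  under eq_bigr => t _ do rewrite mulr_suml.
  rewrite (exchange_big_dep xpredT) //=; apply: eq_bigr => a _.
  rewrite (bigD1 (s a)) //= big1 ?addr0 1?mulrC // => t /andP[/eqP ->].
  by rewrite eqxx.
have := congr1 (fun W : 'M_K => W (Ordinal hj) i) hiV.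
rewrite !mxE eq_sym => <-; apply: eq_bigr => a _.
by rewrite !mxE.
Qed.

(** More than [n] forms in general position generate 1 and every coordinate,
    with constant cofactors. *)
Lemma mform_unit n (u : 'I_n -> fn) (Y : {set T}) : (n < #|Y|)%N ->
  exists w : 'I_n.+1 -> T -> R, [/\ forall i t, t \notin Y -> w i t = 0,
    forall z, \sum_t w ord_max t * mform u t z = 1 &
    forall (i : 'I_n) z, \sum_t w (widen_ord (leqnSn n) i) t * mform u t z = u i z].
Proof.
move=> hY; have [w [w0 hw]] := vandermonde_weights hY.
have E i z : \sum_t w i t * mform u t z =
    \sum_(j < n) ((i : nat) == j)%:R * u j z + ((i : nat) == n)%:R.
  under eq_bigr => t _ do rewrite mulrDr mulr_sumr.
  rewrite big_split /= hw // exchange_big /=; congr (_ + _); apply: eq_bigr => j _.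
  under eq_bigr => t _ do rewrite mulrA.
  by rewrite -mulr_suml hw // ltnS ltnW.
exists w; split=> // [z|i z]; rewrite E /=.
  by rewrite eqxx big1 ?add0r // => j _; rewrite gtn_eqF ?mul0r.
rewrite (ltn_eqF (ltn_ord i)) addr0 (bigD1 i) //= eqxx mul1r.
by rewrite big1 ?addr0 // => j ji; rewrite eq_sym (_ : (_ == _) = false) ?mul0r //; apply: negbTE.
Qed.

(** Exactly [n] forms in general position are affine coordinates. *)
Lemma mform_coord n (u : 'I_n -> fn) (Y : {set T}) : #|Y| = n ->
  exists (w : 'I_n -> T -> R) (c : 'I_n -> R), (forall i t, t \notin Y -> w i t = 0) /\
    forall i z, \sum_t w i t * mform u t z = u i z + c i.
Proof.
move=> hY; have [|w [w0 hw]] := @vandermonde_weights Y n; first by rewrite hY.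
exists w, (fun i => \sum_t w i t * node t ^+ n); split=> // i z.
under eq_bigr => t _ do rewrite mulrDr mulr_sumr.
rewrite big_split /= exchange_big /=; congr (_ + _).
under eq_bigr => j _ do (under eq_bigr => t _ do rewrite mulrA); rewrite (bigD1 i) //=.
rewrite -mulr_suml hw // eqxx mul1r big1 ?addr0 // => j ji.
by rewrite -mulr_suml hw // eq_sym (_ : (_ == _) = false) ?mul0r //; apply: negbTE.
Qed.

(** The two-block Bezout number: the coefficient of [x ^ k * y ^ m] in the
    product of the [(st t).1 * x + (st t).2 * y]. *)
Definition cnt (st : T -> nat * nat) : nat :=
  (\sum_(Y : {set T} | #|Y| == k) \prod_t (if t \in Y then (st t).1 else (st t).2))%N.

Definition upd (st : T -> nat * nat) t p := fun s => if s == t then p else st s.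

Lemma cnt_split st t a b a' b' : st t = ((a + a')%N, (b + b')%N) ->
  cnt st = (cnt (upd st t (a, b)) + cnt (upd st t (a', b')))%N.
Proof.
move=> stE; rewrite /cnt -big_split; apply: eq_bigr => Y _ /=.
rewrite (bigD1 t) //= [in X in _ = (X + _)%N](bigD1 t) //= [in X in _ = (_ + X)%N](bigD1 t) //=.
rewrite /upd eqxx stE /=.
have E p : (\prod_(i < k + m | i != t) (if i \in Y then (if i == t then p else st i).1
      else (if i == t then p else st i).2) =
    \prod_(i < k + m | i != t) (if i \in Y then (st i).1 else (st i).2))%N.
  by apply: eq_bigr => i /negbTE ->.
by rewrite !E -mulnDl; case: (t \in Y).
Qed.

Lemma spans_mono st g A B M M' : (M <= M')%N -> spans st g A B M -> spans st g A B M'.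
Proof.
move=> hM [S [hS h]].
exists (fun j => if insub (j : nat) is Some j' then S j' else fun _ => 0); split.
  by move=> j; case: insubP => [j' _ _|_]; [apply: hS|apply: bd_cst].
move=> f /h[c [q [hq hf]]].
exists (fun j => if insub (j : nat) is Some j' then c j' else 0), q; split=> // z.
rewrite hf; congr (_ + _).
pose W (j : nat) := (if insub j is Some j' then c j' else 0) *
   (if insub j is Some j' then S j' else fun _ => 0) z.
transitivity (\sum_(j < M) W j); first by apply: eq_bigr => j _; rewrite /W valK.
rewrite (big_ord_widen M' W hM) big_mkcond /=; apply: eq_bigr => j _.
case: ifP => // /negbT hj; rewrite insubF ?mul0r //; exact: negbTE.
Qed.

(** With more than [k] equations in the first block the system has no solution,
    and nothing remains modulo the equations. Replacing a coordinate by a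
    combination of equations keeps the cofactors within their degree bound. *)
Lemma spans_leaf_x A B (Y : {set T}) st : (0 < A)%N -> (k < #|Y|)%N ->
  (forall t, st t = if t \in Y then (1, 0)%N else (0, 1)%N) ->
  spans st (linprod st) A B 0.
Proof.
move=> A0 hY hst; have [w [w0 w1 wx]] := mform_unit (fun i z => z 0 (lshift m i)) hY.
have hg i z : \sum_t w i t * linprod st t z = \sum_t w i t * xform t z.
  apply: eq_bigr => t _; case: (boolP (t \in Y)) => tY; last by rewrite w0 // !mul0r.
  by rewrite /linprod hst tY /= expr1 mulr1.
exists (fun _ _ => 0); split=> [j|f hf]; first exact: bd_cst.
suff [q [q0 hq hf']] : exists q : T -> fn, [/\ forall t, t \notin Y -> forall z, q t z = 0,
    forall t, bideg (A - 1) B (q t) & forall z, f z = \sum_t q t z * linprod st t z].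
  exists (fun _ => 0), q; split=> [t|z]; last by rewrite big_ord0 add0r.
  case: (boolP (t \in Y)) => tY; rewrite hst; first by rewrite tY /= subn0.
  by apply: bd_ext (bd_cst _ _ _ _ 0) => z; rewrite q0.
elim: hf A0 => {A B f}.
- move=> A B c _; exists (fun t _ => c * w ord_max t); split=> [t tY z|t|z].
  + by rewrite w0 // mulr0.
  + exact: bd_cst.
  under eq_bigr => t _ do rewrite -mulrA.
  by rewrite -mulr_sumr hg w1 mulr1.
- move=> A B f g _ IHf _ IHg A0; have [q [q0 hq ef]] := IHf A0; have [q' [q0' hq' eg]] := IHg A0.
  exists (fun t z => q t z + q' t z); split=> [t tY z|t|z].
  + by rewrite q0 // q0' // addr0.
  + exact: bd_add.
  + by rewrite ef eg -big_split; apply: eq_bigr => t _; rewrite mulrDl.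
- move=> A B i f hf _ _; pose i' := widen_ord (leqnSn k) i.
  exists (fun t z => w i' t * f z); split=> [t tY z|t|z].
  + by rewrite w0 // mul0r.
  + by rewrite subn1; apply: bd_scale.
  rewrite -[LHS]mulrC; under eq_bigr => t _ do rewrite [_ * f z]mulrC -mulrA.
  by rewrite -mulr_sumr hg wx.
- move=> A B j f _ IH A0; have [q [q0 hq ef]] := IH A0.
  exists (fun t (z : X) => z 0 (rshift k j) * q t z); split=> [t tY z|t|z].
  + by rewrite q0 // mulr0.
  + exact: bd_mull.
  + by rewrite ef mulr_sumr; apply: eq_bigr => t _; rewrite mulrA.
Qed.

(** Too many equations in the second block: the mirror image of [spans_leaf_x]. *)
Lemma spans_leaf_l A B (Y : {set T}) st : (0 < B)%N -> (m < #|~: Y|)%N ->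
  (forall t, st t = if t \in Y then (1, 0)%N else (0, 1)%N) ->
  spans st (linprod st) A B 0.
Proof.
move=> A0 hY hst; have [w [w0 w1 wx]] := mform_unit (fun j z => z 0 (rshift k j)) hY.
have hg i z : \sum_t w i t * linprod st t z = \sum_t w i t * lform t z.
  apply: eq_bigr => t _; case: (boolP (t \in ~: Y)) => tY; last by rewrite w0 // !mul0r.
  by move: tY; rewrite inE => /negbTE tY; rewrite /linprod hst tY /= expr1 mul1r.
exists (fun _ _ => 0); split=> [j|f hf]; first exact: bd_cst.
suff [q [q0 hq hf']] : exists q : T -> fn, [/\ forall t, t \notin ~: Y -> forall z, q t z = 0,
    forall t, bideg A (B - 1) (q t) & forall z, f z = \sum_t q t z * linprod st t z].
  exists (fun _ => 0), q; split=> [t|z]; last by rewrite big_ord0 add0r.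
  case: (boolP (t \in ~: Y)) => tY; rewrite hst; first by move: (tY); rewrite inE => /negbTE -> /=; rewrite subn0.
  by apply: bd_ext (bd_cst _ _ _ _ 0) => z; rewrite q0.
elim: hf A0 => {A B f}.
- move=> A B c _; exists (fun t _ => c * w ord_max t); split=> [t tY z|t|z].
  + by rewrite w0 // mulr0.
  + exact: bd_cst.
  under eq_bigr => t _ do rewrite -mulrA.
  by rewrite -mulr_sumr hg w1 mulr1.
- move=> A B f g _ IHf _ IHg A0; have [q [q0 hq ef]] := IHf A0; have [q' [q0' hq' eg]] := IHg A0.
  exists (fun t z => q t z + q' t z); split=> [t tY z|t|z].
  + by rewrite q0 // q0' // addr0.
  + exact: bd_add.
  + by rewrite ef eg -big_split; apply: eq_bigr => t _; rewrite mulrDl.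
- move=> A B j f _ IH A0; have [q [q0 hq ef]] := IH A0.
  exists (fun t (z : X) => z 0 (lshift m j) * q t z); split=> [t tY z|t|z].
  + by rewrite q0 // mulr0.
  + exact: bd_mulx.
  + by rewrite ef mulr_sumr; apply: eq_bigr => t _; rewrite mulrA.
- move=> A B i f hf _ _; pose i' := widen_ord (leqnSn m) i.
  exists (fun t z => w i' t * f z); split=> [t tY z|t|z].
  + by rewrite w0 // mul0r.
  + by rewrite subn1; apply: bd_scale.
  rewrite -[LHS]mulrC; under eq_bigr => t _ do rewrite [_ * f z]mulrC -mulrA.
  by rewrite -mulr_sumr hg wx.
Qed.

(** With [k] and [m] equations in the two blocks the system has one solution,
    and a function is congruent to its value there. *)
Lemma spans_leaf_1 A B (Y : {set T}) st : #|Y| = k ->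
  (forall t, st t = if t \in Y then (1, 0)%N else (0, 1)%N) ->
  spans st (linprod st) A B 1.
Proof.
move=> hY hst.
have hYc : #|~: Y| = m by have := cardsC Y; rewrite card_ord hY => /addnI.
have [w [cx [w0 wx]]] := mform_coord (fun i z => z 0 (lshift m i)) hY.
have [w' [cl' [w0' wl]]] := mform_coord (fun j z => z 0 (rshift k j)) hYc.
have combx i z : \sum_t w i t * linprod st t z = z 0 (lshift m i) + cx i.
  rewrite -wx; apply: eq_bigr => t _; case: (boolP (t \in Y)) => tY; last by rewrite w0 // !mul0r.
  by rewrite /linprod hst tY /= expr1 mulr1.
have combl i z : \sum_t w' i t * linprod st t z = z 0 (rshift k i) + cl' i.
  rewrite -wl; apply: eq_bigr => t _; case: (boolP (t \in ~: Y)) => tY; last by rewrite w0' // !mul0r.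
  by move: tY; rewrite inE => /negbTE tY; rewrite /linprod hst tY /= expr1 mul1r.
exists (fun _ _ => 1); split=> [j|f hf]; first exact: bd_cst.
suff [c [q [hq hf']]] : exists (c : R) (q : T -> fn),
    (forall t, bideg (A - (st t).1) (B - (st t).2) (q t)) /\
    forall z, f z = c + \sum_t q t z * linprod st t z.
  by exists (fun _ => c), q; split=> // z; rewrite big_ord1 mulr1.
elim: hf => {A B f}.
- move=> A B c; exists c, (fun _ _ => 0); split=> [t|z]; first exact: bd_cst.
  by rewrite big1 ?addr0 // => t _; rewrite mul0r.
- move=> A B f g _ [c [q [hq ef]]] _ [c' [q' [hq' eg]]].
  exists (c + c'), (fun t z => q t z + q' t z); split=> [t|z]; first exact: bd_add.
  rewrite ef eg addrACA; congr (_ + _).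
  by rewrite -big_split; apply: eq_bigr => t _; rewrite mulrDl.
- move=> A B i f hf [c [q [hq ef]]].
  exists (- cx i * c), (fun t z => w i t * f z + - cx i * q t z); split=> [t|z].
    apply: bd_add; last by apply: bd_scale; apply: bd_le (hq t); lia.
    case: (boolP (t \in Y)) => tY; rewrite hst.
      by rewrite tY /= subn1 subn0; apply: bd_scale.
    by rewrite w0 //; apply: bd_ext (bd_cst _ _ _ _ 0) => z; rewrite mul0r.
  have -> : z 0 (lshift m i) * f z = (z 0 (lshift m i) + cx i) * f z - cx i * f z by ring.
  rewrite -combx {2}ef; under [in RHS]eq_bigr => t _ do rewrite mulrDl.
  rewrite big_split /= mulrDr mulr_suml.
  under [\sum_i _ * _ * f z]eq_bigr => t _ do rewrite mulrAC.
  under [X in _ = _ + (_ + X)]eq_bigr => t _ do rewrite -mulrA.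
  rewrite -mulr_sumr; ring.
- move=> A B i f hf [c [q [hq ef]]].
  exists (- cl' i * c), (fun t z => w' i t * f z + - cl' i * q t z); split=> [t|z].
    apply: bd_add; last by apply: bd_scale; apply: bd_le (hq t); lia.
    case: (boolP (t \in ~: Y)) => tY; rewrite hst.
      by move: tY; rewrite inE => /negbTE -> /=; rewrite subn1 subn0; apply: bd_scale.
    by rewrite w0' //; apply: bd_ext (bd_cst _ _ _ _ 0) => z; rewrite mul0r.
  have -> : z 0 (rshift k i) * f z = (z 0 (rshift k i) + cl' i) * f z - cl' i * f z by ring.
  rewrite -combl {2}ef; under [in RHS]eq_bigr => t _ do rewrite mulrDl.
  rewrite big_split /= mulrDr mulr_suml.
  under [\sum_i _ * _ * f z]eq_bigr => t _ do rewrite mulrAC.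
  under [X in _ = _ + (_ + X)]eq_bigr => t _ do rewrite -mulrA.
  rewrite -mulr_sumr; ring.
Qed.

Lemma spans_leaf A B st : (0 < A)%N -> (0 < B)%N ->
  (forall t, st t = (1, 0)%N \/ st t = (0, 1)%N) ->
  spans st (linprod st) A B (cnt st).
Proof.
move=> A0 B0 hst; pose Y := [set t | st t == (1, 0)%N]%SET.
have stY t : st t = if t \in Y then (1, 0)%N else (0, 1)%N.
  by rewrite inE; case: (hst t) => ->.
have [hY|hY|hY] := ltngtP #|Y| k.
- apply: (spans_mono (leq0n _)); apply: spans_leaf_l B0 _ stY.
  have := cardsC Y; rewrite card_ord => hc.
  by move: hY; rewrite -(ltn_add2r #|~: Y|) hc ltn_add2l.
- by apply: (spans_mono (leq0n _)); apply: spans_leaf_x A0 hY stY.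
apply: (spans_mono (M := 1)); last exact: spans_leaf_1 hY stY.
rewrite /cnt (bigD1 Y) ?hY //= big1 ?leq_addr // => t _.
by rewrite stY; case: (t \in Y).
Qed.

(** If equation [t] factors as [p * p'], the quotient by [p * p'] is generated
    by the quotient by [p] together with [p] times the quotient by [p']. *)
Lemma spans_split st t p p' A B M M' :
  st t = ((p.1 + p'.1)%N, (p.2 + p'.2)%N) ->
  (forall s, ((st s).1 + p.1 <= A)%N /\ ((st s).2 + p.2 <= B)%N) ->
  spans (upd st t p) (linprod (upd st t p)) A B M ->
  spans (upd st t p') (linprod (upd st t p')) (A - p.1) (B - p.2) M' ->
  spans st (linprod st) A B (M + M').
Proof.
move=> stE hAB [S [hS h]] [S' [hS' h']].
pose u z := xform t z ^+ p.1 * lform t z ^+ p.2.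
have [hA hB] := hAB t.
have pA : (p.1 <= A)%N by move: hA; rewrite stE /=; lia.
have pB : (p.2 <= B)%N by move: hB; rewrite stE /=; lia.
have bu : bideg p.1 p.2 u.
  have := bd_mul (bd_exp p.1 (bd_xform t)) (bd_exp p.2 (bd_lform t)).
  by rewrite !muln0 !muln1 addn0 add0n.
exists (fun j => match fintype.split j with inl j => S j | inr j => fun z => u z * S' j z end).
split=> [j|f hf].
  case: (fintype.split j) => j' //.
  by apply: bd_le (bd_mul bu (hS' j')); rewrite subnKC.
have [c [q [hq ef]]] := h f hf.
have [|c' [q' [hq' eq]]] := h' (q t).
  by have := hq t; rewrite /upd eqxx.
exists (fun j => match fintype.split j with inl j => c j | inr j => c' j end).
exists (fun s => if s == t then q' t else fun z => q s z + u z * q' s z); split=> [s|z].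
  case: eqVneq => [->|st'].
    by have := hq' t; rewrite /upd eqxx stE /= !subnDA.
  have [hsA hsB] := hAB s.
  apply: bd_add; first by have := hq s; rewrite /upd (negbTE st').
  have := bd_mul bu (hq' s); rewrite /upd (negbTE st'); apply: bd_le; lia.
rewrite ef [X in _ = X + _]big_split_ord /= (bigD1 t) //= [in RHS](bigD1 t) //= eqxx.
have sl j : fintype.split (lshift M' j) = inl j := unsplitK (inl j).
have sr j : fintype.split (rshift M j) = inr j := unsplitK (inr j).
under [X in _ = X + _ + _]eq_bigr => j _ do rewrite !sl.
under [X in _ = _ + X + _]eq_bigr => j _ do rewrite !sr.
have -> : linprod (upd st t p) t z = u z by rewrite /linprod /upd eqxx.
have -> : linprod st t z = u z * linprod (upd st t p') t z.
  by rewrite /linprod /upd eqxx stE /= !exprD /u; ring.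
have E (r : nat * nat) s : s != t -> linprod (upd st t r) s z = linprod st s z.
  by move=> /negbTE h0; rewrite /linprod /upd h0.
rewrite eq (bigD1 t) //=.
under [X in _ + (_ + X) = _]eq_bigr => s hs do rewrite E //.
under [X in (_ + (_ + X)) * _]eq_bigr => s hs do rewrite E //.
have -> : \sum_(i < k + m | i != t) (if i == t then q' t else fun z => q i z + u z * q' i z) z * linprod st i z
   = \sum_(i < k + m | i != t) q i z * linprod st i z + u z * \sum_(i < k + m | i != t) q' i z * linprod st i z.
  rewrite mulr_sumr -big_split; apply: eq_bigr => i /negbTE -> /=; ring.
have -> : \sum_(i < M') c' i * (u z * S' i z) = u z * \sum_i c' i * S' i z.
  by rewrite mulr_sumr; apply: eq_bigr => i _; rewrite mulrCA.
ring.
Qed.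

(** Affine factors are split off one at a time. Both sides of [spans_split] are
    additive in the same way as [cnt], and single affine forms are left at the
    end. *)
Lemma spans_linprod st A B : (\sum_t (st t).1 < A)%N -> (\sum_t (st t).2 < B)%N ->
  spans st (linprod st) A B (cnt st).
Proof.
have [n] := ubnP (\sum_t ((st t).1 + (st t).2))%N.
elim: n st A B => // n IH st A B; rewrite ltnS => hn hA hB.
have [/existsP[t /eqP st0]|/existsPn nz] := boolP [exists t, st t == (0, 0)%N].
  apply: (spans_mono (leq0n _)).
  exists (fun _ _ => 0); split=> [j|f hf]; first exact: bd_cst.
  exists (fun _ => 0), (fun s => if s == t then f else fun _ => 0); split=> [s|z].
    by case: eqVneq => [->|_]; [rewrite st0 !subn0|apply: bd_cst].
  rewrite big_ord0 add0r (bigD1 t) //= eqxx /linprod st0 !expr0 !mulr1.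
  by rewrite big1 ?addr0 // => s /negbTE ->; rewrite mul0r.
have [/existsP[t ht]|/existsPn small] := boolP [exists t, 1 < (st t).1 + (st t).2]%N; last first.
  apply: spans_leaf; first exact: leq_ltn_trans hA.
    exact: leq_ltn_trans hB.
  move=> t; have := small t; have := nz t; case: (st t) => [[|[|a]] [|[|b]]] //=; by [left|right].
have le1 s : ((st s).1 <= \sum_t (st t).1)%N by rewrite (bigD1 s) //= leq_addr.
have le2 s : ((st s).2 <= \sum_t (st t).2)%N by rewrite (bigD1 s) //= leq_addr.
have sumU1 p : (\sum_s (upd st t p s).1 + (st t).1 = \sum_s (st s).1 + p.1)%N.
  rewrite (bigD1 t) //= [in RHS](bigD1 t) //= {1}/upd eqxx.
  have -> : (\sum_(s | s != t) (upd st t p s).1 = \sum_(s | s != t) (st s).1)%N.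
    by apply: eq_bigr => s /negbTE h; rewrite /upd h.
  by move: (bigop _ _ _) => S; lia.
have sumU2 p : (\sum_s (upd st t p s).2 + (st t).2 = \sum_s (st s).2 + p.2)%N.
  rewrite (bigD1 t) //= [in RHS](bigD1 t) //= {1}/upd eqxx.
  have -> : (\sum_(s | s != t) (upd st t p s).2 = \sum_(s | s != t) (st s).2)%N.
    by apply: eq_bigr => s /negbTE h; rewrite /upd h.
  by move: (bigop _ _ _) => S; lia.
have [p [p' [stE [hp hp']]]] : exists p p' : nat * nat,
    st t = ((p.1 + p'.1)%N, (p.2 + p'.2)%N) /\
    (p.1 + p.2 = 1)%N /\ (0 < p'.1 + p'.2)%N.
  case: (st t) ht => [[|a] [|b]] //= h.
  - by exists (0, 1)%N, (0, b)%N.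
  - by exists (1, 0)%N, (a, 0)%N; split=> //=; lia.
  - by exists (1, 0)%N, (a, b.+1); split=> //=; lia.
have e1 : (st t).1 = (p.1 + p'.1)%N by rewrite stE.
have e2 : (st t).2 = (p.2 + p'.2)%N by rewrite stE.
have s1 := sumU1 p; have s2 := sumU2 p; have s1' := sumU1 p'; have s2' := sumU2 p'.
have l1 := le1 t; have l2 := le2 t.
move: hn; rewrite big_split /= => hn.
rewrite (@cnt_split st t p.1 p.2 p'.1 p'.2) // -!surjective_pairing.
apply: (spans_split stE).
- by move=> s; move: hA hB (le1 s) (le2 s); do 2![move: (bigop _ _ _) => ?]; lia.
- apply: IH; rewrite ?big_split /=; move: hA hB hn s1 s2 l1 l2;
  do 4![move: (bigop _ _ _) => ?]; lia.
- apply: IH; rewrite ?big_split /=; move: hA hB hn s1' s2' l1 l2;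
  do 4![move: (bigop _ _ _) => ?]; lia.
Qed.

End LinearProducts.

(** * Transfer to arbitrary systems by deformation *)

Section LinearDependence.
Variable R : rcfType.

Lemma poly_nonroot (p : {poly R}) : p != 0 -> exists x, p.[x] != 0.
Proof.
move=> p0; apply: contrapT => /forallNP h.
pose rs := [seq (i%:R : R) | i <- iota 0 (size p)].
have := max_poly_roots (rs := rs) p0; rewrite size_map size_iota ltnn => /(_ _ _)/implyP.
have -> : all (root p) rs.
  by apply/allP => x _; apply/rootP; apply: contrapT => /eqP; exact: h.
have -> : uniq rs.
  by rewrite map_inj_uniq ?iota_uniq // => i j /eqP; rewrite eqr_nat => /eqP.
by move=> /(_ isT isT).
Qed.

Variables (k m : nat).
Local Notation X := 'rV[R]_(k + m).
Local Notation fn := (X -> R).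

Definition dependent (I : finType) (F : I -> fn) : Prop :=
  exists g : I -> R, (exists i, g i != 0) /\ forall z, \sum_i g i * F i z = 0.

Lemma dependent_ker (I : finType) r (P : 'M[R]_(#|I|, r)) : ~~ row_free P ->
  exists g : I -> R, (exists i, g i != 0) /\
    forall j, \sum_i g i * P (enum_rank i) j = 0.
Proof.
rewrite -kermx_eq0 => /rowV0Pn[v /sub_kermxP vP v0].
exists (fun i => v 0 (enum_rank i)); split.
  apply: contrapT => /forallNP h; case/negP: v0; apply/eqP/rowP => a; rewrite mxE.
  by have /negP/negPn/eqP := h (enum_val a); rewrite enum_valK.
move=> j; have := congr1 (fun w : 'rV_r => w 0 j) vP; rewrite !mxE => e.
rewrite -[RHS]e [LHS](reindex (@enum_val I I)) /=; last first.
  by exists enum_rank => i _; rewrite ?enum_valK ?enum_rankK.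
by apply: eq_bigr => a _; rewrite enum_valK.
Qed.

Lemma dependent_spn (I : finType) (F : I -> fn) (s : seq fn) :
  (forall i, spn s (F i)) -> (size s < #|I|)%N -> dependent F.
Proof.
move=> /choice[c hc] hs.
pose P : 'M[R]_(#|I|, size s) := \matrix_(a, j) c (enum_val a) j.
have [|g [g0 hg]] := @dependent_ker _ _ P.
  by rewrite /row_free; apply/negP => /eqP e; have := rank_leq_col P; rewrite e leqNgt hs.
exists g; split=> // z; under eq_bigr => i _ do rewrite hc mulr_sumr.
rewrite exchange_big big1 // => j _ /=.
under eq_bigr => i _ do rewrite mulrA.
rewrite -mulr_suml; have := hg j; under eq_bigr => i _ do rewrite mxE enum_rankK.
by move=> ->; rewrite mul0r.
Qed.

Lemma det_horner n (N : 'M[{poly R}]_n) s :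
  (\det N).[s] = \det (\matrix_(i, j) (N i j).[s]).
Proof.
rewrite -[LHS]/(horner_eval s (\det N)) -det_map_mx; congr (\det _).
by apply/matrixP => i j; rewrite !mxE.
Qed.

(** Values at interpolation nodes detect dependence. If the functions were
    independent at 0, a minor of their values would be a nonzero polynomial in
    [s], and they would be independent at some [s] with [h.[s] != 0]. *)
Lemma dependent_limit (I : finType) (F : R -> I -> fn) (h : {poly R}) :
  (forall a z, exists p : {poly R}, forall s, F s a z = p.[s]) -> h != 0 ->
  (forall s, h.[s] != 0 -> dependent (F s)) -> dependent (F 0).
Proof.
move=> hF h0 hd; pose sF := [seq F 0 a | a <- enum I].
have sFa a : spn sF (F 0 a).
  have ha : (index a (enum I) < size (enum I))%N by rewrite index_mem mem_enum.
  have := @spn_nth _ _ _ sF (index a (enum I)); rewrite size_map (nth_map a) //.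
  by rewrite nth_index ?mem_enum //; apply.
have [r [y [u [_ _ hu]]]] := interp_basis_spn sF.
pose P : 'M[R]_(#|I|, r) := \matrix_(a, j) F 0 (enum_val a) (y j).
have [|nf] := boolP (row_free P); last first.
  have [g [g0 hg]] := dependent_ker nf; exists g; split=> // z.
  under eq_bigr => i _ do rewrite (hu _ (sFa i) z) mulr_sumr.
  rewrite exchange_big big1 // => j _ /=; under eq_bigr => i _ do rewrite mulrA.
  rewrite -mulr_suml; have := hg j; under eq_bigr => i _ do rewrite mxE enum_rankK.
  by move=> ->; rewrite mul0r.
move=> /row_freeP[B PB].
pose pF (a : 'I_#|I|) (j : 'I_r) := projT1 (cid (hF (enum_val a) (y j))).
have pFE a j s : (pF a j).[s] = F s (enum_val a) (y j).
  by rewrite /pF; case: cid => p /= ->.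
pose PP : 'M[{poly R}]_(#|I|, r) := \matrix_(a, j) pF a j.
pose d := \det (PP *m map_mx polyC B).
have ev s : \matrix_(i, j) ((PP *m map_mx polyC B) i j).[s] =
    (\matrix_(a, j) F s (enum_val a) (y j)) *m B.
  apply/matrixP => i j; rewrite !mxE horner_sum; apply: eq_bigr => a _.
  by rewrite !mxE hornerM hornerC pFE.
have dn0 : d != 0.
  apply/eqP => d0; have := congr1 (fun p => p.[0]) d0; rewrite /d det_horner ev.
  by rewrite -/P PB det1 horner0 => /eqP; rewrite oner_eq0.
have [s] := poly_nonroot (mulf_neq0 h0 dn0).
rewrite hornerM mulf_eq0 negb_or => /andP[/hd [g [[i gi] hg]]].
rewrite /d det_horner ev => dets.
exfalso; case/negP: gi; pose v : 'rV[R]_#|I| := \row_a g (enum_val a).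
have vP : v *m ((\matrix_(a, j) F s (enum_val a) (y j)) *m B) = 0.
  rewrite mulmxA (_ : v *m _ = 0) ?mul0mx //; apply/rowP => j; rewrite !mxE.
  apply: etrans (hg (y j)); rewrite [RHS](reindex (@enum_val I I)) /=; last first.
    by exists enum_rank => a _; rewrite ?enum_valK ?enum_rankK.
  by apply: eq_bigr => a _; rewrite !mxE.
have v0 : v = 0.
  have uQ : (\matrix_(a, j) F s (enum_val a) (y j)) *m B \in unitmx.
    by rewrite unitmxE unitfE; move: dets; congr (\det _ != 0); apply: ev.
  by rewrite -(mulmxK uQ v) vP mul0mx.
by have := congr1 (fun w : 'rV_#|I| => w 0 (enum_rank i)) v0; rewrite !mxE enum_rankK => /eqP.
Qed.

End LinearDependence.

Section Deformation.
Variables (R : rcfType) (k m : nat).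
Local Notation X := 'rV[R]_(k + m).
Local Notation fn := (X -> R).
Local Notation T := 'I_(k + m).
Local Notation bideg := (@bideg R k m).
Variable st : T -> nat * nat.

Definition deform (G F : T -> fn) (s : R) (t : T) : fn :=
  fun z => s * G t z + (1 - s) * F t z.

Lemma bd_deform (G F : T -> fn) s t : bideg (st t).1 (st t).2 (G t) ->
  bideg (st t).1 (st t).2 (F t) -> bideg (st t).1 (st t).2 (deform G F s t).
Proof. by move=> hG hF; apply: bd_add; apply: bd_scale. Qed.

(** At [s = 1] the system is [G] and the interpolation basis is expressed
    through [S] and [G]. Replacing [G] by the deformed system in these
    expressions perturbs the basis, and the matrix of its values at the nodes
    stays invertible as long as its determinant, a polynomial in [s], does not
    vanish. *)
Lemma spans_deform (G F : T -> fn) A B M :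
  (forall t, bideg (st t).1 (st t).2 (G t)) ->
  (forall t, bideg (st t).1 (st t).2 (F t)) ->
  (forall t, ((st t).1 <= A)%N /\ ((st t).2 <= B)%N) ->
  spans st G A B M ->
  exists h : {poly R}, h != 0 /\ forall s, h.[s] != 0 -> spans st (deform G F s) A B M.
Proof.
move=> hG hF hAB [S [hS hsp]].
have [r [y [u [bu uy hu]]]] := bd_interp R k m A B.
have [c hc] := choice (fun j => hsp (u j) (bu j)).
have {hc}[q hq] := choice hc.
pose V (s : R) (j : 'I_r) : fn := fun z =>
  \sum_i c j i * S i z + \sum_t q j t z * deform G F s t z.
have bV s j : bideg A B (V s j).
  apply: bd_add; first by apply: bd_sum => i; apply: bd_scale.
  apply: bd_sum => t; have [hA hB] := hAB t.
  have := bd_mul ((hq j).1 t) (bd_deform s (hG t) (hF t)).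
  by rewrite !subnK.
pose N : 'M[{poly R}]_r := \matrix_(j, i) ((\sum_l c j l * S l (y i))%:P +
  \sum_t (q j t (y i))%:P * ('X * (G t (y i))%:P + (1 - 'X) * (F t (y i))%:P)).
have NE s : \matrix_(j, i) (N j i).[s] = \matrix_(j, i) V s j (y i).
  apply/matrixP => j i; rewrite !mxE hornerD hornerC horner_sum; congr (_ + _).
  by apply: eq_bigr => t _; rewrite !hornerE.
exists (\det N); split.
  apply/eqP => d0; have := congr1 (fun p => p.[1]) d0; rewrite det_horner NE horner0.
  rewrite (_ : \matrix_(j, i) _ = 1%:M) ?det1; first by move/eqP; rewrite oner_eq0.
  apply/matrixP => j i; rewrite !mxE -uy (hq j).2 /V; congr (_ + _).
  by apply: eq_bigr => t _; rewrite /deform mul1r subrr mul0r addr0.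
move=> s; rewrite det_horner NE => ds.
set Ns : 'M[R]_r := \matrix_(j, i) _ in ds.
have uN : Ns \in unitmx by rewrite unitmxE unitfE.
exists S; split=> // f hf.
pose w : 'rV[R]_r := (\row_i f (y i)) *m invmx Ns.
have fE z : f z = \sum_j w 0 j * V s j z.
  rewrite (hu f hf z).
  under [RHS]eq_bigr => j _ do rewrite (hu _ (bV s j) z) mulr_sumr.
  rewrite [RHS]exchange_big /=; apply: eq_bigr => i _.
  under eq_bigr => j _ do rewrite mulrA.
  rewrite -mulr_suml; congr (_ * _).
  have := congr1 (fun v : 'rV_r => v 0 i) (mulmxKV uN (\row_i f (y i))).
  by rewrite -/w !mxE => <-; apply: eq_bigr => j _; rewrite !mxE.
exists (fun l => \sum_j w 0 j * c j l), (fun t z => \sum_j w 0 j * q j t z); split=> [t|z].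
  by apply: bd_sum => j; apply: bd_scale; apply: (hq j).1.
rewrite fE /V; under eq_bigr => j _ do rewrite mulrDr !mulr_sumr.
rewrite big_split /= exchange_big [X in _ + X]exchange_big /=; congr (_ + _).
  by apply: eq_bigr => l _; rewrite mulr_suml; apply: eq_bigr => j _; rewrite mulrA.
by apply: eq_bigr => t _; rewrite mulr_suml; apply: eq_bigr => j _; rewrite mulrA.
Qed.

Definition powers L (F : T -> fn) (b : {ffun T -> 'I_L.+1}) : fn :=
  fun z => \prod_t F t z ^+ b t.

(** The number of exponents on a face of the box, one power of [L.+1] below the
    number of all exponents. *)
Lemma card_face L t : #|[pred b : {ffun T -> 'I_L.+1} | b t == ord_max]| =
  (L.+1 ^ (k + m).-1)%N.
Proof.
pose Fam (s : T) : pred 'I_L.+1 := if s == t then pred1 ord_max else predT.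
rewrite (eq_card (B := family Fam)); last first.
  move=> b; rewrite !inE; apply/eqP/familyP => [bt s|/(_ t)].
    by rewrite /Fam; case: eqVneq => [->|] //; rewrite inE bt.
  by rewrite /Fam eqxx inE => /eqP.
rewrite card_family foldrE big_map big_enum /= (bigD1 t) //= {1}/Fam eqxx card1 mul1n.
rewrite (eq_bigr (fun _ => L.+1)) => [|s /negbTE st']; last first.
  by rewrite /Fam st' card_ord.
by rewrite prod_nat_const cardC1 card_ord.
Qed.

(** Rewriting [f] modulo the system and iterating expresses [f F^b] through
    products [S_j F^b'] and terms in which an exponent has passed the side of
    the box; the latter are counted by the faces of the box. *)
Lemma spn_powers (F : T -> fn) A B M D (y : 'I_D -> X) u L :
  (forall t, ((st t).1 <= A)%N /\ ((st t).2 <= B)%N) ->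
  spans st F A B M -> interp_basis (bideg A B) y u ->
  exists s : seq fn,
    (size s <= M * L.+1 ^ (k + m) + (k + m) * D * L.+1 ^ (k + m).-1)%N /\
    forall (f : fn) (b : {ffun T -> 'I_L.+1}), bideg A B f -> spn s (fun z => f z * powers F b z).
Proof.
move=> hAB [S [hS hsp]] [bu uy hu].
pose E1 := enum {: 'I_M * {ffun T -> 'I_L.+1}}.
pose s1 := [seq (fun z => S p.1 z * powers F p.2 z) | p <- E1].
pose bdry := [pred p : (T * 'I_D) * {ffun T -> 'I_L.+1} | p.2 p.1.1 == ord_max].
pose s2 := [seq (fun z => u p.1.2 z * (F p.1.1 z * powers F p.2 z)) | p <- enum bdry].
have in1 j (b : {ffun T -> 'I_L.+1}) : spn (s1 ++ s2) (fun z => S j z * powers F b z).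
  apply: spn_catl; have pin : (j, b) \in E1 by rewrite mem_enum.
  have ha : (index (j, b) E1 < size E1)%N by rewrite index_mem.
  have := @spn_nth _ _ _ s1 (index (j, b) E1).
  by rewrite size_map (nth_map (j, b)) // nth_index //; apply.
have in2 t l (b : {ffun T -> 'I_L.+1}) : b t = ord_max ->
    spn (s1 ++ s2) (fun z => u l z * (F t z * powers F b z)).
  move=> bt; apply: spn_catr; pose p := ((t, l), b).
  have pin : p \in enum bdry by rewrite mem_enum inE /= bt.
  have ha : (index p (enum bdry) < size (enum bdry))%N by rewrite index_mem.
  have := @spn_nth _ _ _ s2 (index p (enum bdry)).
  by rewrite size_map (nth_map p) // nth_index //; apply.
exists (s1 ++ s2); split.
  rewrite size_cat; have -> : size s1 = (M * L.+1 ^ (k + m))%N.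
    by rewrite size_map -cardT card_prod card_ffun !card_ord.
  have -> : size s2 = #|bdry| by rewrite size_map -cardE.
  rewrite leq_add2l -sum1_card.
  rewrite -(pair_big_dep xpredT (fun p (b : {ffun T -> 'I_L.+1}) => b p.1 == ord_max) (fun _ _ => 1%N)) /=.
  rewrite (eq_bigr (fun _ => L.+1 ^ (k + m).-1))%N => [|p _].
    by rewrite sum_nat_const card_prod !card_ord.
  by rewrite sum1_card -[RHS](card_face L p.1).
move=> f b; have [n] := ubnP (\sum_t (L - b t))%N; elim: n f b => // n IH f b.
rewrite ltnS => hn hf; have [c [q [hq ef]]] := hsp f hf.
have -> : (fun z => f z * powers F b z) = (fun z =>
    (\sum_j c j * (S j z * powers F b z)) + \sum_t q t z * (F t z * powers F b z)).
  apply: funext => z; rewrite ef mulrDl !mulr_suml; congr (_ + _); apply: eq_bigr => i _; by rewrite mulrA.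
apply: spn_add; first by apply: spn_sum => j _; apply: spn_scale.
apply: spn_sum => t _.
have bq : bideg A B (q t) by apply: bd_le (hq t); rewrite leq_subr.
have [bt|bt] := eqVneq (b t) ord_max.
  have -> : (fun z => q t z * (F t z * powers F b z)) =
     (fun z => \sum_l q t (y l) * (u l z * (F t z * powers F b z))).
    by apply: funext => z; rewrite (hu _ bq z) mulr_suml; apply: eq_bigr => l _; rewrite -mulrA.
  by apply: spn_sum => l _; apply: spn_scale; apply: in2.
have btL : (b t < L)%N.
  by rewrite ltn_neqAle -ltnS ltn_ord andbT; apply: contra bt => /eqP e; apply/eqP/val_inj.
pose b' : {ffun T -> 'I_L.+1} := [ffun s => if s == t then inord (b t).+1 else b s].
have b't : b' t = (b t).+1 :> nat by rewrite ffunE eqxx inordK.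
have b's s : s != t -> b' s = b s by move=> /negbTE st'; rewrite ffunE st'.
have -> : (fun z => q t z * (F t z * powers F b z)) = (fun z => q t z * powers F b' z).
  apply: funext => z; congr (_ * _); rewrite /powers (bigD1 t) //= [in RHS](bigD1 t) //= b't exprS mulrA.
  by congr (_ * _); apply: eq_bigr => s /b's ->.
apply: IH bq; move: hn; rewrite (bigD1 t) //= => hn; rewrite (bigD1 t) //= b't.
rewrite (eq_bigr (fun s => (L - b s)%N)) => [|s /b's ->] //.
move: hn btL; set x := (\sum_(i < k + m | i != t) _)%N; lia.
Qed.

(** Products [l ^ i * F^b] with [i <= M] and [b] in a box of side [L] are more
    numerous, for [L] large, than the generators of [spn_powers], so they are
    dependent for the deformed systems; [dependent_limit] carries this to [F]
    itself, which need not have the spanning property itself. *)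
Lemma algebraic_relation (F : T -> fn) (l : fn) :
  (forall t, bideg (st t).1 (st t).2 (F t)) -> bideg 1 1 l ->
  exists L (g : 'I_(cnt st).+1 * {ffun T -> 'I_L.+1} -> R), (exists p, g p != 0) /\
    forall z, \sum_p g p * (l z ^+ p.1 * powers F p.2 z) = 0.
Proof.
move=> hF hl; set M := cnt st.
pose A := (\sum_t (st t).1 + M.+1)%N; pose B := (\sum_t (st t).2 + M.+1)%N.
have hAB t : ((st t).1 <= A)%N /\ ((st t).2 <= B)%N.
  by split; rewrite /A /B (bigD1 t) //= -addnA leq_addr.
have [||h [h0 hs]] := spans_deform (bd_linprod R st) hF hAB (@spans_linprod R k m st A B _ _).
- by rewrite /A addnS ltnS leq_addr.
- by rewrite /B addnS ltnS leq_addr.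
have [D [y [u hu]]] := bd_interp R k m A B.
(* With this side the faces of the box are too small to matter. *)
pose L := ((k + m) * D)%N; exists L.
pose W s (p : 'I_M.+1 * {ffun T -> 'I_L.+1}) : fn :=
  fun z => l z ^+ p.1 * powers (deform (linprod st) F s) p.2 z.
suff [g [g0 hg]] : dependent (W 0).
  exists g; split=> // z; apply: etrans (hg z); apply: eq_bigr => p _.
  rewrite /W /powers; congr (_ * (_ * _)); apply: eq_bigr => t _.
  by rewrite /deform mul0r add0r subr0 mul1r.
apply: dependent_limit h0 _ => [p z|s /hs sp].
  exists ((l z ^+ p.1)%:P * \prod_t ('X * (linprod st t z)%:P + (1 - 'X) * (F t z)%:P) ^+ p.2 t) => s.
  rewrite hornerM hornerC horner_prod /W; congr (_ * _); apply: eq_bigr => t _.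
  by rewrite horner_exp /deform !hornerE.
have [s' [hsz hsp]] := spn_powers L hAB sp hu.
apply: (@dependent_spn _ _ _ _ _ s') => [p|].
  apply: hsp; have := bd_exp p.1 hl; rewrite !muln1; apply: bd_le.
    by rewrite /A; have := ltn_ord p.1; lia.
  by rewrite /B; have := ltn_ord p.1; lia.
apply: leq_ltn_trans hsz _; rewrite card_prod card_ffun !card_ord mulSn addnC ltn_add2r -/L.
case E: (k + m)%N => [|n]; last by rewrite expnS ltn_mul2r expn_gt0 /=.
by rewrite /L E mul0n.
Qed.

End Deformation.

(** * Generic fibres of square polynomial systems *)

Section GenericSets.
Variable R : rcfType.

(** Containing a dense open set, in terms of boxes. *)
Definition generic n (G : set 'rV[R]_n) : Prop :=
  forall x e, 0 < e -> exists y d, 0 < d /\ forall z, bx y z d -> bx x z e /\ G z.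

Lemma generic_seq n (T : eqType) (s : seq T) (G : T -> set 'rV[R]_n) :
  (forall i, i \in s -> generic (G i)) -> generic (fun x => forall i, i \in s -> G i x).
Proof.
elim: s => [|i s IH] h x e e0; first by exists x, e; split.
have [y [d [d0 hy]]] := h i (mem_head _ _) x e e0.
have [|y' [d' [d'0 hy']]] := IH _ y d d0; first by move=> j js; apply: h; rewrite inE js orbT.
exists y', d'; split=> // z /hy'[/hy[h1 h2] h3]; split=> // j.
by rewrite inE => /predU1P[->|]; auto.
Qed.

Lemma generic_all n (T : finType) (G : T -> set 'rV[R]_n) :
  (forall i, generic (G i)) -> generic (fun x => forall i, G i x).
Proof.
move=> h x e e0; have [|y [d [d0 hy]]] := @generic_seq n T (enum T) G _ x e e0; first by move=> i _.
by exists y, d; split=> // z /hy[h1 h2]; split=> // i; apply: h2; rewrite mem_enum.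
Qed.

Lemma generic_sub n (G G' : set 'rV[R]_n) : (forall x, G x -> G' x) -> generic G -> generic G'.
Proof.
move=> GG h x e e0; have [y [d [d0 hy]]] := h x e e0.
by exists y, d; split=> // z /hy[h1 h2]; split=> //; apply: GG.
Qed.

Lemma box_in_box n (x y : 'rV[R]_n) e : bx x y e -> exists d, 0 < d /\
  forall z, bx y z d -> bx x z e.
Proof.
move=> h; have [|i|d [d0 hd]] := @unif_delta R 'I_n (fun i d => `|x 0 i - y 0 i| + d < e).
- by move=> i d d' _ hd; apply: le_lt_trans; rewrite lerD2l.
- by exists ((e - `|x 0 i - y 0 i|) / 2); have := h i; lra.
exists d; split=> // z hz i; apply: le_lt_trans (ler_distD (y 0 i) _ _) _.
by apply: lt_trans (hd i); rewrite ltrD2l.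
Qed.

Lemma generic_neq0 n (f : 'rV[R]_n -> R) : cont f ->
  (forall x e, 0 < e -> exists y, bx x y e /\ f y != 0) -> generic (fun x => f x != 0).
Proof.
move=> cf h x e e0; have [y [xy fy]] := h x e e0.
have [d [d0 hd]] := box_in_box xy.
have [|d' [d'0 hd']] := cf y `|f y|; first by rewrite normr_gt0.
exists y, (Num.min d d'); split=> [|z hz]; first by rewrite lt_min d0.
split; first by apply: hd; apply: bx_le hz; rewrite ge_min lexx.
apply/eqP => fz; have := hd' z (bx_le _ hz); rewrite fz subr0 ltxx.
by move=> /(_ _)/negP; rewrite ge_min lexx orbT => /(_ isT).
Qed.

Lemma poly_nonroot_small (p : {poly R}) d : p != 0 -> 0 < d ->
  exists s, [/\ 0 < s, s < d & p.[s] != 0].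
Proof.
move=> p0 d0; apply: contrapT => h.
pose rs := [seq d / i.+2%:R | i <- iota 0 (size p)].
have := max_poly_roots (rs := rs) p0; rewrite size_map size_iota ltnn => H.
suff : false by []; apply: H.
  apply/allP => x /mapP[i _ ->]; apply/rootP; apply: contrapT => /eqP hx; apply: h.
  exists (d / i.+2%:R); split=> //; first by rewrite divr_gt0.
  by rewrite ltr_pdivrMr // ltr_pMr // ltr1n.
rewrite map_inj_uniq ?iota_uniq // => i j /(mulfI (lt0r_neq0 d0)) /invr_inj /eqP.
by rewrite eqr_nat => /eqP[].
Qed.

Lemma base_repr_inj K n (a b : nat -> nat) : (forall i, a i < K)%N -> (forall i, b i < K)%N ->
  (\sum_(i < n) a i * K ^ i = \sum_(i < n) b i * K ^ i)%N ->
  forall i, (i < n)%N -> a i = b i.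
Proof.
elim: n a b => [|n IH] a b ha hb //.
rewrite !big_ord_recl !expn0 !muln1.
have E (c : nat -> nat) : (\sum_(i < n) c (lift ord0 i) * K ^ lift ord0 i =
    K * \sum_(i < n) c i.+1 * K ^ i)%N.
  by rewrite big_distrr /=; apply: eq_bigr => i _; rewrite /bump /= expnS mulnCA.
rewrite !E => h; have K0 : (0 < K)%N by apply: leq_ltn_trans (ha 0%N).
have e0 : a 0%N = b 0%N.
  move: (congr1 (modn^~ K) h) => /=; rewrite !(addnC _ (K * _)%N) !(mulnC K) !modnMDl.
  by rewrite !modn_small.
move=> [|i] hi //; apply: (IH (fun i => a i.+1) (fun i => b i.+1)) => //.
by move: h; rewrite e0 => /addnI /eqP; rewrite eqn_pmul2l // => /eqP.
Qed.

Lemma uniq_take_ex (T : eqType) (s : seq T) M : uniq s -> (M < size s)%N ->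
  exists s', [/\ uniq s', size s' = M.+1 & {subset s' <= s}].
Proof.
move=> us hs; exists (take M.+1 s); split; first exact: take_uniq.
  by rewrite size_takel.
by move=> x /mem_take.
Qed.

Definition boxpoly n L (g : {ffun 'I_n -> 'I_L.+1} -> R) (v : 'rV[R]_n) : R :=
  \sum_b g b * \prod_t v 0 t ^+ b t.

Lemma cont_boxpoly n L (g : {ffun 'I_n -> 'I_L.+1} -> R) : cont (boxpoly g).
Proof.
apply: cont_sum => b; apply: cont_mul; first exact: cont_cst.
by apply: cont_prod => t; apply: cont_exp; apply: cont_coord.
Qed.

(** Kronecker substitution turns the coefficients [g] into those of a nonzero
    polynomial in one variable, which has a nonroot; the line from any point to
    the resulting point carries a nonzero polynomial, which has nonroots close
    to its origin. *)
Lemma boxpoly_neq0 n L (g : {ffun 'I_n -> 'I_L.+1} -> R) b0 : g b0 != 0 ->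
  generic (fun v => boxpoly g v != 0).
Proof.
move=> gb0; pose ex (b : {ffun 'I_n -> 'I_L.+1}) := (\sum_(t < n) b t * L.+1 ^ t)%N.
have ex_inj : injective ex.
  move=> b c h; pose nb (b : {ffun 'I_n -> 'I_L.+1}) (i : nat) : nat :=
    if insub i is Some i' then b i' else 0%N.
  have nbE (b' : {ffun 'I_n -> 'I_L.+1}) (i : 'I_n) : nb b' i = b' i by rewrite /nb valK.
  have nbl b' i : (nb b' i < L.+1)%N by rewrite /nb; case: insub.
  apply/ffunP => i; apply: val_inj; rewrite /= -!nbE.
  apply: (base_repr_inj (K := L.+1) (n := n)) => //.
  by rewrite (eq_bigr (fun t : 'I_n => b t * L.+1 ^ t)%N) => [|t _]; rewrite ?nbE // -/(ex b) h;
     apply: eq_bigr => t _; rewrite nbE.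
pose P : {poly R} := \sum_b g b *: 'X^(ex b).
have P0 : P != 0.
  apply/eqP => P0; case/negP: gb0; apply/eqP.
  have := congr1 (fun p : {poly R} => p`_(ex b0)) P0; rewrite coef0 coef_sum (bigD1 b0) //=.
  rewrite coefZ coefXn eqxx mulr1 big1 ?addr0 // => b bb0.
  by rewrite coefZ coefXn eq_sym (inj_eq ex_inj) (negbTE bb0) mulr0.
have [r hr] := poly_nonroot P0.
have [w hw] : exists w : 'rV[R]_n, boxpoly g w != 0.
  exists (\row_(t < n) r ^+ (L.+1 ^ t)).
  move: hr; congr (_ != 0); rewrite horner_sum; apply: eq_bigr => b _.
  rewrite hornerZ hornerXn; congr (_ * _); rewrite /ex expr_sum.
  by apply: eq_bigr => t _; rewrite mxE -exprM mulnC.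
apply: generic_neq0 (cont_boxpoly g) _ => x e e0.
pose Q : {poly R} := \sum_b g b *: \prod_t ((x 0 t)%:P + (w 0 t - x 0 t)%:P * 'X) ^+ b t.
have QE s : Q.[s] = boxpoly g (x + s *: (w - x)).
  rewrite horner_sum; apply: eq_bigr => b _; rewrite hornerZ horner_prod; congr (_ * _).
  by apply: eq_bigr => t _; rewrite horner_exp !hornerE !mxE [s * _]mulrC.
have Q0 : Q != 0.
  apply/eqP => Q0; case/negP: hw; have := QE 1; rewrite Q0 horner0 scale1r subrKC.
  by move=> <-.
pose C := 1 + \sum_t `|w 0 t - x 0 t|.
have C0 : 0 < C by rewrite ltr_wpDr // sumr_ge0.
have [s [s0 sd hs]] := poly_nonroot_small Q0 (divr_gt0 e0 C0).
exists (x + s *: (w - x)); split; last by rewrite -QE.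
move=> t; rewrite !mxE opprD addNKr normrN normrM gtr0_norm //.
move: sd; rewrite ltr_pdivlMr //; apply: le_lt_trans; apply: ler_wpM2l; first exact: ltW.
by rewrite /C (bigD1 t) //= addrCA lerDl addr_ge0 ?sumr_ge0.
Qed.

Lemma size_prod_bound (s : seq {poly R}) (N : nat) : (forall p : {poly R}, p \in s -> (size p <= N)%N) ->
  (size (\prod_(p <- s) p)%R <= (size s * N).+1)%N.
Proof.
elim: s => [|p s IH] h; first by rewrite big_nil size_poly1.
rewrite big_cons; apply: (leq_trans (size_polyMleq _ _)).
have h1 := h p (mem_head _ _).
have h2 := IH (fun q qs => h q (mem_behead (s := p :: s) qs)).
by move: h1 h2; rewrite /= mulSn; lia.
Qed.

Definition moment n (c : nat) (z : 'rV[R]_n) : R := \sum_j z 0 j * (c%:R : R) ^+ j.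

(** For a pair of distinct points the bad values of [c] are roots of a nonzero
    polynomial of degree less than [n]. *)
Lemma moment_separates n (s : seq 'rV[R]_n) : uniq s ->
  exists c, (c < (size s * size s * n).+1)%N /\ {in s &, injective (moment c)}.
Proof.
move=> us; pose df (p : 'rV[R]_n * 'rV[R]_n) : {poly R} := \poly_(j < n) oapp (fun j => p.1 0 j - p.2 0 j) 0 (insub j).
have dfE p (c : R) : (df p).[c] = \sum_j (p.1 0 j - p.2 0 j) * c ^+ j.
  by rewrite horner_poly; apply: eq_bigr => j _; rewrite valK.
pose prs := [seq p <- [seq (a, b) | a <- s, b <- s] | p.1 != p.2].
pose Pi := \prod_(q <- [seq df p | p <- prs]) q.
have szPi : (size Pi <= (size s * size s * n).+1)%N.
  apply: leq_trans (@size_prod_bound _ n _) _; first by move=> q /mapP[p _ ->]; apply: size_poly.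
  rewrite ltnS leq_mul2r size_map size_filter; apply/orP; right.
  by apply: leq_trans (count_size _ _) _; rewrite size_allpairs.
have Pi0 : Pi != 0.
  rewrite prodf_seq_neq0; apply/allP => q /mapP[p]; rewrite mem_filter => /andP[pp _] -> /=.
  apply: contra pp => /eqP dp; apply/eqP/rowP => j.
  have := congr1 (fun p : {poly R} => p`_j) dp; rewrite coef0 coef_poly ltn_ord valK /=.
  by move=> /subr0_eq.
apply: contrapT => hn.
pose rs := [seq (c%:R : R) | c <- iota 0 (size s * size s * n).+1].
have : (size rs < size Pi)%N; last by rewrite size_map size_iota ltnNge szPi.
apply: max_poly_roots => //; last first.
  by rewrite map_inj_uniq ?iota_uniq // => i j /eqP; rewrite eqr_nat => /eqP.
apply/allP => x /mapP[c]; rewrite mem_iota => /andP[_ hc] ->; apply/negPn/negP => nr.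
apply: hn; exists c; split=> // a b as' bs' hab; apply/eqP/negPn/negP => ab.
have dab : df (a, b) \in [seq df p | p <- prs].
  by apply: map_f; rewrite mem_filter /= ab; apply: allpairs_f.
move: nr; rewrite rootE horner_prod prodf_seq_neq0 => /allP/(_ _ dab)/=/eqP; apply.
have -> : (df (a, b)).[c%:R] = moment c a - moment c b.
  by rewrite dfE /moment -sumrB; apply: eq_bigr => j _; rewrite mulrBl.
by rewrite hab subrr.
Qed.

Definition grid_fiber k m (st : 'I_(k + m) -> nat * nat)
  (F : 'I_(k + m) -> 'rV[R]_(k + m) -> R) (v : 'rV[R]_(k + m)) : Prop :=
  forall zs : seq 'rV[R]_(k + m), uniq zs ->
    (forall z, z \in zs -> forall t, F t z = v 0 t) -> (size zs <= cnt st)%N.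

(** On the fibre over [v] every form [moment c] satisfies a polynomial equation
    of degree at most [cnt st], by [algebraic_relation]. Its coefficients are
    polynomials in [v], so it is a nontrivial equation for generic [v]; for
    finitely many [c] this holds simultaneously, and one of these forms
    separates the points of the fibre. *)
Lemma generic_fiber_bound k m (st : 'I_(k + m) -> nat * nat)
    (F : 'I_(k + m) -> 'rV[R]_(k + m) -> R) :
  (forall t, bideg (st t).1 (st t).2 (F t)) -> generic (grid_fiber st F).
Proof.
move=> hF; set M := cnt st; pose K := (M.+1 * M.+1 * (k + m)).+1.
have hm (c : nat) : bideg 1 1 (moment c : 'rV[R]_(k + m) -> R).
  by apply: bd_sum => j; apply: bd_ext (bd_scale _ (bd_coord R j)) => z /=; rewrite mulrC.
have rel (c : nat) := algebraic_relation hF (hm c).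
have {rel}rel (c : nat) : exists G : set 'rV[R]_(k + m), generic G /\ forall v, G v ->
    exists q : {poly R}, [/\ q != 0, (size q <= M.+1)%N &
      forall z, (forall t, F t z = v 0 t) -> root q (moment c z)].
  have [L [g [[[i0 b0] g0] hg]]] := rel c.
  exists (fun v => boxpoly (fun b => g (i0, b)) v != 0); split; first exact: boxpoly_neq0 g0.
  move=> v hv; exists (\poly_(i < M.+1) (if insub i is Some i' then boxpoly (fun b => g (i', b)) v else 0)).
  split; last 2 [exact: size_poly].
    apply/eqP => q0; case/negP: hv; apply/eqP.
    have := congr1 (fun p : {poly R} => p`_i0) q0.
    by rewrite coef0 coef_poly ltn_ord valK.
  move=> z hz; apply/rootP; apply: etrans (hg z); rewrite horner_poly.
  transitivity (\sum_(p : 'I_(cnt st).+1 * {ffun 'I_(k + m) -> 'I_L.+1})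
      g (p.1, p.2) * (moment c z ^+ p.1 * powers F p.2 z)); last by apply: eq_bigr => -[].
  rewrite -(pair_bigA _ (fun i b => g (i, b) * (moment c z ^+ i * powers F b z))) /=.
  apply: eq_bigr => i _; rewrite valK /boxpoly mulr_suml; apply: eq_bigr => b _.
  rewrite -mulrA [_ ^+ i * _]mulrC; congr (_ * (_ * _)); rewrite /powers.
  by apply: eq_bigr => t _; rewrite hz.
have [G hG] := choice rel.
have := @generic_all _ 'I_K (fun c => G c) (fun c => (hG c).1).
apply: generic_sub => v hv zs uzs hzs; rewrite leqNgt; apply/negP => big.
have [zs' [us' szs' sub]] := uniq_take_ex uzs big.
have [c [hc inj]] := moment_separates us'.
rewrite szs' -/K in hc.
have [q [q0 szq hq]] := (hG c).2 v (hv (Ordinal hc)).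
have := max_poly_roots (rs := [seq moment c z | z <- zs']) q0.
rewrite size_map szs' ltnNge szq => H; suff : false by []; apply: H.
  by apply/allP => x /mapP[z zin ->]; apply: hq; apply: hzs; apply: sub.
by rewrite map_inj_in_uniq.
Qed.

End GenericSets.

(** The equation for a coordinate has degree [e] in the point and 1 in the
    multipliers; the constraints only involve the point. *)
Definition lagrange_type k m (d : 'I_m -> nat) (e : nat) (t : 'I_(k + m)) : nat * nat :=
  match fintype.split t with inl _ => (e, 1%N) | inr i => (d i, 0%N) end.

(** A set contributes only if its complement avoids the constraints, which have
    degree 0 in the multipliers. *)
Lemma cnt_lagrange k m (d : 'I_m -> nat) e :
  (cnt (@lagrange_type k m d e) <= 'C(k, m) * e ^ (k - m) * \prod_i d i)%N.
Proof.
pose E := [set lshift m i | i : 'I_k]%SET.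
have cE : #|E| = k by rewrite card_imset ?card_ord //; exact: lshift_inj.
pose Good := [set Y : {set 'I_(k + m)} | (#|Y| == k) && (~: Y \subset E)]%SET.
have cG : (#|Good| <= 'C(k, m))%N.
  rewrite -[in X in (_ <= X)%N]cE -cards_draws -(card_imset (mem Good) (can_inj (@finset.setCK _))).
  apply: subset_leq_card; apply/fintype.subsetP => Y' /imsetP[Y hY ->]; move: hY; rewrite !inE => /andP[/eqP cY YE].
  rewrite YE /=; have := cardsC Y; rewrite card_ord cY => /addnI ->.
  by rewrite eqxx.
rewrite /cnt; apply: leq_trans (_ : \sum_(Y in Good) (e ^ (k - m) * \prod_i d i) <= _)%N; last first.
  by rewrite sum_nat_const -mulnA leq_mul2r cG orbT.
rewrite [X in (X <= _)%N](bigID (mem Good)) /= [X in (_ + X <= _)%N]big1 ?addn0; last first.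
  move=> Y /andP[cY]; rewrite inE cY /= => /fintype.subsetPn[t]; rewrite inE => tY tE.
  apply/eqP; rewrite prod_nat_seq_eq0; apply/hasP; exists t; first exact: mem_index_enum.
  rewrite /= (negbTE tY) /lagrange_type; case: fintype.splitP => j jt //=.
  by case/negP: tE; apply/imsetP; exists j => //; apply: val_inj.
rewrite big_mkcond [X in (_ <= X)%N]big_mkcond; apply: leq_sum => Y _.
case: (boolP (Y \in Good)) => hY; last by rewrite andbF.
rewrite andbT; case: ifP => // cY.
move: hY; rewrite inE => /andP[_ /fintype.subsetP YE].
rewrite big_split_ord /= leq_mul //; last first.
  apply: eq_leq; apply: eq_bigr => i _; rewrite /lagrange_type.
  rewrite (_ : fintype.split _ = inr i); last exact: (unsplitK (inr i)).
  case: ifP => // /negbT h; have := YE (rshift k i); rewrite inE h => /(_ isT)/imsetP[j _ /eqP].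
  by rewrite eq_rlshift.
rewrite (eq_bigr (fun i => if lshift m i \in Y then e else 1%N)) => [|i _]; last first.
  by rewrite /lagrange_type (_ : fintype.split _ = inl i) //; exact: (unsplitK (inl i)).
rewrite -big_mkcond prod_nat_const; apply: eq_leq; congr (_ ^ _)%N.
have hYr i : rshift k i \in Y.
  apply/negPn/negP => h; have := YE (rshift k i); rewrite inE h => /(_ isT)/imsetP[j _ /eqP].
  by rewrite eq_rlshift.
have cY' : (\sum_(t < k + m) (t \in Y) = k)%N.
  by rewrite -[RHS](eqP cY) -sum1_card [RHS]big_mkcond; apply: eq_bigr => t _; case: (t \in Y).
move: cY'; rewrite big_split_ord /= [X in (_ + X)%N](eq_bigr (fun _ => 1%N)) => [|i _]; last by rewrite hYr.
rewrite sum_nat_const card_ord muln1 => /(congr1 (subn^~ m)) /=; rewrite addnK => <-.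
rewrite -sum1_card big_mkcond.
by apply: eq_bigr => i _; rewrite -[LHS]/(if lshift m i \in Y then 1 else 0)%N; case: ifP.
Qed.

(** * Semi-algebraic sets near generic points *)

Section Cylinders.
Variable R : rcfType.

(** Polynomials in one variable with coefficients depending continuously on [z]. *)
Definition cpoly n (q : 'rV[R]_n -> {poly R}) : Prop :=
  (forall a, cont (fun z => (q z)`_a)) /\ exists N, forall z, (size (q z) <= N)%N.

Lemma cpoly_cst n (p : {poly R}) : cpoly (fun _ : 'rV[R]_n => p).
Proof. by split=> [a|]; [exact: cont_cst|exists (size p)]. Qed.

Lemma cpoly_add n (p q : 'rV[R]_n -> {poly R}) : cpoly p -> cpoly q ->
  cpoly (fun z => p z + q z).
Proof.
move=> [cp [N hN]] [cq [M hM]]; split=> [a|].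
  by have := cont_add (cp a) (cq a); congr cont; apply: funext => z; rewrite coefD.
exists (maxn N M) => z; apply: leq_trans (size_polyD _ _) _.
by rewrite geq_max !leq_max hN hM orbT.
Qed.

Lemma cpoly_mul n (p q : 'rV[R]_n -> {poly R}) : cpoly p -> cpoly q ->
  cpoly (fun z => p z * q z).
Proof.
move=> [cp [N hN]] [cq [M hM]]; split=> [a|].
  have := cont_sum (index_enum 'I_a.+1) xpredT (fun i : 'I_a.+1 => cont_mul (cp i) (cq (a - i)%N)).
  by congr cont; apply: funext => z; rewrite coefM.
exists (N + M)%N => z; apply: leq_trans (size_polyMleq _ _) _.
by apply: leq_trans (leq_pred _) _; apply: leq_add.
Qed.

Lemma cpoly_exp n (p : 'rV[R]_n -> {poly R}) k : cpoly p -> cpoly (fun z => p z ^+ k).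
Proof.
move=> hp; elim: k => [|k IH]; first exact: cpoly_cst.
by have := cpoly_mul hp IH; congr cpoly; apply: funext => z; rewrite exprS.
Qed.

Lemma cpoly_sum n (T : Type) (s : seq T) (f : T -> 'rV[R]_n -> {poly R}) :
  (forall i, cpoly (f i)) -> cpoly (fun z => \sum_(i <- s) f i z).
Proof.
move=> hf; elim: s => [|i s IH].
  by have := cpoly_cst n 0; congr cpoly; apply: funext => z; rewrite big_nil.
by have := cpoly_add (hf i) IH; congr cpoly; apply: funext => z; rewrite big_cons.
Qed.

Lemma cpoly_prod n (T : Type) (s : seq T) (f : T -> 'rV[R]_n -> {poly R}) :
  (forall i, cpoly (f i)) -> cpoly (fun z => \prod_(i <- s) f i z).
Proof.
move=> hf; elim: s => [|i s IH].
  by have := cpoly_cst n 1; congr cpoly; apply: funext => z; rewrite big_nil.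
by have := cpoly_mul (hf i) IH; congr cpoly; apply: funext => z; rewrite big_cons.
Qed.

Lemma cpoly_linepoly n m (p : {mpoly R[m]}) (x v : 'rV[R]_n -> 'rV[R]_m) :
  contV x -> contV v -> cpoly (fun z => linepoly p (x z) (v z)).
Proof.
move=> cx cv; have cC (f : 'rV[R]_n -> R) : cont f -> cpoly (fun z => (f z)%:P).
  move=> cf; split=> [a|]; last by exists 1%N => z; apply: size_polyC_leq1.
  have -> : (fun z => (f z)%:P`_a) = (fun z => (a == 0%N)%:R * f z).
    by apply: funext => z; rewrite coefC; case: (a == 0%N); rewrite ?mul1r ?mul0r.
  exact: cont_mul (cont_cst _) cf.
apply: cpoly_sum => mon; apply: cpoly_mul; first exact: cpoly_cst.
apply: cpoly_prod => i; apply: cpoly_exp; apply: cpoly_add; first exact: cC (cx i).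
by apply: cpoly_mul; [exact: cC (cv i)|exact: cpoly_cst].
Qed.

Definition up n (z : 'rV[R]_n) (t : R) : 'rV[R]_(n + 1) := row_mx z (const_mx t).

Lemma bx_up n (x z : 'rV[R]_n) d s t : bx x z d -> `|s - t| < d -> bx (up x s) (up z t) d.
Proof.
move=> h hst i; rewrite !mxE; case: (fintype.split i) => j; first exact: h.
by rewrite !mxE.
Qed.

(** The lowest coefficient in the last variable that is not identically zero is
    nonzero on a sub-box, and there it decides the sign of the polynomial close
    to the base. *)
Lemma cylinder n (A : set 'rV[R]_(n + 1)) : semialgebraic A ->
  forall x e, 0 < e -> exists y d, [/\ 0 < d, forall z, bx y z d -> bx x z e &
    forall z z' t t', bx y z d -> bx y z' d -> 0 < t < d -> 0 < t' < d ->
      A (up z t) -> A (up z' t')].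
Proof.
have base (p : {mpoly R[n + 1]}) : forall x e, 0 < e -> exists y d s,
    [/\ 0 < d, forall z, bx y z d -> bx x z e &
    forall z t, bx y z d -> 0 < t < d -> Num.sg p.@[up z t 0] = s].
  move=> x e e0; pose q z := linepoly p (up z 0) (up 0 1).
  have qE z t : (q z).[t] = p.@[up z t 0].
    rewrite horner_linepoly; apply: meval_eq => i; rewrite !mxE.
    by case: (fintype.split i) => j; rewrite !mxE ?mulr0 ?addr0 ?mulr1 ?add0r.
  have [cq [N hN]] : cpoly q.
    apply: cpoly_linepoly; last by ct.
    move=> i; rewrite /up; case: (fintype.splitP i) => j ij.
      have -> : (fun z : 'rV[R]_n => row_mx z (const_mx 0 : 'rV[R]_1) 0 i) = fun z => z 0 j.
        by apply: funext => z; rewrite (_ : i = lshift 1 j) ?row_mxEl //; apply: val_inj.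
      exact: cont_coord.
    have -> : (fun z : 'rV[R]_n => row_mx z (const_mx 0 : 'rV[R]_1) 0 i) = fun z => 0.
      by apply: funext => z; rewrite (_ : i = rshift n j) ?row_mxEr ?mxE //; apply: val_inj.
    exact: cont_cst.
  have [h0|/existsNP] := pselect (forall a z, bx x z e -> (q z)`_a = 0).
    exists x, e, 0; split=> // z t hz _; rewrite -qE (_ : q z = 0) ?horner0 ?sgr0 //.
    by apply/polyP => a; rewrite h0 // coef0.
  move=> [a0 /existsNP[z0 /not_implyP[hz0 /eqP qz0]]].
  have ex : exists a, `[< exists z, bx x z e /\ (q z)`_a <> 0 >].
    by exists a0; apply/asboolP; exists z0; split=> //; apply/eqP.
  (* The order in t of the generic member of the family q. *)
  case: (ex_minnP ex) => a /asboolP[y [hy /eqP qy]] amin.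
  have low z b : bx x z e -> (b < a)%N -> (q z)`_b = 0.
    move=> hz ba; apply: contrapT => h; move: ba; rewrite ltnNge => /negP; apply.
    by apply: amin; apply/asboolP; exists z.
  pose r (w : 'rV[R]_(n + 1)) := \sum_(b < N) (q (lsubmx w))`_(a + b) * rsubmx w 0 0 ^+ b.
  have cr : cont r.
    apply: cont_sum => b; apply: cont_mul; last by ct.
    by apply: (@cont_comp _ _ _ (fun z => (q z)`_(a + b))) (cq _); ct.
  have rE z t : bx x z e -> p.@[up z t 0] = t ^+ a * r (up z t).
    move=> hz; rewrite -qE (@horner_coef_wide _ (a + N)); last first.
      by apply: leq_trans (hN z) (leq_addl _ _).
    rewrite big_split_ord /= big1 ?add0r => [|b _]; last by rewrite low ?mul0r.
    rewrite /r row_mxKl row_mxKr mxE mulr_sumr; apply: eq_bigr => b _.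
    by rewrite exprD mulrCA.
  have N0 : (0 < N)%N.
    rewrite lt0n; apply/eqP => N0; case/negP: qy; apply/eqP.
    by apply: nth_default; apply: leq_trans (hN y) _; rewrite N0.
  have ry : r (up y 0) = (q y)`_a.
    rewrite /r row_mxKl row_mxKr mxE; case: (N) N0 => // N' _.
    rewrite big_ord_recl addn0 expr0 mulr1 big1 ?addr0 // => b _.
    by rewrite expr0n /= mulr0.
  have [d [d0 hd]] := box_in_box hy.
  have [|d' [d'0 hd']] := cr (up y 0) `|(q y)`_a|; first by rewrite normr_gt0.
  exists y, (Num.min d d'), (Num.sg (q y)`_a); split.
  - by rewrite lt_min d0.
  - by move=> z hz; apply: hd; apply: bx_le hz; rewrite ge_min lexx.
  move=> z t hz /andP[t0 td]; rewrite rE; last by apply: hd; apply: bx_le hz; rewrite ge_min lexx.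
  rewrite sgrM gtr0_sg ?exprn_gt0 // mul1r.
  have /hd' : bx (up y 0) (up z t) d'.
    apply: bx_up; first by apply: bx_le hz; rewrite ge_min lexx orbT.
    by rewrite sub0r normrN gtr0_norm //; apply: lt_le_trans td _; rewrite ge_min lexx orbT.
  rewrite ry; move: qy; case: (ltrgt0P ((q y)`_a)) => // qy _; rewrite ltr_norml => /andP[h1 h2].
    by rewrite !gtr0_sg //; lra.
  by rewrite !ltr0_sg //; lra.
pose cyl (B : set 'rV[R]_(n + 1)) y d := forall z z' t t', bx y z d -> bx y z' d ->
  0 < t < d -> 0 < t' < d -> B (up z t) -> B (up z' t').
have both B1 B2 : (forall x e, 0 < e -> exists y d, [/\ 0 < d, forall z, bx y z d -> bx x z e & cyl B1 y d]) ->
    (forall x e, 0 < e -> exists y d, [/\ 0 < d, forall z, bx y z d -> bx x z e & cyl B2 y d]) ->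
    forall x e, 0 < e -> exists y d, [/\ 0 < d, forall z, bx y z d -> bx x z e & cyl B1 y d /\ cyl B2 y d].
  move=> hB1 hB2 x e e0; have [y [d [d0 hd h1]]] := hB1 x e e0.
  have [y' [d' [d'0 hd' h2]]] := hB2 y d d0.
  have l1 : Num.min d d' <= d by rewrite ge_min lexx.
  have l2 : Num.min d d' <= d' by rewrite ge_min lexx orbT.
  have tl t : 0 < t < Num.min d d' -> (0 < t < d) /\ (0 < t < d').
    by move=> /andP[-> ht]; split; apply: lt_le_trans ht _.
  have sub z : bx y' z (Num.min d d') -> bx y z d by move=> hz; apply/hd'/(bx_le l2).
  exists y', (Num.min d d'); split; [by rewrite lt_min d0|by move=> z /sub/hd|split].
    by move=> z z' t t' /sub hz /sub hz' /tl[ht _] /tl[ht' _]; exact: h1.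
  by move=> z z' t t' /(bx_le l2) hz /(bx_le l2) hz' /tl[_ ht] /tl[_ ht']; exact: h2.
elim=> {A}.
- move=> p x e e0; have [y [d [s [d0 hd hs]]]] := base p x e e0.
  exists y, d; split=> // z z' t t' hz hz' ht ht' /= h.
  by have := hs _ _ hz ht; have /eqP := hs _ _ hz' ht'; rewrite h sgr0 => + s0; rewrite -s0 sgr_eq0 => /eqP.
- move=> p x e e0; have [y [d [s [d0 hd hs]]]] := base p x e e0.
  exists y, d; split=> // z z' t t' hz hz' ht ht' /= h.
  by rewrite -sgr_gt0 (hs _ _ hz' ht') -(hs _ _ hz ht) sgr_gt0.
- move=> A B _ hA _ hB x e e0; have [y [d [d0 hd [h1 h2]]]] := both A B hA hB x e e0.
  exists y, d; split=> // z z' t t' hz hz' ht ht' [h|h]; [left|right].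
    exact: h1 hz hz' ht ht' h.
  exact: h2 hz hz' ht ht' h.
- move=> A B _ hA _ hB x e e0; have [y [d [d0 hd [h1 h2]]]] := both A B hA hB x e e0.
  exists y, d; split=> // z z' t t' hz hz' ht ht' [hA1 hB1]; split.
    exact: h1 hz hz' ht ht' hA1.
  exact: h2 hz hz' ht ht' hB1.
- move=> A _ hA x e e0; have [y [d [d0 hd h1]]] := hA x e e0.
  exists y, d; split=> // z z' t t' hz hz' ht ht' nA hA1; apply: nA.
  exact: h1 hz' hz ht' ht hA1.
Qed.

Lemma subbox n (A : set 'rV[R]_n) : semialgebraic A -> forall x e, 0 < e ->
  exists y d, [/\ 0 < d, forall z, bx y z d -> bx x z e &
    (forall z, bx y z d -> A z) \/ (forall z, bx y z d -> ~ A z)].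
Proof.
move=> hA x e e0; have hA' : semialgebraic (fun w : 'rV[R]_(n + 1) => A (lsubmx w)) by sa.
have [y [d [d0 hd h]]] := cylinder hA' x e0.
have ht : 0 < d / 2 < d by apply/andP; split; lra.
exists y, d; split=> //; have [Ay|nAy] := pselect (A y); [left|right] => z hz.
  by have := h y z _ _ (bx_refl _ d0) hz ht ht; rewrite !row_mxKl; apply.
move=> Az; apply: nAy.
by have := h z y _ _ hz (bx_refl _ d0) ht ht; rewrite !row_mxKl; apply.
Qed.

(** By [subbox], each box contains a box inside the set or a box in its
    complement, and density excludes the latter. *)
Lemma dense_generic n (U A : set 'rV[R]_n) : semialgebraic U -> semialgebraic A ->
  (forall x e, 0 < e -> (forall z, bx x z e -> U z) -> exists y, bx x y e /\ A y) ->
  generic (fun x => U x -> A x).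
Proof.
move=> hU hA h x e e0.
have hUA : semialgebraic (fun x => U x -> A x) by sa.
have [y [d [d0 hd hc]]] := subbox hUA x e0.
exists y, d; split=> // z hz; split; first exact: hd.
case: hc => hc; first exact: hc hz.
exfalso; have [|a [ha Aa]] := h y d d0.
  by move=> a ha; apply: contrapT => nU; apply: (hc a ha) => /nU.
by apply: (hc a ha).
Qed.

End Cylinders.

(** * Linear sections in which given points are isolated *)

Section Isolation.
Variable R : rcfType.

Lemma row_free_complete a b k (A : 'M[R]_(a, k)) : row_free A -> (a + b <= k)%N ->
  exists N : 'M[R]_(b, k), row_free (col_mx A N).
Proof.
move=> fA abk; have rA : \rank A = a by apply/eqP.
pose r := \rank (A^C)%MS; have br : (b <= r)%N by rewrite /r mxrank_compl rA; lia.
pose N := (pid_mx b : 'M[R]_(b, r)) *m row_base (A^C)%MS.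
have rN : \rank N = b.
  rewrite mxrankMfree ?row_base_free // rank_pid_mx //.
have NC : (N <= A^C)%MS by apply: submx_trans (submxMl _ _) _; rewrite eq_row_base.
exists N; rewrite /row_free -addsmxE mxrank_disjoint_sum ?rA ?rN //.
apply/eqP; rewrite -submx0 -(capmx_compl A); exact: capmxS.
Qed.

Lemma row_free_col a k (A : 'M[R]_(a, k)) (w : 'rV[R]_k) : row_free A ->
  ~~ (w <= A)%MS -> row_free (col_mx A w).
Proof.
move=> fA nw; have rA : \rank A = a by apply/eqP.
rewrite /row_free eqn_leq rank_leq_row -addsmxE /=.
have lt : (\rank A < \rank (A + w)%MS)%N.
  apply: rank_ltmx; rewrite /ltmx addsmxSl /=; apply: contra nw => h.
  by apply: submx_trans h; apply: addsmxSr.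
by move: lt; rewrite rA; lia.
Qed.

Lemma row_bound n (v : 'rV[R]_n) d : 0 < d -> exists c, 0 < c /\
  forall i, `|c * v 0 i| < d.
Proof.
move=> d0; pose C := 1 + \sum_i `|v 0 i|.
have C0 : 0 < C by rewrite ltr_wpDr // sumr_ge0.
exists (d / C); split=> [|i]; first exact: divr_gt0.
rewrite normrM gtr0_norm ?divr_gt0 // mulrAC ltr_pdivrMr // ltr_pM2l //.
by rewrite /C (bigD1 i) //= addrCA ltrDl ltr_wpDr // sumr_ge0.
Qed.

Lemma free_in_box a k (A : 'M[R]_(a, k)) y d : row_free A -> (a < k)%N -> 0 < d ->
  exists w, bx y w d /\ row_free (col_mx A w).
Proof.
move=> fA ak d0; have [|N fN] := @row_free_complete a 1 k A fA; first by rewrite addn1.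
have nN : ~~ (N <= A)%MS.
  apply/negP => NA; have := eqP fN; rewrite -addsmxE (addsmx_idPl NA).
  by rewrite (eqP fA) => /eqP; rewrite addn1 ltn_eqF.
have [yA|yA] := boolP (y <= A)%MS; last by exists y; split; [exact: bx_refl|exact: row_free_col].
have [c [c0 hc]] := row_bound N d0.
exists (y + c *: N); split; first by move=> i; rewrite !mxE opprD addNKr normrN.
apply: row_free_col => //; apply: contra nN => h.
have -> : N = c^-1 *: ((y + c *: N) - y) by rewrite addrC addKr scalerA mulVf ?scale1r ?gt_eqF.
by apply: scalemx_sub; apply: addmx_sub => //; rewrite eqmx_opp.
Qed.

Variables (k p : nat) (Z : set 'rV[R]_k).
Hypotheses (hZ : semialgebraic Z) (cZ : cl Z).

(** The direction [w] and the time [t] can be recovered from a point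
    [x + s *m W + (sg * t) *: w], as long as [w] varies in an affine space of
    dimension [p] transverse to [W]. A lexicographic choice of [s] makes the
    point a semi-algebraic function of these [p.+1] parameters. *)
Lemma cube_of_directions x j (W : 'M[R]_(j, k)) (sg rho : R) y d :
  sg != 0 -> row_free W -> (j.+1 + p <= k)%N -> 0 < d ->
  (forall w t, bx y w d -> 0 < t < d -> exists s : 'rV[R]_j,
     (forall i, `|s 0 i| <= rho) /\ Z (x + s *m W + (sg * t) *: w)) ->
  cube_embeds p.+1 Z.
Proof.
move=> sg0 fW jpk d0 hyp.
have [w0 [yw0 fw0]] : exists w, bx y w d /\ row_free (col_mx W w).
  by apply: free_in_box => //; lia.
have [|N fN] := @row_free_complete _ p k _ fw0; first by rewrite addn1.
have [d1 [d10 hd1]] := box_in_box yw0.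
have [c [c0 hc]] : exists c, 0 < c /\ forall u : 'rV[R]_p, (forall i, 0 < u 0 i < 1) ->
    forall i, `|(c *: (u *m N)) 0 i| < d1.
  have [|c [c0 hc]] := @row_bound _ (\row_i \sum_l `|N l i|) d1; first by [].
  exists c; split=> // u hu i; apply: le_lt_trans (hc i).
  rewrite !mxE !normrM; apply: ler_wpM2l => //.
  apply: (le_trans _ (ler_norm _)); apply: (le_trans (ler_norm_sum _ _ _)).
  apply: ler_sum => l _.
  have /andP[u0 u1] := hu l; rewrite normrM gtr0_norm //.
  by apply: ler_piMl => //; apply: ltW.
pose w (xi : 'rV[R]_(1 + p)) : 'rV[R]_k := w0 + c *: (rsubmx xi *m N).
pose t (xi : 'rV[R]_(1 + p)) : R := d * lsubmx xi 0 0.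
pose K (xi : 'rV[R]_(1 + p)) (s : 'rV[R]_j) := (forall i, `|s 0 i| <= rho) /\
  Z (x + s *m W + (sg * t xi) *: w xi).
pose S xi := xget 0 (lexmin (K xi)).
have cubeE (xi : 'rV[R]_(1 + p)) : open_unit_cube xi -> bx y (w xi) d /\ 0 < t xi < d.
  move=> h; split.
    apply: hd1 => i; rewrite /w mxE opprD addNKr normrN.
    by apply: hc => l; rewrite mxE; apply: h.
  have /andP[h0 h1] := h (lshift p 0); rewrite /t mxE.
  by rewrite mulr_gt0 //= gtr_pMr.
have SP xi : open_unit_cube xi -> lexmin (K xi) (S xi).
  move=> /cubeE[h1 h2]; have [|||| s hs] := @lexmin_exists R j (K xi).
  - by rewrite /K; sa.
  - by rewrite /K; ct.
  - by exists rho => s [].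
  - exact: hyp.
  exact: (xgetPex 0 (ex_intro _ s hs)).
pose f xi := x + S xi *m W + (sg * t xi) *: w xi.
have inj (a b : 'rV[R]_(1 + p)) : open_unit_cube a -> open_unit_cube b -> f a = f b -> a = b.
  move=> ha hb; rewrite /f => e.
  have [_ /andP[ta _]] := cubeE _ ha; have [_ /andP[tb _]] := cubeE _ hb.
  have : row_mx (row_mx (S a - S b) (const_mx (sg * (t a - t b))))
     ((sg * c) *: (t a *: rsubmx a - t b *: rsubmx b)) *m col_mx (col_mx W w0) N = 0.
    rewrite !mul_row_col mulmxBl; have := subrr (x + S a *m W + (sg * t a) *: w a).
    rewrite {2}e => <-.
    have -> : (const_mx (sg * (t a - t b)) : 'rV[R]_1) *m w0 = (sg * (t a - t b)) *: w0.
      by rewrite (_ : const_mx _ = (sg * (t a - t b))%:M) ?mul_scalar_mx //; apply/rowP => i; rewrite !mxE ord1.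
    rewrite /w -scalemxAl mulmxBl -!scalemxAl; apply/rowP => i; rewrite !mxE; ring.
  move/eqP; rewrite (mulmx_free_eq0 _ fN) => /eqP.
  rewrite -[0]row_mx0 => /eq_row_mx[]; rewrite -[0]row_mx0 => /eq_row_mx[_ h1] h2.
  have tab : t a = t b.
    have := congr1 (fun v : 'rV_1 => v 0 0) h1; rewrite !mxE => /eqP.
    by rewrite mulf_eq0 (negbTE sg0) /= subr_eq0 => /eqP.
  have rab : rsubmx a = rsubmx b.
    move: h2; rewrite tab -scalerBr scalerA => /eqP.
    have nz : sg * c * t b != 0 by apply: mulf_neq0; [apply: mulf_neq0|]; rewrite // gt_eqF.
    rewrite scaler_eq0 (negbTE nz) /= subr_eq0.
    by move/eqP.
  rewrite -[a]hsubmxK -[b]hsubmxK rab; congr row_mx.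
  apply/rowP => i; rewrite ord1; apply: (mulfI (lt0r_neq0 d0)); exact: tab.
exists f; split.
- have h : semialgebraic (fun z : 'rV[R]_((1 + p) + k) =>
      (forall i, 0 < lsubmx z 0 i /\ lsubmx z 0 i < 1) /\
      exists s : 'rV[R]_j, lexmin (K (lsubmx z)) s /\
        rsubmx z = x + s *m W + (sg * t (lsubmx z)) *: w (lsubmx z)).
    by rewrite /lexmin /lexlt /K /t /w; sa.
  apply: semialgebraic_ext h => z /=; split=> [[hz [s [hs ->]]]|[hz ->]].
    have cz : open_unit_cube (lsubmx z : 'rV[R]_(1 + p)).
      by move=> i; have [-> ->] := hz i.
    by split=> //; rewrite /f (lexmin_uniq hs (SP _ cz)).
  split=> [i|]; first by have /andP[] := hz i.
  by exists (S (lsubmx z)); split=> //; exact: SP.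
- by move=> a b /set_mem ha /set_mem hb; exact: (inj a b ha hb).
- by move=> _ [xi hxi <-]; have [[_ h] _] := SP xi hxi.
Qed.

Hypothesis nemb : ~ cube_embeds p.+1 Z.

(** By [cylinder], near some direction either all directions meet [Z] for all
    small times, which [cube_of_directions] excludes, or none does. *)
Lemma good_direction x j (W : 'M[R]_(j, k)) (sg rho : R) :
  sg != 0 -> row_free W -> (j.+1 + p <= k)%N ->
  generic (fun w => exists r, 0 < r /\ forall t (s : 'rV[R]_j), 0 < t < r ->
     (forall i, `|s 0 i| <= rho) -> ~ Z (x + s *m W + (sg * t) *: w)).
Proof.
move=> sg0 fW jpk x0 e e0.
pose T (z : 'rV[R]_(k + 1)) := exists s : 'rV[R]_j, (forall i, `|s 0 i| <= rho) /\
  Z (x + s *m W + (sg * rsubmx z 0 0) *: lsubmx z).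
have hT : semialgebraic T by rewrite /T; sa.
have [y [d [d0 hd hc]]] := cylinder hT x0 e0.
have hd2 : 0 < d / 2 < d by apply/andP; split; lra.
have [Ty|nTy] := pselect (T (up y (d / 2))).
  exfalso; apply: nemb; apply: (@cube_of_directions x j W sg rho y d) => // w t hw ht.
  have [s] := hc _ _ _ _ (bx_refl y d0) hw hd2 ht Ty.
  by rewrite row_mxKl row_mxKr mxE => hs; exists s.
exists y, d; split=> // z hz; split; first exact: hd.
exists d; split=> // t s ht hs hZz; apply: nTy; apply: hc hz (bx_refl y d0) ht hd2 _.
by exists s; rewrite row_mxKl row_mxKr mxE.
Qed.

(** Directions are added one at a time, generic for all the points and for both
    signs of the time. *)
Lemma isolating_subspace (xs : seq 'rV[R]_k) j : (j + p <= k)%N ->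
  exists W : 'M[R]_(j, k), row_free W /\ exists rho, 0 < rho /\
    forall x, x \in xs -> forall s : 'rV[R]_j, s != 0 -> (forall i, `|s 0 i| <= rho) ->
      ~ Z (x + s *m W).
Proof.
elim: j => [|j IH] jpk.
  exists 0; split; first by rewrite /row_free mxrank0.
  by exists 1; split=> // x _ s /eqP[]; apply/rowP => -[].
have [|W [fW [rho [rho0 hW]]]] := IH; first by lia.
pose G (q : 'rV[R]_k * R) (w : 'rV[R]_k) := exists r, 0 < r /\ forall t (s : 'rV[R]_j),
  0 < t < r -> (forall i, `|s 0 i| <= rho) -> ~ Z (q.1 + s *m W + (q.2 * t) *: w).
have gG q : q \in [seq (x, sg) | x <- xs, sg <- [:: 1; -1]] -> generic (G q).
  move=> /allpairsP[[x sg] /= [_ hsg ->]]; apply: good_direction => //.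
  by move: hsg; rewrite !inE => /orP[] /eqP ->; rewrite ?oppr_eq0 oner_neq0.
have [y [d [d0 hd]]] := generic_seq gG 0 ltr01.
have [w [hw fw]] : exists w, bx y w d /\ row_free (col_mx W w).
  by apply: free_in_box => //; lia.
have [_ Gw] := hd w hw.
have [||r [r0 hr]] := @unif_seq R _ [seq (x, sg) | x <- xs, sg <- [:: 1; -1]]
   (fun q r => forall t (s : 'rV[R]_j), 0 < t < r ->
     (forall i, `|s 0 i| <= rho) -> ~ Z (q.1 + s *m W + (q.2 * t) *: w)).
- by move=> q r r' _ rr' H t s /andP[t0 tr]; apply: H; rewrite t0 (lt_le_trans tr).
- by move=> q /Gw.
have e1 : j.+1 = (j + 1)%N by rewrite addn1.
exists (castmx (esym e1, erefl k) (col_mx W w)).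
suff H : row_free (col_mx W w) /\ exists rho, 0 < rho /\
    forall x, x \in xs -> forall s : 'rV[R]_(j + 1), s != 0 -> (forall i, `|s 0 i| <= rho) ->
      ~ Z (x + s *m col_mx W w).
  by move: H; move: (col_mx W w); case: _ / (esym e1).
split=> //; exists (Num.min rho (r / 2)); split; first by rewrite lt_min rho0; lra.
move=> x xin s s0 hs; rewrite -[s]hsubmxK mul_row_col.
set s1 := lsubmx s; set t := rsubmx s 0 0.
have hs1 i : `|s1 0 i| <= rho.
  by rewrite mxE; apply: le_trans (hs _) _; rewrite ge_min lexx.
have ht : `|t| < r.
  rewrite /t mxE; apply: le_lt_trans (hs _) _.
  have : Num.min rho (r / 2) <= r / 2 by rewrite ge_min lexx orbT.
  lra.
have -> : rsubmx s *m w = t *: w.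
  by rewrite [rsubmx s]mx11_scalar mul_scalar_mx.
rewrite addrA; case: (ltrgt0P t) => t0.
- have qin : (x, 1 : R) \in [seq (x, sg) | x <- xs, sg <- [:: 1; -1 : R]].
    by apply/allpairsP; exists (x, 1 : R); rewrite /= xin mem_head.
  have := hr _ qin t s1; rewrite /= mul1r; apply => //.
  by rewrite t0 -[t]gtr0_norm.
- have qin : (x, -1 : R) \in [seq (x, sg) | x <- xs, sg <- [:: 1; -1 : R]].
    by apply/allpairsP; exists (x, -1 : R); rewrite /= xin !inE eqxx orbT.
  have := hr _ qin (- t) s1; rewrite /= mulrNN mul1r; apply => //.
  by rewrite oppr_gt0 t0 -[- t]ltr0_norm.
- rewrite t0 scale0r addr0; apply: hW => //.
  apply: contra s0 => /eqP s10; apply/eqP; rewrite -[s]hsubmxK -/s1 s10.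
  by apply/rowP => i; rewrite !mxE; case: (fintype.split i) => i'; rewrite ?mxE // ord1 -t0 /t mxE.
Qed.

End Isolation.

(** * Degrees and derivatives of polynomials *)

Section Gradients.
Variable R : rcfType.

Definition dle n d (p : {mpoly R[n]}) : Prop := (msize p <= d.+1)%N.

Lemma dle_le n d d' (p : {mpoly R[n]}) : (d <= d')%N -> dle d p -> dle d' p.
Proof. by move=> h h1; apply: leq_trans h1 _. Qed.

Lemma dle_coef n d (p : {mpoly R[n]}) : (forall m, p@_m != 0 -> (mdeg m <= d)%N) -> dle d p.
Proof.
move=> h; rewrite /dle msizeE big_seq; elim/big_ind: _ => //.
  by move=> a b ha hb; rewrite geq_max ha.
by move=> m; rewrite mcoeff_msupp => /h.
Qed.

Lemma coef_dle n d (p : {mpoly R[n]}) m : dle d p -> p@_m != 0 -> (mdeg m <= d)%N.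
Proof.
move=> h pm; rewrite -ltnS; apply: leq_trans h.
by apply: msize_mdeg_lt; rewrite mcoeff_msupp.
Qed.

Lemma dle_add n d (p q : {mpoly R[n]}) : dle d p -> dle d q -> dle d (p + q).
Proof.
move=> hp hq; apply: dle_coef => m; rewrite mcoeffD => h.
have [p0|p0] := eqVneq p@_m 0; last exact: coef_dle hp p0.
by apply: (coef_dle hq); move: h; rewrite p0 add0r.
Qed.

Lemma dle_scale n d c (p : {mpoly R[n]}) : dle d p -> dle d (c *: p).
Proof. by move=> h; apply: leq_trans (msizeZ_le _ _) h. Qed.

Lemma dle_opp n d (p : {mpoly R[n]}) : dle d p -> dle d (- p).
Proof. by rewrite -scaleN1r; exact: dle_scale. Qed.

Lemma dle_sum n d (T : Type) (s : seq T) (f : T -> {mpoly R[n]}) :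
  (forall i, dle d (f i)) -> dle d (\sum_(i <- s) f i).
Proof.
move=> h; elim: s => [|i s IH]; first by rewrite big_nil /dle msize0.
by rewrite big_cons; apply: dle_add.
Qed.

Lemma dle_mul n d e (p q : {mpoly R[n]}) : dle d p -> dle e q -> dle (d + e) (p * q).
Proof.
rewrite /dle => hp hq; have [->|p0] := eqVneq p 0; first by rewrite mul0r msize0.
have [->|q0] := eqVneq q 0; first by rewrite mulr0 msize0.
by rewrite msizeM //; move: (msize p) (msize q) hp hq => a b; lia.
Qed.

Lemma dle_deriv n d (p : {mpoly R[n]}) i : dle d p -> dle d.-1 (p^`M(i)).
Proof.
move=> hp; apply: dle_coef => m; rewrite mcoeff_deriv => h.
have /(coef_dle hp) : p@_(m + U_(i)) != 0 by apply: contra h => /eqP ->; rewrite mul0rn.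
by rewrite mdegD mdeg1; lia.
Qed.

Lemma dle_X n i : dle 1 ('X_i : {mpoly R[n]}).
Proof. by rewrite /dle msizeX mdeg1. Qed.

Lemma bideg_dle k m d (p : {mpoly R[k]}) : dle d p ->
  bideg d 0 (fun z : 'rV[R]_(k + m) => p.@[lsubmx z 0]).
Proof.
move=> hp; apply: (bd_ext (f := fun z : 'rV[R]_(k + m) => \sum_(mo <- msupp p)
    (if (mdeg mo <= d)%N then fun z => p@_mo * \prod_i lsubmx z 0 i ^+ mo i else fun _ => 0) z)).
  move=> z; rewrite mevalE big_seq [RHS]big_seq; apply: eq_bigr => mo.
  by rewrite mcoeff_msupp => /(coef_dle hp) ->.
apply: bd_sum => mo; case: ifP => hm; last exact: bd_cst.
apply: bd_scale; apply: (@bd_le _ _ _ (mdeg mo) 0) => //.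
rewrite mdegE; elim: (index_enum _) => [|i s IH].
  by rewrite big_nil; apply: bd_ext (bd_cst _ _ _ _ 1) => z; rewrite big_nil.
have h := bd_exp (mo i) (bd_x R m i); rewrite muln1 muln0 in h.
rewrite big_cons; apply: bd_ext (bd_mul h IH) => z.
by rewrite big_cons mxE.
Qed.

Definition dirder n (v : 'rV[R]_n) (p : {mpoly R[n]}) : {mpoly R[n]} :=
  \sum_i v 0 i *: p^`M(i).

Lemma dle_dirder n d v (p : {mpoly R[n]}) : dle d p -> dle d.-1 (dirder v p).
Proof. by move=> h; apply: dle_sum => i; apply: dle_scale; apply: dle_deriv. Qed.

Lemma dirder_add n (v : 'rV[R]_n) p q : dirder v (p + q) = dirder v p + dirder v q.
Proof. by rewrite /dirder -big_split; apply: eq_bigr => i _; rewrite mderivD scalerDr. Qed.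

Lemma dirder_scale n (v : 'rV[R]_n) c p : dirder v (c *: p) = c *: dirder v p.
Proof. by rewrite /dirder scaler_sumr; apply: eq_bigr => i _; rewrite mderivZ !scalerA mulrC. Qed.

Lemma dirder_opp n (v : 'rV[R]_n) p : dirder v (- p) = - dirder v p.
Proof. by rewrite -scaleN1r dirder_scale scaleN1r. Qed.

Lemma dirder_mul n (v : 'rV[R]_n) p q : dirder v (p * q) = dirder v p * q + p * dirder v q.
Proof.
rewrite /dirder mulr_suml mulr_sumr -big_split; apply: eq_bigr => i _ /=.
by rewrite mderivM scalerDr scalerAl scalerAr.
Qed.

Lemma dirder_sum n (v : 'rV[R]_n) (T : Type) (s : seq T) (f : T -> {mpoly R[n]}) :
  dirder v (\sum_(i <- s) f i) = \sum_(i <- s) dirder v (f i).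
Proof.
elim: s => [|i s IH]; last by rewrite !big_cons dirder_add IH.
by rewrite !big_nil /dirder big1 // => i _; rewrite mderiv0 scaler0.
Qed.

Lemma dirder_X n (v : 'rV[R]_n) i : dirder v 'X_i = (v 0 i)%:MP.
Proof.
rewrite /dirder (bigD1 i) //= mderivX mnm1E eqxx scale1r.
have -> : (U_(i) - U_(i) = 0 :> 'X_{1..n})%MM by have := addmK U_(i)%MM 0%MM; rewrite add0m.
rewrite mpolyX0 big1 ?addr0 => [|j ji]; first exact: alg_mpolyC.
by rewrite mderivX mnm1E eq_sym (negbTE ji) scale0r scaler0.
Qed.

Lemma dirder_C n (v : 'rV[R]_n) c : dirder v c%:MP = 0.
Proof. by rewrite /dirder big1 // => i _; rewrite mderivC scaler0. Qed.

Lemma deriv_linepoly n (p : {mpoly R[n]}) (x v : 'rV[R]_n) :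
  (linepoly p x v)^`().[0] = (dirder v p).@[x 0].
Proof.
have L0 q : (linepoly q x v).[0] = q.@[x 0] by rewrite horner_linepoly scale0r addr0.
pose P q := (linepoly q x v)^`().[0] = (dirder v q).@[x 0].
have PM q r : P q -> P r -> P (q * r).
  rewrite /P => hq hr; rewrite dirder_mul /linepoly rmorphM derivM hornerD !hornerM.
  by rewrite -/(linepoly q x v) -/(linepoly r x v) hq hr !L0 mevalD !mevalM.
have PC c : P c%:MP.
  by rewrite /P /linepoly mmapC derivC horner0 dirder_C meval0.
have PX i : P 'X_i.
  rewrite /P /linepoly mmapX mmap1U derivD derivC add0r deriv_mulC derivX mulr1 hornerC.
  by rewrite dirder_X mevalC.
have PXn i k : P ('X_i ^+ k).
  by elim: k => [|k IH]; [rewrite expr0 -mpolyC1; exact: PC|rewrite exprS; apply: PM].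
have Pm mo : P 'X_[mo].
  rewrite mpolyXE_id; elim: (index_enum _) => [|i s IH].
    by rewrite big_nil -mpolyC1; exact: PC.
  by rewrite big_cons; apply: PM.
rewrite -/(P p); elim/mpolyind: p => [|c mo p _ _ IH]; first by rewrite -mpolyC0; exact: PC.
rewrite /P /linepoly rmorphD derivD hornerD -!/(linepoly _ x v) IH dirder_add mevalD.
by congr (_ + _); rewrite -mul_mpolyC; apply: PM.
Qed.

(** Otherwise [g - g.[0]] is [X] times a polynomial of constant sign near 0, and
    changes sign. *)
Lemma deriv_local_min (g : {poly R}) e : 0 < e ->
  (forall t, `|t| < e -> g.[0] <= g.[t]) -> g^`().[0] = 0.
Proof.
move=> e0 h; apply/eqP/negPn/negP => g'0.
have [h' hE] : exists h' : {poly R}, g - (g.[0])%:P = h' * 'X.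
  have /factor_theorem[h' ->] : root (g - (g.[0])%:P) 0 by rewrite /root !hornerE subrr.
  by exists h'; rewrite subr0.
have gE t : g.[t] = g.[0] + t * h'.[t].
  have := congr1 (fun p => p.[t]) hE; rewrite !hornerE => /eqP.
  by rewrite subr_eq addrC mulrC => /eqP.
have h'0 : h'.[0] = g^`().[0].
  have := congr1 (fun p : {poly R} => p^`().[0]) hE.
  by rewrite derivB derivC subr0 derivM derivX !hornerE ?mulr0 ?add0r => ->.
have [|d d0 hd] := @poly_cont R 0 h' `|h'.[0]|; first by rewrite normr_gt0 h'0.
pose t0 := Num.min d e / 2.
have m0 : 0 < Num.min d e by rewrite lt_min d0.
have t00 : 0 < t0 by rewrite /t0; lra.
have t0d : t0 < d.
  have : Num.min d e <= d by rewrite ge_min lexx.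
  by rewrite /t0; lra.
have t0e : t0 < e.
  have : Num.min d e <= e by rewrite ge_min lexx orbT.
  by rewrite /t0; lra.
have key t : `|t| = t0 -> ~ (t * h'.[0] < 0).
  move=> ht hth; have := h t; rewrite ht (gE t) => /(_ t0e); rewrite lerDl.
  have := hd t; rewrite subr0 ht => /(_ t0d) hh; rewrite leNgt => /negP; apply.
  have [tn|tp|t0'] := ltrgt0P t.
  - have h0 : h'.[0] < 0 by move: hth; rewrite pmulr_rlt0.
    rewrite pmulr_rlt0 //; move: hh; rewrite (ltr0_norm h0) ltr_norml => /andP[_]; lra.
  - have h0 : 0 < h'.[0] by move: hth; rewrite nmulr_rlt0.
    rewrite nmulr_rlt0 //; move: hh; rewrite (gtr0_norm h0) ltr_norml => /andP[]; lra.
  - by move: hth; rewrite t0' mul0r ltxx.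
rewrite -h'0 in g'0; have [hp|hn|h0] := ltrgt0P h'.[0].
- by apply: (key (- t0)); rewrite ?normrN ?gtr0_norm // mulNr oppr_lt0 mulr_gt0.
- by apply: (key t0); rewrite ?gtr0_norm // pmulr_rlt0.
- by rewrite h0 eqxx in g'0.
Qed.

Lemma dirder_local_min n (p : {mpoly R[n]}) (x v : 'rV[R]_n) e : 0 < e ->
  (forall t, `|t| < e -> p.@[x 0] <= p.@[(x + t *: v) 0]) -> (dirder v p).@[x 0] = 0.
Proof.
move=> e0 h; rewrite -deriv_linepoly; apply: deriv_local_min e0 _ => t ht.
by rewrite !horner_linepoly scale0r addr0; apply: h.
Qed.

Lemma dirder_delta n (p : {mpoly R[n]}) i : dirder (delta_mx 0 i) p = p^`M(i).
Proof.
rewrite /dirder (bigD1 i) //= mxE !eqxx scale1r big1 ?addr0 // => j ji.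
by rewrite mxE eqxx (negbTE ji) scale0r.
Qed.

Lemma mderiv_local_min n (p : {mpoly R[n]}) (x : 'rV[R]_n) e : 0 < e ->
  (forall y, bx x y e -> p.@[x 0] <= p.@[y 0]) -> forall i, (p^`M(i)).@[x 0] = 0.
Proof.
move=> e0 h i; rewrite -dirder_delta; apply: dirder_local_min e0 _ => t ht.
apply: h => j; rewrite !mxE opprD addNKr normrN normrM.
apply: le_lt_trans ht; rewrite ler_piMr //.
by case: (_ && _); rewrite ?normr1 ?normr0.
Qed.

End Gradients.

(** * Polar equations *)

Section PolarVariety.
Variables (R : rcfType) (k q : nat) (Q : {mpoly R[k]}).
Variables (W : 'M[R]_(q.+1, k)) (V : 'M[R]_(k, q.+1)).
Hypothesis WV : W *m V = 1%:M.

Definition ucoord (l : 'I_q.+1) : {mpoly R[k]} := \sum_i V i l *: 'X_i.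

Lemma ucoordE l (x : 'rV[R]_k) : (ucoord l).@[x 0] = (x *m V) 0 l.
Proof.
rewrite /ucoord raddf_sum /= mxE; apply: eq_bigr => i _.
by rewrite mevalZ mevalXU mulrC.
Qed.

(** The fibre over [c] is cut out by the value [c 0 ord0] of [Qc c] and by the
    vanishing of its derivatives along all rows of [W] but the first, where
    [Qc c] is [Q] minus a small linear form. *)
Definition polar (l : 'I_q.+1) : {mpoly R[k]} :=
  match unlift ord0 l with
  | Some l' => dirder (row (lift ord0 l') W) Q
  | None => Q - \sum_(l' < q) ucoord (lift ord0 l') * dirder (row (lift ord0 l') W) Q
  end.

(** On bounded sets small values of the polar equations force a small value of
    [Q]. *)
Lemma polar_decomp (x : 'rV[R]_k) : Q.@[x 0] = (polar ord0).@[x 0] +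
  \sum_(l < q) (x *m V) 0 (lift ord0 l) * (polar (lift ord0 l)).@[x 0].
Proof.
have -> : \sum_(l < q) (x *m V) 0 (lift ord0 l) * (polar (lift ord0 l)).@[x 0] =
    (\sum_(l < q) ucoord (lift ord0 l) * dirder (row (lift ord0 l) W) Q).@[x 0].
  rewrite raddf_sum /=; apply: eq_bigr => l _.
  by rewrite /polar liftK mevalM ucoordE.
by rewrite /polar unlift_none mevalB subrK.
Qed.

Lemma dle_polar d l : dle d Q -> dle d (polar l).
Proof.
move=> hQ; rewrite /polar; case: (unlift ord0 l) => [l'|].
  by apply: dle_le (dle_dirder _ hQ); rewrite leq_pred.
apply: dle_add => //; apply: dle_opp; apply: dle_sum => l'.
case: d hQ => [|d] hQ.
  have -> : dirder (row (lift ord0 l') W) Q = 0.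
    move: hQ => /msize1_polyC ->; exact: dirder_C.
  by rewrite mulr0 /dle msize0.
rewrite -add1n; apply: dle_mul; last exact: dle_dirder hQ.
by apply: dle_sum => i; apply: dle_scale; exact: dle_X.
Qed.

Variables (xs : seq 'rV[R]_k) (rho : R).
Hypotheses (Qge0 : forall x : 'rV[R]_k, 0 <= Q.@[x 0]) (rho0 : 0 < rho).
Hypothesis Qxs : forall x, x \in xs -> Q.@[x 0] = 0.
Hypothesis isol : forall x, x \in xs -> forall s : 'rV[R]_q.+1, s != 0 ->
  (forall i, `|s 0 i| <= rho) -> Q.@[(x + s *m W) 0] <> 0.

Definition Qc (c : 'rV[R]_q.+1) : {mpoly R[k]} :=
  Q - \sum_(l < q) c 0 (lift ord0 l) *: ucoord (lift ord0 l).

Lemma QcE c (x : 'rV[R]_k) : (Qc c).@[x 0] = Q.@[x 0] - \sum_(l < q) c 0 (lift ord0 l) * (x *m V) 0 (lift ord0 l).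
Proof.
rewrite mevalB; congr (_ - _); rewrite raddf_sum; apply: eq_bigr => l _ /=.
by rewrite mevalZ ucoordE.
Qed.

Lemma ucoord_shift x (s : 'rV[R]_q.+1) : (x + s *m W) *m V = x *m V + s.
Proof. by rewrite mulmxDl -mulmxA WV mulmx1. Qed.

(** The point of the fibre is the highest one, with respect to the first
    coordinate of [W], in the region [Qc c <= c 0 ord0] of the section; the
    first hypothesis keeps it away from the boundary of the cube. *)
Lemma polar_point (x : 'rV[R]_k) (c : 'rV[R]_q.+1) (r : R) : 0 < r -> (forall s : 'rV[R]_q.+1, (forall i, `|s 0 i| <= r) ->
    (exists i, `|s 0 i| = r) -> c 0 ord0 < (Qc c).@[(x + s *m W) 0]) ->
  (Qc c).@[x 0] <= c 0 ord0 ->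
  exists s : 'rV[R]_q.+1, (forall i, `|s 0 i| <= r) /\
    forall l, (polar l).@[(x + s *m W) 0] = c 0 l.
Proof.
move=> r0 hsph hx.
pose K := fun s : 'rV[R]_q.+1 => (forall i, `|s 0 i| <= r) /\ (Qc c).@[(x + s *m W) 0] <= c 0 ord0.
have [|||||| s [[hs Ks] smax]] := @definable_max R q.+1 K (fun s => s 0 ord0).
- by rewrite /K; sa.
- by rewrite /K; ct.
- by exists r => s [].
- exists 0; split=> [i|]; first by rewrite mxE normr0 ltW.
  by rewrite mul0mx addr0.
- by sa.
- by ct.
have cQ : cont (fun s : 'rV[R]_q.+1 => (Qc c).@[(x + s *m W) 0]) by ct.
have hs' i : `|s 0 i| < r.
  rewrite lt_neqAle hs andbT; apply/eqP => e.
  by have := hsph s hs (ex_intro _ i e); rewrite ltNge Ks.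
have [|i|e [e0 he]] := @unif_delta R 'I_q.+1 (fun i d => `|s 0 i| + d <= r).
- by move=> i d d' _ dd' H; apply: le_trans H; rewrite lerD2l.
- by exists (r - `|s 0 i|); rewrite subr_gt0 hs' subrKC.
have inK y : bx s y e -> forall i, `|y 0 i| <= r.
  move=> hy i; apply: le_trans (he i).
  have -> : y 0 i = s 0 i - (s 0 i - y 0 i) by ring.
  by apply: le_trans (ler_normB _ _) _; rewrite lerD2l ltW.
have nolow y : bx s y e -> y 0 ord0 = s 0 ord0 -> c 0 ord0 <= (Qc c).@[(x + y *m W) 0].
  move=> hy y0; rewrite leNgt; apply/negP => low.
  have [|d [d0 hd]] := cQ y (c 0 ord0 - (Qc c).@[(x + y *m W) 0]); first by rewrite subr_gt0.
  have [d' [d'0 hd']] := box_in_box hy.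
  pose t := Num.min d d' / 2.
  have m0 : 0 < Num.min d d' by rewrite lt_min d0.
  have t0 : 0 < t by rewrite /t; lra.
  have td : t < d.
    have : Num.min d d' <= d by rewrite ge_min lexx.
    by rewrite /t; lra.
  have td' : t < d'.
    have : Num.min d d' <= d' by rewrite ge_min lexx orbT.
    by rewrite /t; lra.
  pose y' := y + t *: delta_mx 0 ord0.
  have yy' u : t < u -> bx y y' u.
    move=> tu i; rewrite /y' !mxE opprD addNKr normrN normrM (gtr0_norm t0).
    apply: le_lt_trans tu; rewrite ler_piMr ?(ltW t0) //.
    by case: (_ && _); rewrite ?normr1 ?normr0 ?ler01.
  have := smax y'; rewrite {2}/y' mxE y0 !mxE !eqxx mulr1 => H.
  suff : s 0 ord0 + t <= s 0 ord0 by lra.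
  apply: H; split; first by apply/inK/hd'/yy'.
  by have := hd y' (yy' _ td); rewrite ltr_norml => /andP[]; lra.
have Qs : (Qc c).@[(x + s *m W) 0] = c 0 ord0.
  by apply/le_anti; rewrite Ks nolow //; exact: bx_refl.
have Ds l : (dirder (row (lift ord0 l) W) (Qc c)).@[(x + s *m W) 0] = 0.
  apply: (dirder_local_min (e := e)) => // t ht; rewrite Qs.
  have -> : x + s *m W + t *: row (lift ord0 l) W = x + (s + t *: delta_mx 0 (lift ord0 l)) *m W.
    by rewrite mulmxDl -scalemxAl -rowE addrA.
  apply: nolow; last by rewrite !mxE /= mulr0 addr0.
  move=> i; rewrite !mxE opprD addNKr normrN normrM.
  apply: le_lt_trans ht; rewrite ler_piMr //.
  by case: (_ && _); rewrite ?normr1 ?normr0 ?ler01.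
have Dl l : (dirder (row (lift ord0 l) W) Q).@[(x + s *m W) 0] = c 0 (lift ord0 l).
  have du l' : dirder (row (lift ord0 l) W) (ucoord (lift ord0 l')) = ((l == l')%:R)%:MP.
    rewrite /ucoord dirder_sum.
    under eq_bigr => i _ do rewrite dirder_scale dirder_X -mul_mpolyC -mpolyCM.
    rewrite -raddf_sum /=; congr (_%:MP).
    have := congr1 (fun M : 'M_q.+1 => M (lift ord0 l) (lift ord0 l')) WV.
    rewrite !mxE (inj_eq lift_inj) => <-; apply: eq_bigr => i _.
    by rewrite !mxE mulrC.
  have := Ds l; rewrite /Qc dirder_add dirder_opp mevalB dirder_sum.
  have -> : (\sum_(l' < q) dirder (row (lift ord0 l) W)
      (c 0 (lift ord0 l') *: ucoord (lift ord0 l'))).@[(x + s *m W) 0] = c 0 (lift ord0 l).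
    rewrite raddf_sum (bigD1 l) //= dirder_scale du eqxx mevalZ mevalC mulr1 big1 ?addr0 //.
    by move=> l' ll'; rewrite dirder_scale du eq_sym (negbTE ll') mevalZ mevalC mulr0.
  by move/eqP; rewrite subr_eq0 => /eqP.
exists s; split=> // l; rewrite /polar; case: unliftP => [l'|] ->; first exact: Dl.
rewrite -Qs QcE mevalB; congr (_ - _); rewrite raddf_sum; apply: eq_bigr => l' _ /=.
by rewrite mevalM ucoordE Dl mulrC.
Qed.

Lemma seq_bound (T : eqType) (s : seq T) (f : T -> R) : exists B, 0 < B /\ forall x, x \in s -> f x <= B.
Proof.
elim: s => [|x s [B [B0 hB]]]; first by exists 1.
exists (Num.max B (f x)); split=> [|y]; first by rewrite lt_max B0.
by rewrite inE le_max => /predU1P[->|/hB ->]; rewrite ?lexx ?orbT.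
Qed.

(** Isolated zeros make [Q] bounded below by a positive number on a small sphere
    around each point of [xs] in the section, and a small linear form cannot
    compensate this: [polar_point] applies to all [c] in a box whose first
    coordinate stays positive. *)
Lemma polar_fibers (r eta : R) : 0 < r -> 0 < eta -> exists c0 d, 0 < d /\
  forall c : 'rV[R]_q.+1, bx c0 c d -> (forall l, `|c 0 l| < eta) /\
    forall x, x \in xs -> exists y, bx x y r /\ forall l, (polar l).@[y 0] = c 0 l.
Proof.
move=> r0 eta0.
have [r1 [r10 r1r r1W]] : exists r1, [/\ 0 < r1, r1 <= rho &
    forall (s : 'rV[R]_q.+1) x, (forall i, `|s 0 i| <= r1) -> bx x (x + s *m W) r].
  have [c [c0 hc]] := @row_bound R _ (\row_i \sum_l `|W l i|) r r0.
  exists (Num.min rho c); split; first by rewrite lt_min rho0.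
    by rewrite ge_min lexx.
  move=> s x hs i; rewrite !mxE opprD addNKr normrN; apply: le_lt_trans (hc i).
  rewrite mxE normrM (gtr0_norm c0).
  apply: (@le_trans _ _ (c * \sum_l `|W l i|)); last by rewrite ler_pM2l // ler_norm.
  apply: (le_trans (ler_norm_sum _ _ _)); rewrite mulr_sumr; apply: ler_sum => l _.
  rewrite normrM ler_wpM2r //; apply: le_trans (hs l) _.
  by rewrite ge_min lexx orbT.
have [mu [mu0 hmu]] : exists mu, 0 < mu /\ forall x, x \in xs -> forall s : 'rV[R]_q.+1,
    (forall i, `|s 0 i| <= r1) -> (exists i, `|s 0 i| = r1) -> mu <= Q.@[(x + s *m W) 0].
  apply: unif_seq => [x d d' _ dd' H s h1 h2|x hx].
    by apply: le_trans dd' _; exact: H.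
  have [|i|mu [mu0 hmu]] := @unif_delta R 'I_q.+1 (fun i mu => forall s : 'rV[R]_q.+1,
      (forall i, `|s 0 i| <= r1) -> `|s 0 i| = r1 -> mu <= Q.@[(x + s *m W) 0]).
  - by move=> i d d' _ dd' H s h1 h2; apply: le_trans dd' _; exact: H.
  - pose K := fun s : 'rV[R]_q.+1 => (forall i, `|s 0 i| <= r1) /\ `|s 0 i| = r1.
    have [[s Ks]|nK] := pselect (exists s, K s); last first.
      by exists 1; split=> // s h1 h2; case: nK; exists s.
    have [||||||s0 [[hs0 hs0i] smin]] := @definable_min R q.+1 K (fun s => Q.@[(x + s *m W) 0]).
    + by rewrite /K; sa.
    + by rewrite /K; ct.
    + by exists r1 => s' [].
    + by exists s.
    + by sa.
    + by ct.
    exists (Q.@[(x + s0 *m W) 0]); split; last by move=> s' h1 h2; apply: smin.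
    rewrite lt_neqAle Qge0 andbT eq_sym; apply/eqP; apply: isol => //.
      by apply/eqP => s00; move: hs0i; rewrite s00 mxE normr0 => e; move: r10; rewrite -e ltxx.
    by move=> j; apply: le_trans (hs0 j) r1r.
  by exists mu; split=> // s h1 [i h2]; apply: hmu h2.
have [B [B0 hB]] := seq_bound xs (fun x => \sum_l `|(x *m V) 0 l|).
(* D bounds the linear forms with coefficients at most 1 in the sections near
   xs. *)
pose D := 1 + q%:R * (B + r1).
have D0 : 0 < D by rewrite /D ltr_wpDr // mulr_ge0 ?ler0n //; lra.
pose g := Num.min (eta / 2) (mu / 2).
have g0 : 0 < g by rewrite lt_min; apply/andP; split; lra.
have gmu : g <= mu / 2 by rewrite /g ge_min lexx orbT.
have geta : g <= eta / 2 by rewrite /g ge_min lexx.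
pose d := g / 4 / D.
have d0 : 0 < d by rewrite /d !divr_gt0.
have dD : d * D = g / 4 by rewrite /d divfK // gt_eqF.
have BR0 : 0 <= q%:R * (B + r1) by rewrite mulr_ge0 ?ler0n //; lra.
have dg : d <= g / 4.
  by rewrite -dD ler_peMr ?(ltW d0) // /D lerDl.
exists (\row_l (if l == ord0 then g else 0)), d; split=> // c hc.
have hc0 : `|g - c 0 ord0| < d by have := hc ord0; rewrite mxE eqxx.
have hcl l : `|c 0 (lift ord0 l)| < d.
  by have := hc (lift ord0 l); rewrite mxE /= sub0r normrN.
move: hc0; rewrite ltr_norml => /andP[hc1 hc2].
split=> [l|x hx].
  case: (unliftP ord0 l) => [l'|] ->; first by apply: lt_trans (hcl l') _; lra.
  by rewrite ltr_norml; apply/andP; split; lra.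
have hsum (s : 'rV[R]_q.+1) : (forall i, `|s 0 i| <= r1) ->
    `|\sum_(l < q) c 0 (lift ord0 l) * ((x + s *m W) *m V) 0 (lift ord0 l)| <= g / 4.
  move=> hs; rewrite -dD; apply: (le_trans (ler_norm_sum _ _ _)).
  apply: (@le_trans _ _ (\sum_(l < q) d * (B + r1))); last first.
    by rewrite sumr_const card_ord -mulr_natl mulrCA ler_wpM2l ?(ltW d0) // /D lerDr ler01.
  apply: ler_sum => l _; rewrite normrM; apply: ler_pM => //; first exact: ltW.
  rewrite ucoord_shift mxE; apply: (le_trans (ler_normD _ _)); apply: lerD; last exact: hs.
  by apply: (le_trans _ (hB x hx)); rewrite (bigD1 (lift ord0 l)) //= lerDl sumr_ge0.
have [||s [hs hfs]] := @polar_point x c r1 r10.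
- move=> s hs hsi; rewrite QcE; have := hmu x hx s hs hsi.
  by have := hsum s hs; rewrite ler_norml => /andP[]; lra.
- have h0 i : `|(0 : 'rV[R]_q.+1) 0 i| <= r1 by rewrite mxE normr0 ltW.
  have := hsum 0 h0; rewrite QcE mul0mx addr0 ler_norml Qxs // => /andP[]; lra.
by exists (x + s *m W); split=> //; apply: r1W.
Qed.

End PolarVariety.

(** * Separation of compact sets *)

Section CompactSeparation.
Variable R : rcfType.

Lemma cl_ex n (T : finType) (A : T -> set 'rV[R]_n) :
  (forall i, cl (A i)) -> cl (fun x => exists i, A i x).
Proof.
move=> hA x h; apply: contrapT => /forallNP nA.
have [|i|d [d0 hd]] := @unif_delta R T (fun i d => ~ exists y, A i y /\ bx x y d).
- by move=> i d d' _ dd' H [y [Ay hy]]; apply: H; exists y; split=> //; apply: bx_le hy.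
- have /existsNP[d /not_implyP[d0 hd]] : ~ forall e, 0 < e -> exists y, A i y /\ bx x y e.
    by move=> H; apply: (nA i); apply: hA.
  by exists d.
by have [y [[i Ay] hy]] := h d d0; apply: (hd i); exists y.
Qed.

Lemma thickening_cl n (K : set 'rV[R]_n) r : semialgebraic K -> cl K -> bdd K ->
  cl (fun x => exists y, K y /\ forall i, `|x 0 i - y 0 i| <= r).
Proof.
move=> hK cK [M bK] x h.
have [|||||y hy] := @definable_compactness R n (fun y t => K y /\ forall i, `|x 0 i - y 0 i| <= r + t).
- by sa.
- move=> t t0; have [x' [[y [Ky hy]] hx]] := h t t0.
  exists y; split=> // i; apply: le_trans (ler_distD (x' 0 i) _ _) _.
  by rewrite [r + t]addrC; apply: lerD; [exact: ltW (hx i)|exact: hy].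
- by move=> s t y _ st [Ky hy]; split=> // i; apply: le_trans (hy i) _; rewrite lerD2l.
- by exists M => t y _ [/bK].
- by move=> t _; ct.
exists y; have [Ky _] := hy 1 ltr01; split=> // i; rewrite leNgt; apply/negP => lt.
by have [|_ /(_ i)] := hy ((`|x 0 i - y 0 i| - r) / 2); lra.
Qed.

(** Otherwise pairs of points at distance at most [t] would have a limit on the
    diagonal. *)
Lemma compact_sep n (K L : set 'rV[R]_n) : semialgebraic K -> semialgebraic L ->
  cl K -> cl L -> bdd K -> bdd L -> (forall x, K x -> ~ L x) ->
  exists r, 0 < r /\ forall x y, K x -> L y -> ~ bx x y r.
Proof.
move=> hK hL cK cL [M bK] [M' bL] dis; apply: contrapT => /forallNP H.
have [|||||z hz] := @definable_compactness R (n + n) (fun z t =>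
   K (lsubmx z) /\ L (rsubmx z) /\ forall i, `|lsubmx z 0 i - rsubmx z 0 i| <= t).
- by sa.
- move=> t t0; have := H t => /not_andP[//|/existsNP[x /existsNP[y]]].
  move=> /not_implyP[Kx /not_implyP[Ly /contrapT hxy]].
  by exists (row_mx x y); rewrite row_mxKl row_mxKr; split=> //; split=> // i; apply/ltW.
- by move=> s t z _ st [Kz [Lz h]]; split=> //; split=> // i; apply: le_trans (h i) st.
- exists (Num.max M M') => t z _ [/bK h1 [/bL h2 _]] i; rewrite le_max.
  case: (fintype.splitP i) => j ij.
    have -> : z 0 i = lsubmx z 0 j by rewrite mxE; congr (z _ _); apply: val_inj.
    by rewrite h1.
  have -> : z 0 i = rsubmx z 0 j by rewrite mxE; congr (z _ _); apply: val_inj.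
  by rewrite h2 orbT.
- by move=> t _; ct.
have [Kz [Lz _]] := hz 1 ltr01.
have e : lsubmx z = rsubmx z.
  apply/rowP => i; apply/eqP; rewrite -subr_eq0 -normr_eq0 eq_le normr_ge0 andbT leNgt.
  apply/negP => h.
  by have [|_ [_ /(_ i)]] := hz (`|lsubmx z 0 i - rsubmx z 0 i| / 2); lra.
by apply: dis Kz _; rewrite e.
Qed.

End CompactSeparation.

(** * Critical points under active constraints *)

Section LagrangeSystem.
Variables (R : rcfType) (k q : nat) (I : finType).
Variables (f : 'I_q -> {mpoly R[k]}) (pol : I -> {mpoly R[k]}).
Variables (e0 : nat) (d : I -> nat) (e : {set I} -> nat).
Hypotheses (hf : forall l, dle e0 (f l)) (hpol : forall i, dle (d i) (pol i)).
Hypotheses (e1 : forall S, (0 < e S)%N) (ed : forall (S : {set I}) i, i \in S -> (d i <= e S)%N)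
  (ee0 : forall S, (0 < q)%N -> (e0 <= e S)%N).

Local Notation np := (#|{: I * 'I_4}|).
Local Notation param := 'rV[R]_((q + np) + k).
(** A parameter consists of the values of the [f l], of four thresholds for each
    [pol i] and of the centre of the distance function. *)
Definition cval (th : param) (l : 'I_q) : R := th 0 (lshift k (lshift np l)).
Definition thr (th : param) (i : I) (a : 'I_4) : R :=
  th 0 (lshift k (rshift q (enum_rank (i, a)))).
Definition ctr (th : param) (j : 'I_k) : R := th 0 (rshift (q + np) j).

(** The active polynomials, each with the threshold that it attains. *)
Definition activity := {ffun I -> option 'I_4}.
Definition act (psi : activity) : {set I} := [set i | psi i != None]%SET.
Local Notation m psi := (q + #|act psi|)%N.

Lemma enum_act (psi : activity) (a : 'I_#|act psi|) : enum_val a \in act psi.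
Proof. exact: enum_valP. Qed.

Definition side (psi : activity) (i : I) : 'I_4 := odflt ord0 (psi i).

Definition constr (psi : activity) (i : 'I_(m psi)) : {mpoly R[k]} :=
  match fintype.split i with inl l => f l | inr a => pol (enum_val a) end.

Arguments constr : clear implicits.

(** The coordinates of a parameter that occur as right-hand sides of the system. *)
Definition target (psi : activity) (t : 'I_(k + m psi)) : 'I_((q + np) + k) :=
  match fintype.split t with
  | inl j => rshift (q + np) j
  | inr i => match fintype.split i with
             | inl l => lshift k (lshift np l)
             | inr a => lshift k (rshift q (enum_rank (enum_val a, side psi (enum_val a))))
             end
  end.

(** The first [k] equations state that a combination of the gradients of the
    constraints joins the centre to the point; the others prescribe the values
    of the constraints. *)
Definition lagr (psi : activity) (t : 'I_(k + m psi)) (z : 'rV[R]_(k + m psi)) : R :=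
  match fintype.split t with
  | inl j => lsubmx z 0 j - \sum_i rsubmx z 0 i * ((constr psi i)^`M(j)).@[lsubmx z 0]
  | inr i => (constr psi i).@[lsubmx z 0]
  end.

Lemma target_inj psi : injective (@target psi).
Proof.
move=> t t'; rewrite /target.
case: (fintype.splitP t) => [j|i] ti; case: (fintype.splitP t') => [j'|i'] ti'.
- by move/rshift_inj => jj; apply: val_inj; rewrite /= ti ti' jj.
- by case: (fintype.split i') => ? /eqP; rewrite eq_rlshift.
- by case: (fintype.split i) => ? /eqP; rewrite eq_lrshift.
move=> H; suff ii : i = i' by apply: val_inj; rewrite /= ti ti' ii.
move: H; case: (fintype.splitP i) => [l|a] il; case: (fintype.splitP i') => [l'|a'] il'.
- by move/lshift_inj/lshift_inj => ll; apply: val_inj; rewrite /= il il' ll.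
- by move/lshift_inj/eqP; rewrite eq_lrshift.
- by move/lshift_inj/eqP; rewrite eq_rlshift.
move/lshift_inj/rshift_inj/enum_rank_inj => -[/enum_val_inj aa _].
by apply: val_inj; rewrite /= il il' aa.
Qed.

Definition ldeg (psi : activity) (i : 'I_(m psi)) : nat :=
  match fintype.split i with inl l => e0 | inr a => d (enum_val a) end.

Arguments ldeg : clear implicits.

Lemma dle_constr psi i : dle (ldeg psi i) (constr psi i).
Proof. by rewrite /ldeg /constr; case: (fintype.split i). Qed.

Lemma ldeg_le psi i : (ldeg psi i <= e (act psi))%N.
Proof.
rewrite /ldeg; case: (fintype.split i) => [l|a]; last by apply: ed; apply: enum_act.
by apply: ee0; apply: leq_ltn_trans (ltn_ord l).
Qed.

Lemma bd_lagr psi t : let st := @lagrange_type k (m psi) (ldeg psi) (e (act psi)) t in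
  bideg st.1 st.2 (@lagr psi t).
Proof.
rewrite /lagrange_type /lagr; case: (fintype.split t) => [j|i] /=; last first.
  by apply: bideg_dle; apply: dle_constr.
apply: bd_add.
  apply: bd_ext (bd_le (e1 _) (leq0n 1) (bd_x R (m psi) j)) => z; by rewrite mxE.
apply: bd_ext (bd_scale (-1) (bd_sum (f := fun i z => rsubmx z 0 i * ((constr psi i)^`M(j)).@[lsubmx z 0]) _ _ _)).
  by move=> z; rewrite mulN1r.
move=> i; have h := bd_mul (bd_l R k i) (bideg_dle (m psi) (dle_deriv j (dle_constr i))).
apply: (bd_ext (f := fun z => z 0 (rshift k i) * ((constr psi i)^`M(j)).@[lsubmx z 0])).
  by move=> z; rewrite mxE.
apply: bd_le h => //; rewrite add0n; apply: leq_trans (leq_pred _) (ldeg_le i).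
Qed.

(** The Bezout number of the Lagrange systems with active set [S]. *)
Definition lbound (S : {set I}) : nat :=
  ('C(k, q + #|S|) * e S ^ (k - (q + #|S|)) * (e0 ^ q * \prod_(i in S) d i))%N.

Lemma cnt_lbound psi : (cnt (@lagrange_type k (m psi) (ldeg psi) (e (act psi))) <= lbound (act psi))%N.
Proof.
apply: leq_trans (cnt_lagrange _ _ _) _; rewrite /lbound leq_mul2l; apply/orP; right.
apply: eq_leq; rewrite big_split_ord /=; congr (_ * _)%N.
  rewrite (eq_bigr (fun _ => e0)) => [|l _]; last first.
    by rewrite /ldeg (_ : fintype.split _ = inl l) //; exact: (unsplitK (inl l)).
  by rewrite prod_nat_const card_ord.
rewrite [RHS]big_enum_val /=; apply: eq_bigr => a _.
by rewrite /ldeg (_ : fintype.split _ = inr a) //; exact: (unsplitK (inr a)).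
Qed.

Lemma generic_pullback n N (pi : 'I_n -> 'I_N) (G : set 'rV[R]_n) : injective pi ->
  generic G -> generic (fun th : 'rV[R]_N => G (\row_t th 0 (pi t))).
Proof.
move=> inj hG x r r0; have [y [s [s0 hy]]] := hG (\row_t x 0 (pi t)) r r0.
pose y' : 'rV[R]_N := \row_i oapp (fun t => y 0 t) (x 0 i) [pick t | pi t == i].
have y'pi t : y' 0 (pi t) = y 0 t.
  rewrite mxE; case: pickP => [t' /eqP/inj -> //|/(_ t)].
  by rewrite eqxx.
exists y', (Num.min s r); split=> [|z hz]; first by rewrite lt_min s0.
have hz' : bx y (\row_t z 0 (pi t)) s.
  move=> t; rewrite mxE -y'pi; apply: lt_le_trans (hz _) _.
  by rewrite ge_min lexx.
have [h1 h2] := hy _ hz'; split=> // i.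
case: (pickP [pred t | pi t == i]) => [t /eqP <-|no].
  by have := h1 t; rewrite !mxE.
have -> : x 0 i = y' 0 i.
  by rewrite mxE; case: pickP => [t|_] //=; have /= := no t => ->.
by apply: lt_le_trans (hz i) _; rewrite ge_min lexx orbT.
Qed.

Definition rhs (psi : activity) (th : param) : 'rV[R]_(k + m psi) :=
  \row_t th 0 (target t).

Definition critical (psi : activity) (th : param) (z : 'rV[R]_(k + m psi)) : Prop :=
  forall t, @lagr psi t z = rhs psi th 0 t.

Definition regular_param (th : param) : Prop := forall psi,
  grid_fiber (@lagrange_type k (m psi) (ldeg psi) (e (act psi))) (@lagr psi) (rhs psi th).

Lemma generic_regular : generic regular_param.
Proof.
apply: generic_all => psi; apply: (generic_pullback (@target_inj psi)).
by apply: generic_fiber_bound => t; apply: bd_lagr.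
Qed.

(** Points in disjoint sets are distinct. Those with the same activity lie in
    one fibre of one Lagrange system, and there are at most [4 ^ #|S|]
    activities with active set [S]. *)
Lemma count_critical (J : finType) (N : J -> set 'rV[R]_k) th : regular_param th ->
  (forall i j x, N i x -> N j x -> i = j) ->
  (forall j, exists psi z, N j (lsubmx z) /\ @critical psi th z) ->
  (#|J| <= \sum_(S : {set I}) 4 ^ #|S| * lbound S)%N.
Proof.
move=> reg dis /choice[psi hpsi].
have -> : #|J| = (\sum_(p : activity) #|[pred j | psi j == p]|)%N.
  rewrite -sum1_card (partition_big psi xpredT) //=; apply: eq_bigr => p _.
  by rewrite sum1_card.
apply: (@leq_trans (\sum_(p : activity) lbound (act p))%N).
  apply: leq_sum => p _; apply: leq_trans (cnt_lbound p).
  have hz j : psi j = p -> exists z : 'rV[R]_(k + m p), N j (lsubmx z) /\ critical th z.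
    by move=> <-; exact: hpsi.
  pose zf j := xget 0 [set z : 'rV[R]_(k + m p) | N j (lsubmx z) /\ critical th z].
  have zfP j : psi j = p -> N j (lsubmx (zf j)) /\ critical th (zf j).
    by move=> h; exact: (xgetPex 0 (hz j h)).
  have mE j : j \in enum [pred j | psi j == p] -> psi j = p.
    by rewrite mem_enum => /eqP.
  rewrite [X in (X <= _)%N]cardE -(size_map zf); apply: reg.
    rewrite map_inj_in_uniq ?enum_uniq // => i j /mE/zfP[hi _] /mE/zfP[hj _] eij.
    by apply: dis hi _; rewrite eij.
  by move=> _ /mapP[j /mE/zfP[_ h] ->] t; exact: h.
rewrite (partition_big act xpredT) //=; apply: leq_sum => S _.
rewrite (eq_bigr (fun _ => lbound S)) => [|p /eqP -> //].
rewrite sum_nat_const leq_mul2r; apply/orP; right.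
have <- : #|pffun_on (None : option 'I_4) (mem S) (predC1 None)| = (4 ^ #|S|)%N.
  by rewrite card_pffun_on cardC1 card_option card_ord.
apply: subset_leq_card; apply/fintype.subsetP => p pS.
have {pS} <- : act p = S by apply/eqP.
apply/pffun_onP; split.
  by apply/supportP => i; rewrite inE negbK => /eqP.
by move=> y /fintype.imageP[i]; rewrite !inE => hi ->.
Qed.

Lemma split_lshift n p (i : 'I_n) : fintype.split (lshift p i) = inl i.
Proof. exact: (unsplitK (inl i)). Qed.

Lemma split_rshift n p (i : 'I_p) : fintype.split (rshift n i) = inr i.
Proof. exact: (unsplitK (inr i)). Qed.

Lemma constr_l psi l : @constr psi (lshift _ l) = f l.
Proof. by rewrite /constr split_lshift. Qed.

Lemma constr_r psi a : @constr psi (rshift q a) = pol (enum_val a).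
Proof. by rewrite /constr split_rshift. Qed.

Lemma rhs_ctr psi th j : rhs psi th 0 (lshift _ j) = ctr th j.
Proof. by rewrite mxE /target split_lshift. Qed.

Lemma rhs_cval psi th l : rhs psi th 0 (rshift k (lshift _ l)) = cval th l.
Proof. by rewrite mxE /target split_rshift split_lshift. Qed.

Lemma rhs_thr (psi : activity) th (a : 'I_#|act psi|) b : psi (enum_val a) = Some b ->
  rhs psi th 0 (rshift k (rshift q a)) = thr th (enum_val a) b.
Proof. by move=> ab; rewrite mxE /target !split_rshift /side ab. Qed.

(** Odd thresholds are lower bounds for the value [t], even ones upper bounds; a
    positive excess is a violation. *)
Definition excess (a : 'I_4) (t b : R) : R := if odd a then b - t else t - b.

Lemma mderiv_sqr (p : {mpoly R[k]}) c j (x : 'rV[R]_k) :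
  (((p - c%:MP) ^+ 2)^`M(j)).@[x 0] = 2 * (p.@[x 0] - c) * (p^`M(j)).@[x 0].
Proof.
rewrite expr2 -!dirder_delta dirder_mul dirder_add dirder_opp dirder_C oppr0 addr0.
by rewrite mevalD !mevalM mevalB mevalC; ring.
Qed.

Lemma mderiv_sqrs (T : finType) (p : T -> {mpoly R[k]}) c j (x : 'rV[R]_k) :
  ((\sum_t (p t - (c t)%:MP) ^+ 2)^`M(j)).@[x 0] =
  \sum_t 2 * ((p t).@[x 0] - c t) * ((p t)^`M(j)).@[x 0].
Proof.
rewrite -dirder_delta dirder_sum (raddf_sum (meval (x 0))); apply: eq_bigr => t _ /=.
by rewrite dirder_delta mderiv_sqr.
Qed.

(** Minimise the squared distance to the centre plus a large multiple of the
    squared violations. A minimiser violates the constraints only slightly, so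
    it is interior to [N] by the last hypothesis. Near it only the active
    constraints contribute, and replacing their violations by plain differences
    gives a polynomial with a local minimum there. The vanishing of its gradient
    is a Lagrange system for the parameter [th'] that records the values
    actually attained, and [th'] is close to [th]. *)
Lemma penalty_critical (th : param) (N : set 'rV[R]_k) (rel : I -> 'I_4 -> bool) (y : 'rV[R]_k) (eps : R) :
  semialgebraic N -> cl N -> bdd N -> 0 < eps -> N y ->
  (forall l, (f l).@[y 0] = cval th l) ->
  (forall i a, rel i a -> excess a (pol i).@[y 0] (thr th i a) <= 0) ->
  (forall i a a' t, rel i a -> rel i a' -> 0 <= excess a t (thr th i a) ->
     0 <= excess a' t (thr th i a') -> a = a') ->
  (forall x, N x -> \sum_j (x 0 j - ctr th j) ^+ 2 <= \sum_j (y 0 j - ctr th j) ^+ 2 ->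
     (forall l, `|(f l).@[x 0] - cval th l| < eps) ->
     (forall i a, rel i a -> excess a (pol i).@[x 0] (thr th i a) < eps) ->
     exists d, 0 < d /\ forall z, bx x z d -> N z) ->
  exists th', bx th th' eps /\ exists psi z, N (lsubmx z) /\ @critical psi th' z.
Proof.
move=> hN cN bN eps0 Ny fy py excl int.
pose dist (x : 'rV[R]_k) := \sum_j (x 0 j - ctr th j) ^+ 2.
pose viol (x : 'rV[R]_k) i a := if rel i a then Num.max 0 (excess a (pol i).@[x 0] (thr th i a)) else 0.
pose pen (x : 'rV[R]_k) := \sum_l ((f l).@[x 0] - cval th l) ^+ 2 + \sum_i \sum_a viol x i a ^+ 2.
(* M makes every violation at a minimiser smaller than eps. *)
pose M := (dist y + 1) / eps ^+ 2.
have dist0 x : 0 <= dist x by apply: sumr_ge0 => j _; exact: sqr_ge0.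
have M0 : 0 < M by rewrite divr_gt0 ?exprn_gt0 // ltr_wpDl.
have MO : M * eps ^+ 2 = dist y + 1 by rewrite divfK // gt_eqF ?exprn_gt0.
have viol_sa i a : safun (fun x => viol x i a).
  by rewrite /viol /excess; case: (rel i a); case: (odd a); sa.
have viol_ct i a : cont (fun x => viol x i a).
  by rewrite /viol /excess; case: (rel i a); case: (odd a); ct.
have [|||xm [Nx xmin]] := @definable_min R k N (fun x => dist x + M * pen x) hN cN bN.
- by exists y.
- by rewrite /dist /pen; sa; apply: viol_sa.
- by rewrite /dist /pen; ct; apply: viol_ct.
have peny : pen y = 0.
  rewrite /pen big1 => [|l _]; last by rewrite fy subrr expr0n.
  rewrite add0r; apply: big1 => i _; apply: big1 => a _; rewrite /viol; case: ifP => ra; last by rewrite expr0n.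
  by rewrite max_l ?expr0n // py.
have pens x : 0 <= \sum_l ((f l).@[x 0] - cval th l) ^+ 2 by apply: sumr_ge0 => l _; exact: sqr_ge0.
have penv x : 0 <= \sum_i \sum_a viol x i a ^+ 2.
  by do 2 (apply: sumr_ge0 => ? _); exact: sqr_ge0.
have dpx : dist xm + M * pen xm <= dist y.
  by have := xmin y Ny; rewrite peny mulr0 addr0.
have pen0 : 0 <= pen xm by apply: addr_ge0.
have small t : t ^+ 2 <= pen xm -> `|t| < eps.
  move=> ht; rewrite -(ltr_pXn2r (n := 2)) ?nnegrE ?(ltW eps0) // real_normK ?num_real //.
  rewrite -(ltr_pM2l M0) MO; apply: le_lt_trans (_ : dist y < _); last by lra.
  apply: le_trans dpx; apply: le_trans (_ : M * pen xm <= _); first by rewrite ler_pM2l.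
  by rewrite lerDr.
have fx l : `|(f l).@[xm 0] - cval th l| < eps.
  apply: small; apply: le_trans (_ : \sum_l ((f l).@[xm 0] - cval th l) ^+ 2 <= _); last by rewrite lerDl.
  by rewrite (bigD1 l) //= lerDl; apply: sumr_ge0 => l' _; exact: sqr_ge0.
have vx i a : `|viol xm i a| < eps.
  apply: small; apply: le_trans (_ : \sum_i \sum_a viol xm i a ^+ 2 <= _); last by rewrite lerDr.
  rewrite (bigD1 i) //= (bigD1 a) //= -addrA lerDl addr_ge0 //; apply: sumr_ge0 => ? _; rewrite ?sqr_ge0 //.
  by apply: sumr_ge0 => ? _; rewrite sqr_ge0.
have [r [r0 hr]] : exists r, 0 < r /\ forall z, bx xm z r -> N z.
  apply: int => // [|i a ra]; first by apply: le_trans dpx; rewrite lerDl mulr_ge0 // ltW.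
  have := vx i a; rewrite /viol ra; apply: le_lt_trans; apply: le_trans (ler_norm _).
  by rewrite le_max lexx orbT.
(* The thresholds that the minimiser reaches; excl makes them unique. *)
pose psi : activity := [ffun i => [pick a | rel i a && (0 <= excess a (pol i).@[xm 0] (thr th i a))]].

have psiS i a : psi i = Some a -> rel i a /\ 0 <= excess a (pol i).@[xm 0] (thr th i a).
  by rewrite ffunE; case: pickP => // a' /andP[r1 r2] [<-].
have off i a : rel i a -> psi i != Some a -> excess a (pol i).@[xm 0] (thr th i a) < 0.
  move=> ra; rewrite ffunE ltNge; case: pickP => [a' /andP[ra' h']|/(_ a)]; last by rewrite ra /= => ->.
  by apply: contraNN => h; apply/eqP; congr Some; apply: excl h' h.
pose v (t : 'I_(m psi)) := rhs psi th 0 (rshift k t).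
(* Near the minimiser G majorises the penalised distance, with equality there. *)
pose G : {mpoly R[k]} := \sum_j ('X_j - (ctr th j)%:MP) ^+ 2
  + M *: \sum_t (@constr psi t - (v t)%:MP) ^+ 2.
have act_some (a : 'I_#|act psi|) : exists b, psi (enum_val a) = Some b.
  by have := enum_act a; rewrite inE; case: (psi _) => // b _; exists b.
have GE (x : 'rV[R]_k) : G.@[x 0] = dist x + M * (\sum_l ((f l).@[x 0] - cval th l) ^+ 2
    + \sum_i oapp (fun a => ((pol i).@[x 0] - thr th i a) ^+ 2) 0 (psi i)).
  rewrite mevalD mevalZ !raddf_sum /=; congr (_ + _ * _).
    by apply: eq_bigr => j _; rewrite rmorphXn /= mevalB mevalXU mevalC.
  rewrite big_split_ord /=; congr (_ + _).
    by apply: eq_bigr => l _; rewrite rmorphXn /= mevalB mevalC constr_l /v rhs_cval.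
  rewrite [RHS](bigID (mem (act psi))) /= [X in _ = _ + X]big1 ?addr0 => [|i]; last first.
    by rewrite inE negbK => /eqP ->.
  rewrite [RHS]big_enum_val /=; apply: eq_bigr => a _.
  have [b ab] := act_some a.
  by rewrite rmorphXn /= mevalB mevalC constr_r /v (rhs_thr _ ab) ab.
have [r' [r'0 offr]] : exists r', 0 < r' /\ forall i a, rel i a -> psi i != Some a ->
    forall z, bx xm z r' -> excess a (pol i).@[z 0] (thr th i a) < 0.
  have [|[i a]|r' [r'0 H]] := @unif_delta R (I * 'I_4)%type (fun ia d => rel ia.1 ia.2 -> psi ia.1 != Some ia.2 ->
      forall z, bx xm z d -> excess ia.2 (pol ia.1).@[z 0] (thr th ia.1 ia.2) < 0).
  - by move=> ia d1 d2 _ d12 H ra oa z hz; apply: H => //; apply: bx_le hz.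
  - case: (boolP (rel i a && (psi i != Some a))) => [/andP[ra oa]|]; last first.
      by move=> H; exists 1; split=> //= ra oa; rewrite ra oa in H.
    have ce : cont (fun z : 'rV[R]_k => excess a (pol i).@[z 0] (thr th i a)).
      by rewrite /excess; case: (odd a); ct.
    have lt0 := off i a ra oa.
    have [|r1 [r10 hr1]] := ce xm (- excess a (pol i).@[xm 0] (thr th i a)); first by rewrite oppr_gt0.
    exists r1; split=> //= _ _ z hz; have := hr1 z hz; rewrite ltr_norml => /andP[]; lra.
  by exists r'; split=> // i a; exact: (H (i, a)).
have penG z : bx xm z r' -> pen z <= \sum_l ((f l).@[z 0] - cval th l) ^+ 2
    + \sum_i oapp (fun a => ((pol i).@[z 0] - thr th i a) ^+ 2) 0 (psi i).
  move=> hz; rewrite lerD2l; apply: ler_sum => i _.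
  have nul a : psi i != Some a -> viol z i a = 0.
    by move=> oa; rewrite /viol; case: ifP => // ra; rewrite max_l // ltW // offr.
  case ia : (psi i) => [a|] /=; last by rewrite big1 // => a _; rewrite nul ?ia // expr0n.
  rewrite (bigD1 a) //= big1 ?addr0 => [|a' aa']; last first.
    by rewrite nul ?expr0n // ia; apply: contraNneq aa' => -[->].
  have [ra _] := psiS _ _ ia; rewrite /viol ra /excess.
  case: (odd a); last first.
    by rewrite /Num.max /Order.max; case: ifP => // _; rewrite expr0n sqr_ge0.
  rewrite /Num.max /Order.max; case: ifP => _; last by rewrite expr0n sqr_ge0.
  by rewrite -sqrrN opprB.
have penGx : pen xm = \sum_l ((f l).@[xm 0] - cval th l) ^+ 2
    + \sum_i oapp (fun a => ((pol i).@[xm 0] - thr th i a) ^+ 2) 0 (psi i).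
  congr (_ + _); apply: eq_bigr => i _.
  have nul a : psi i != Some a -> viol xm i a = 0.
    by move=> oa; rewrite /viol; case: ifP => // ra; rewrite max_l // ltW // off.
  case ia : (psi i) => [a|] /=; last by rewrite big1 // => a _; rewrite nul ?ia // expr0n.
  rewrite (bigD1 a) //= big1 ?addr0 => [|a' aa']; last first.
    by rewrite nul ?expr0n // ia; apply: contraNneq aa' => -[->].
  have [ra ea] := psiS _ _ ia; rewrite /viol ra max_r // /excess.
  by case: (odd a) => //; rewrite -sqrrN opprB.
have grad := @mderiv_local_min R k G xm (Num.min r r').
have {}grad j : (G^`M(j)).@[xm 0] = 0.
  apply: grad => [|z hz]; first by rewrite lt_min r0.
  have hz1 : bx xm z r by apply: bx_le hz; rewrite ge_min lexx.
  have hz2 : bx xm z r' by apply: bx_le hz; rewrite ge_min lexx orbT.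
  rewrite !GE -penGx; apply: le_trans (xmin z (hr z hz1)) _.
  by rewrite lerD2l ler_pM2l // penG.
(* The multipliers read off from the gradient of G. *)
pose lam : 'rV[R]_(m psi) := \row_t - (M * ((@constr psi t).@[xm 0] - v t)).
have eqx j : xm 0 j - \sum_t lam 0 t * ((@constr psi t)^`M(j)).@[xm 0] = ctr th j.
  have := grad j; rewrite mderivD mderivZ mevalD mevalZ !mderiv_sqrs.
  rewrite (bigD1 j) //= big1 ?addr0 => [|j' jj']; last first.
    by rewrite -dirder_delta dirder_X mxE (negbTE jj') andbF mevalC mulr0.
  rewrite -dirder_delta dirder_X mxE !eqxx mevalC mulr1 mevalXU.
  rewrite (eq_bigr (fun t => 2 * (((@constr psi t).@[xm 0] - v t) * ((@constr psi t)^`M(j)).@[xm 0]))); last first.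
    by move=> t _; rewrite mulrA.
  rewrite -mulr_sumr => h.
  have -> : \sum_t lam 0 t * ((@constr psi t)^`M(j)).@[xm 0] =
      - (M * \sum_t ((@constr psi t).@[xm 0] - v t) * ((@constr psi t)^`M(j)).@[xm 0]).
    rewrite mulr_sumr -sumrN; apply: eq_bigr => t _; rewrite mxE; ring.
  move: h; set Sg := \sum_t _; lra.
(* The parameter whose entries are the values attained at the minimiser. *)
pose th' : param := row_mx (row_mx (\row_l (f l).@[xm 0])
  (\row_t (let: (i, a) := enum_val t in if psi i == Some a then (pol i).@[xm 0] else thr th i a)))
  (\row_j ctr th j).
have cv' l : cval th' l = (f l).@[xm 0] by rewrite /cval /th' !row_mxEl mxE.
have th'E i a : thr th' i a = if psi i == Some a then (pol i).@[xm 0] else thr th i a.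
  by rewrite /thr /th' row_mxEl row_mxEr mxE enum_rankK.
have ct' j : ctr th' j = ctr th j by rewrite /ctr /th' row_mxEr mxE.
exists th'; split.
  move=> t; rewrite -(splitK t); case: (fintype.split t) => [t1|j] /=; last first.
    by rewrite -/(ctr th j) -/(ctr th' j) ct' subrr normr0.
  rewrite -(splitK t1); case: (fintype.split t1) => [l|t2] /=.
    by rewrite -/(cval th l) -/(cval th' l) cv' distrC.
  rewrite -(enum_valK t2); case: (enum_val t2) => i a; rewrite -/(thr th i a) -/(thr th' i a).
  rewrite th'E; case: eqP => [ia|_]; last by rewrite subrr normr0.
  have [ra ea] := psiS _ _ ia; have := vx i a; rewrite /viol ra max_r // /excess.
  by case: (odd a) => //; rewrite distrC.
exists psi, (row_mx xm lam); rewrite row_mxKl; split=> // t.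
rewrite /lagr row_mxKl row_mxKr -(splitK t); case: (fintype.split t) => [j|t1] /=.
  by rewrite split_lshift rhs_ctr ct' eqx.
rewrite split_rshift -(splitK t1); case: (fintype.split t1) => [l|a] /=.
  by rewrite constr_l rhs_cval cv'.
by have [b ab] := act_some a; rewrite constr_r (rhs_thr _ ab) th'E ab eqxx.
Qed.

End LagrangeSystem.

(** * Disjoint neighbourhoods of the pieces *)

Section SeparatedNeighbourhoods.
Variables (R : rcfType) (k : nat) (I J : finType).
Variables (Q : {mpoly R[k]}) (pol : I -> {mpoly R[k]}) (sg : J -> I -> int) (C : J -> set 'rV[R]_k).

Definition realize (s : I -> int) : set 'rV[R]_k :=
  fun y => Q.@[y 0] = 0 /\ forall i, sgz (pol i).@[y 0] = s i.

Hypothesis Qge0 : forall y : 'rV[R]_k, 0 <= Q.@[y 0].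
Hypothesis sC : forall j, semialgebraic (C j).
Hypothesis CR : forall j y, C j y -> realize (sg j) y.
Hypothesis C0 : forall j, exists y, C j y.
Hypothesis Ccl : forall j y, realize (sg j) y ->
  (forall e, 0 < e -> exists z, C j z /\ bx y z e) -> C j y.
Hypothesis Cop : forall j y, C j y ->
  exists e, 0 < e /\ forall z, realize (sg j) z -> bx y z e -> C j z.
Hypothesis Cdis : forall i j y, C i y -> C j y -> i = j.

(** A bounded part of a realization on which nonzero polynomials keep a distance
    [dl] from zero, with the equations relaxed by [tau]. *)
Definition relaxed (dl M tau : R) j : set 'rV[R]_k :=
  fun y => Q.@[y 0] <= tau /\ (forall l, `|y 0 l| <= M) /\ forall i,
    (sg j i = 0 -> `|(pol i).@[y 0]| <= tau) /\ (sg j i = 1 -> dl <= (pol i).@[y 0])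
    /\ (sg j i = -1 -> (pol i).@[y 0] <= - dl).

Lemma sg_cases j i : [\/ sg j i = 0, sg j i = 1 | sg j i = -1].
Proof.
have [y /CR[_ /(_ i) <-]] := C0 j.
case: (ltrgt0P (pol i).@[y 0]) => h.
- by constructor 2; rewrite gtr0_sgz.
- by constructor 3; rewrite ltr0_sgz.
- by constructor 1; rewrite h sgz0.
Qed.

Lemma relaxed_sa dl M tau j : semialgebraic (relaxed dl M tau j).
Proof. by rewrite /relaxed; sa. Qed.

Lemma relaxed_cl dl M tau j : cl (relaxed dl M tau j).
Proof. by rewrite /relaxed; ct. Qed.

Lemma relaxed0 dl M j y : 0 < dl -> relaxed dl M 0 j y -> realize (sg j) y.
Proof.
move=> dl0 [h1 [_ h2]]; split; first by apply/le_anti; rewrite h1 Qge0.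
move=> i; have [a [b c]] := h2 i; case: (sg_cases j i) => s; rewrite s.
- by have := a s; rewrite normr_le0 => /eqP ->; rewrite sgz0.
- by rewrite gtr0_sgz //; apply: lt_le_trans dl0 (b s).
- by rewrite ltr0_sgz //; apply: le_lt_trans (c s) _; rewrite oppr_lt0.
Qed.

(** For [tau = 0] the relaxed sets meet the pieces in compact sets, which have
    disjoint closed thickenings. As [tau] decreases, the relaxed set inside a
    thickening shrinks to the piece, so by compactness it eventually lies well
    inside the thickening. *)
Lemma separated_neighbourhoods (dl M : R) : 0 < dl ->
  exists N : J -> set 'rV[R]_k, [/\ forall j, semialgebraic (N j) /\ cl (N j) /\ bdd (N j),
    forall i j y, N i y -> N j y -> i = j,
    exists r, 0 < r /\ forall j z y, C j z -> relaxed dl M 0 j z -> bx z y r -> N j y &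
    exists tau, 0 < tau /\ forall j y, N j y -> relaxed dl M tau j y ->
      exists d, 0 < d /\ forall z, bx y z d -> N j z].
Proof.
move=> dl0.
pose K j := fun y => C j y /\ relaxed dl M 0 j y.
pose L j := fun y => ~ C j y /\ relaxed dl M 0 j y.
have hr := relaxed_sa dl M.
have hcl tau j : cl (relaxed dl M tau j) by exact: relaxed_cl.
have sK j : semialgebraic (K j) by apply: sa_and.
have sL j : semialgebraic (L j) by apply: sa_and => //; apply: sa_not.
have cK j : cl (K j).
  move=> y h; have ry : relaxed dl M 0 j y.
    by apply: hcl => e /h[z [[_ ?] ?]]; exists z.
  split=> //; apply: Ccl; first exact: relaxed0 ry.
  by move=> e /h[z [[? _] ?]]; exists z.
have cL j : cl (L j).
  move=> y h; have ry : relaxed dl M 0 j y.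
    by apply: hcl => e /h[z [[_ ?] ?]]; exists z.
  split=> // Cy; have [e [e0 he]] := Cop Cy.
  by have [z [[nC rz] yz]] := h e e0; apply/nC/he => //; apply: relaxed0 rz.
have bR tau j : bdd (relaxed dl M tau j) by exists M => y [_ [h _]].
have bK j : bdd (K j) by apply: bdd_sub (bR 0 j) => y [].
have bL j : bdd (L j) by apply: bdd_sub (bR 0 j) => y [].
(* One distance separates each compact part from the others and from the rest
   of its own realization. *)
have [||r [r0 hsep]] := @unif_delta R (J * J)%type (fun p r =>
    (p.1 != p.2 -> forall x y, K p.1 x -> K p.2 y -> ~ bx x y r) /\
    (forall x y, K p.1 x -> L p.1 y -> ~ bx x y r)).
- move=> p d d' _ dd' [h1 h2]; split=> [ne|] x y Kx Ky xy.
    by apply: h1 Kx Ky _ => //; apply: bx_le xy.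
  by apply: h2 Kx Ky _; apply: bx_le xy.
- move=> [i j] /=.
  have [r2 [r20 h2]] : exists r, 0 < r /\ forall x y, K i x -> L i y -> ~ bx x y r.
    by apply: compact_sep => // x [Cx _] [].
  case: (eqVneq i j) => [_|ij]; first by exists r2.
  have [r1 [r10 h1]] : exists r, 0 < r /\ forall x y, K i x -> K j y -> ~ bx x y r.
    by apply: compact_sep => // x [Ci _] [Cj _]; move: ij; rewrite (Cdis Ci Cj) eqxx.
  exists (Num.min r1 r2); split; first by rewrite lt_min r10.
  split=> [_|] x y Kx Ky xy; [apply: h1 Kx Ky _|apply: h2 Kx Ky _];
    by apply: bx_le xy; rewrite ge_min lexx ?orbT.
have sepK i j x y : i != j -> K i x -> K j y -> ~ bx x y r.
  by move=> ij; have [h _] := hsep (i, j); exact: h.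
have sepL i x y : K i x -> L i y -> ~ bx x y r.
  by have [_ h] := hsep (i, i); exact: h.
pose N j := fun x : 'rV[R]_k => exists y, K j y /\ forall i, `|x 0 i - y 0 i| <= r / 3.
exists N; split.
- move=> j; split; first by rewrite /N; have h := sK j; sa.
  split; first exact: thickening_cl.
  have [B hB] := bK j; exists (B + r / 3) => x [y [Ky xy]] i.
  have -> : x 0 i = y 0 i + (x 0 i - y 0 i) by ring.
  apply: le_trans (ler_normD _ _) _; apply: lerD (xy i); exact: hB.
- move=> i j x [y [Ky xy]] [z [Kz xz]]; apply/eqP/negP => /negP ij.
  apply: (sepK i j y z ij Ky Kz) => l.
  have -> : y 0 l - z 0 l = (x 0 l - z 0 l) - (x 0 l - y 0 l) by ring.
  apply: le_lt_trans (ler_normB _ _) _; have := xy l; have := xz l; lra.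
- exists (r / 3); split; first by lra.
  move=> j z y Cz rz zy; exists z; split=> // i; rewrite distrC; exact: ltW.
have [|j|tau [tau0 htau]] := @unif_delta R J (fun j tau => forall y, N j y -> relaxed dl M tau j y ->
  exists z, K j z /\ bx z y (r / 6)).
- move=> j d d' _ dd' h y Ny [h1 [h2 h3]]; apply: h => //; split; first exact: le_trans h1 dd'.
  split=> // i; have [a [b c]] := h3 i; split=> // s; apply: le_trans (a s) dd'.
- apply: contrapT => /forallNP H.
  have sN : semialgebraic (N j) by rewrite /N; have h := sK j; sa.
  have cN : cl (N j) by exact: thickening_cl.
  have [|||||y hy] := @definable_compactness R k (fun y t => N j y /\ relaxed dl M t j y /\
      forall z, K j z -> exists i, r / 6 <= `|z 0 i - y 0 i|).
  + by have h := sK j; rewrite /relaxed; sa.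
  + move=> t t0; have := H t => /not_andP[//|/existsNP[y /not_implyP[Ny /not_implyP[ry far]]]].
    exists y; split=> //; split=> // z Kz; apply: contrapT => /forallNP h.
    by apply: far; exists z; split=> // i; rewrite ltNge; apply/negP/h.
  + move=> s t y _ st [Ny [[h1 [h2 h3]] far]]; split=> //; split=> //.
    split; first exact: le_trans h1 st.
    by split=> // i; have [a [b c]] := h3 i; split=> // s0; apply: le_trans (a s0) st.
  + by exists M => t y _ [_ [[_ [h _]] _]].
  + move=> t t0; apply: cl_and => //; apply: cl_and; first exact: hcl.
    apply: cl_all => z; apply: cl_imp; apply: cl_ex => i; ct.
  have ry : relaxed dl M 0 j y.
    split; first by rewrite leNgt; apply/negP => lt; have [|_ [[h _] _]] := hy (Q.@[y 0] / 2); lra.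
    split=> [i|i]; first by have [_ [[_ [h _]] _]] := hy 1 ltr01.
    have [_ [[_ [_ /(_ i)[_ h]]] _]] := hy 1 ltr01; split=> // s.
    rewrite leNgt; apply/negP => lt.
    by have [|_ [[_ [_ /(_ i)[/(_ s) h' _]]] _]] := hy (`|(pol i).@[y 0]| / 2); lra.
  have [[z [Kz yz]] [_ far]] := hy 1 ltr01.
  have [Cy|nCy] := pselect (C j y).
    by have [i] := far y (conj Cy ry); rewrite subrr normr0; lra.
  apply: (sepL j z y Kz (conj nCy ry)) => i; rewrite distrC; have := yz i; lra.
exists tau; split=> // j y Ny ry; have [z [Kz zy]] := htau j y Ny ry.
exists (r / 6); split=> [|w yw]; first by lra.
exists z; split=> // i; rewrite distrC.
have -> : z 0 i - w 0 i = (z 0 i - y 0 i) + (y 0 i - w 0 i) by ring.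
apply: le_trans (ler_normD _ _) _; have := zy i; have := yw i; lra.
Qed.

End SeparatedNeighbourhoods.

(** * Counting pieces of realizations *)

Section Nonvanishing.
Variable R : rcfType.

Lemma generic_meval n (p : {mpoly R[n]}) (v : 'rV[R]_n) : p.@[v 0] != 0 ->
  generic (fun y : 'rV[R]_n => p.@[y 0] != 0).
Proof.
move=> pv; apply: generic_neq0 => [|x e e0]; first by ct.
have [c [c0 hc]] := row_bound (\row_i `|v 0 i - x 0 i|) e0.
have [|s [s0 sc hs]] := @poly_nonroot_small R (linepoly p x (v - x)) c _ c0.
  by apply: contraNneq pv => g0; rewrite -[v](subrKC x) -[v - x]scale1r -horner_linepoly g0 horner0.
exists (x + s *: (v - x)); split; last by rewrite -horner_linepoly.
move=> i; have := hc i; rewrite !mxE opprD addNKr normrN !normrM normr_id; apply: le_lt_trans.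
by rewrite ler_wpM2r // !gtr0_norm // ltW.
Qed.

Lemma punctured_nonroot (g : {poly R}) : g != 0 ->
  exists r, 0 < r /\ forall s, s != 0 -> `|s| <= r -> g.[s] != 0.
Proof.
move=> g0; have [m [h]] := multiplicity_XsubC g 0; rewrite g0 subr0 /= => h0 ->.
have [|r r0 hr] := @poly_cont R 0 h `|h.[0]|; first by rewrite normr_gt0.
exists (r / 2); split=> [|s s0 hs]; first by lra.
rewrite hornerM horner_exp hornerX mulf_neq0 ?expf_neq0 //.
by apply: contraTneq (hr s _) => [->|]; [rewrite sub0r normrN ltxx|rewrite subr0; lra].
Qed.

End Nonvanishing.

Ltac few_lra := repeat match goal with H : is_true _ |- _ => clear H end; intros; lra.

Section CountPieces.
Variables (R : rcfType) (k : nat) (I J : finType).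
Variables (Q : {mpoly R[k]}) (pol : I -> {mpoly R[k]}) (sg : J -> I -> int) (C : J -> set 'rV[R]_k).
Hypothesis Qge0 : forall y : 'rV[R]_k, 0 <= Q.@[y 0].
Hypothesis sC : forall j, semialgebraic (C j).
Hypothesis CR : forall j y, C j y -> realize Q pol (sg j) y.
Hypothesis Ccl : forall j y, realize Q pol (sg j) y ->
  (forall e, 0 < e -> exists z, C j z /\ bx y z e) -> C j y.
Hypothesis Cop : forall j y, C j y ->
  exists e, 0 < e /\ forall z, realize Q pol (sg j) z -> bx y z e -> C j z.
Hypothesis Cdis : forall i j y, C i y -> C j y -> i = j.

Variables (d : I -> nat) (e : {set I} -> nat) (x : J -> 'rV[R]_k).
Hypotheses (hpol : forall i, dle (d i) (pol i)) (e1 : forall S, (0 < e S)%N)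
  (ed : forall (S : {set I}) i, i \in S -> (d i <= e S)%N).
Hypothesis Cx : forall j, C j (x j).

Section PieceCount.
Variables (q : nat) (f : 'I_q -> {mpoly R[k]}).
Hypothesis fQ : forall M kappa : R, 0 < kappa -> exists eta, 0 < eta /\ forall y : 'rV[R]_k,
  (forall i, `|y 0 i| <= M) -> (forall l, `|(f l).@[y 0]| < eta) -> Q.@[y 0] <= kappa.
Hypothesis fibers : forall r eta : R, 0 < r -> 0 < eta -> exists c0 d, 0 < d /\
  forall c : 'rV[R]_q, bx c0 c d -> (forall l, `|c 0 l| < eta) /\
    forall j, exists y, bx (x j) y r /\ forall l, (f l).@[y 0] = c 0 l.

(** Thresholds are numbered in increasing order: 1 and 2 enclose the value zero,
    0 and 3 keep a negative or positive value away from zero. *)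
Definition active_for (s : int) (a : 'I_4) : bool :=
  [|| (s == 0) && ((a == 1 :> nat) || (a == 2 :> nat))%N, (s == 1) && (a == 3 :> nat)%N | (s == -1) && (a == 0 :> nat)%N].

Lemma active_forP s a : active_for s a ->
  [\/ s = 0 /\ a = 1%N :> nat, s = 0 /\ a = 2%N :> nat, s = 1 /\ a = 3%N :> nat | s = -1 /\ a = 0%N :> nat].
Proof.
rewrite /active_for => /or3P[/andP[/eqP -> /orP[]]|/andP[/eqP ->]|/andP[/eqP ->]] /eqP ->.
- by constructor 1.
- by constructor 2.
- by constructor 3.
- by constructor 4.
Qed.

Lemma finite_bound (T : finType) (g : T -> R) : exists B, 0 < B /\ forall t, g t <= B.
Proof.
have [B [B0 h]] := seq_bound (enum T) g.
by exists B; split=> // t; apply: h; rewrite mem_enum.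
Qed.

Notation param := 'rV[R]_((q + #|{: I * 'I_4}|) + k).


(** For every parameter in a box, the fibre of [f] contains a point close to
    [x j] that respects all thresholds, so [penalty_critical] produces critical
    points near the piece for parameters arbitrarily close to the given one.
    Dense semi-algebraic sets are generic. *)
Lemma params_for_pieces : exists (N : J -> set 'rV[R]_k) (th0 : param) rho, [/\ 0 < rho,
    forall i j y, N i y -> N j y -> i = j &
    forall j, generic (fun th : param => bx th0 th rho ->
      exists psi z, N j (lsubmx z) /\ @critical R k q I f pol psi th z)].
Proof.
have [dl [dl0 hdl]] : exists dl, 0 < dl /\ forall j i, (pol i).@[x j 0] != 0 -> 2 * dl < `|(pol i).@[x j 0]|.
  have [|[j i]|dl [dl0 h]] := @unif_delta R (J * I)%type (fun p dl =>
    (pol p.2).@[x p.1 0] != 0 -> 2 * dl < `|(pol p.2).@[x p.1 0]|).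
  - by move=> p b b' _ bb' h /h; lra.
  - case: (eqVneq (pol i).@[x j 0] 0) => [->|ne]; first by exists 1; split=> //=; rewrite eqxx.
    by have := ne; rewrite -normr_gt0 => H; exists (`|(pol i).@[x j 0]| / 4); split=> [|_] /=; lra.
  by exists dl; split=> // j i; exact: (h (j, i)).
have [M0 [M00 hM0]] : exists M, 0 < M /\ forall j i, `|x j 0 i| <= M.
  have [M [M0 h]] := @finite_bound (J * 'I_k)%type (fun p => `|x p.1 0 p.2|).
  by exists M; split=> // j i; exact: (h (j, i)).
(* Points that are at most as far from the centre as a point near some x j have
   coordinates bounded by M. *)
pose M := k.+1%:R * (M0 + 2) + 1.
have k1 : 1 <= k.+1%:R :> R by rewrite ler1n.
have M0M : M0 <= M.
  have : M0 + 2 <= k.+1%:R * (M0 + 2) by rewrite ler_peMl //; lra.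
  by rewrite /M; lra.
have C0 j : exists y, C j y by exists (x j).
have [N [hN Ndis [r [r0 hr]] [tau [tau0 htau]]]] :=
  separated_neighbourhoods Qge0 sC CR C0 Ccl Cop Cdis M dl0.
have [eta [eta0 heta]] := fQ M tau0.
have [r1 [r10 hr1]] : exists r1, 0 < r1 /\ forall j i y, bx (x j) y r1 ->
    `|(pol i).@[x j 0] - (pol i).@[y 0]| < Num.min (dl / 4) (tau / 4).
  have m0 : 0 < Num.min (dl / 4) (tau / 4) by rewrite lt_min; apply/andP; split; lra.
  have [|[j i]|r1 [r10 h]] := @unif_delta R (J * I)%type (fun p r1 => forall y, bx (x p.1) y r1 ->
    `|(pol p.2).@[x p.1 0] - (pol p.2).@[y 0]| < Num.min (dl / 4) (tau / 4)).
  - by move=> p b b' _ bb' h y hy; apply: h; apply: bx_le hy.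
  - exact: (cont_meval (pol i) (@contV_id R k) (x j) m0).
  by exists r1; split=> // j i; exact: (h (j, i)).
pose r2 := Num.min r1 (Num.min r 1).
have r20 : 0 < r2 by rewrite !lt_min r10 r0 ltr01.
have eta20 : 0 < eta / 2 by lra.
have [c0 [d' [d0 hfib]]] := fibers r20 eta20.
(* Two thresholds of order tau around zero, and two of order dl. *)
pose base (a : nat) : R := nth 0 [:: - (3 / 2 * dl); - (tau / 2); tau / 2; 3 / 2 * dl] a.
pose th0 : param := row_mx (row_mx c0 (\row_(t < #|{: I * 'I_4}|) base (enum_val t).2)) 0.
pose rho := Num.min d' (Num.min (dl / 4) (Num.min (tau / 4) 1)).
have rho0 : 0 < rho.
  by rewrite !lt_min d0 ltr01 /=; apply/and3P; split=> //; lra.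
have rhod : rho <= d' by rewrite ge_min lexx.
have rhodl : rho <= dl / 4 by rewrite !ge_min lexx !orbT.
have rhotau : rho <= tau / 4 by rewrite !ge_min lexx !orbT.
have rho1 : rho <= 1 by rewrite !ge_min lexx !orbT.
exists N, th0, rho; split=> // j; apply: dense_generic.
- by rewrite /bx; sa.
- have [hNj _] := hN j; apply: sa_ex => psi; apply: sa_exV; apply: sa_and; first by sa.
  apply: sa_all => t; rewrite /lagr; apply: sa_eq; last by rewrite /rhs; sa.
  case: (fintype.split t) => [l|i]; sa.
move=> th er e00 inU.
have thU : bx th0 th rho by apply: inU; exact: bx_refl.
have hc : bx c0 (\row_l cval th l) d'.
  move=> l; have := thU (lshift k (lshift _ l)); rewrite !row_mxEl [in X in _ -> X]mxE => h.
  exact: lt_le_trans h rhod.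
have hb i (a : 'I_4) : `|base a - thr th i a| < rho.
  by have := thU (lshift k (rshift q (enum_rank (i, a)))); rewrite row_mxEl row_mxEr mxE enum_rankK.
have hz l : `|ctr th l| < rho.
  by have := thU (rshift _ l); rewrite row_mxEr mxE sub0r normrN.
have [ceta /(_ j)[y [xy fy]]] := hfib _ hc.
pose eps := Num.min er (Num.min (eta / 2) (Num.min (tau / 4) (dl / 4))).
have eps0 : 0 < eps by rewrite !lt_min e00 eta20 /=; apply/andP; split; move: tau0 dl0; few_lra.
have epse : eps <= er by rewrite ge_min lexx.
have epseta : eps <= eta / 2 by rewrite !ge_min lexx !orbT.
have epstau : eps <= tau / 4 by rewrite !ge_min lexx !orbT.
have epsdl : eps <= dl / 4 by rewrite !ge_min lexx !orbT.
have [sNj [cNj bNj]] := hN j.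
have xr : bx (x j) y r by apply: bx_le xy; rewrite !ge_min lexx !orbT.
have xy1 : bx (x j) y 1 by apply: bx_le xy; rewrite !ge_min lexx !orbT.
have [Qx sx] := CR (Cx j).
have relx : relaxed Q pol sg dl M 0 j (x j).
  split; first by rewrite Qx.
  split=> [l|i]; first exact: le_trans (hM0 j l) M0M.
  have := sx i; have := hdl j i; case: (ltrgt0P (pol i).@[x j 0]) => h.
  - by rewrite gtr0_sgz // => /(_ isT) H <-; do !split=> //; move: H dl0; few_lra.
  - by rewrite ltr0_sgz // => /(_ isT) H <-; do !split=> //; move: H dl0; few_lra.
  - by rewrite h sgz0 => _ <-; do !split=> //; rewrite normr0.
have pxy i : `|(pol i).@[x j 0] - (pol i).@[y 0]| < dl / 4 /\ `|(pol i).@[x j 0] - (pol i).@[y 0]| < tau / 4.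
  have xy' : bx (x j) y r1 by apply: bx_le xy; rewrite ge_min lexx.
  by have := hr1 j i y xy'; rewrite lt_min => /andP.
have [||i a ra|i a a' t|xm Nx dx fx ex|th' [hth' H]] := @penalty_critical R k q I f pol th (N j)
   (fun i a => active_for (sg j i) a) y eps sNj cNj bNj eps0.
- exact: hr (Cx j) relx xr.
- by move=> l; rewrite fy mxE.
- have [h1 h2] := pxy i; move: h1 h2; rewrite !ltr_norml => /andP[h1 h2] /andP[h3 h4].
  have := hb i a; rewrite ltr_norml => /andP[h5 h6].
  have [_ [_ /(_ i)[rz [rp rn]]]] := relx.
  case: (active_forP ra) => -[s av]; rewrite /excess; move: h5 h6; rewrite /base av /= => h5 h6.
  + have := rz s; rewrite normr_le0 => /eqP z; rewrite z in h1 h2 h3 h4; move: h1 h2 h3 h4 h5 h6 rhotau tau0; few_lra.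
  + have := rz s; rewrite normr_le0 => /eqP z; rewrite z in h1 h2 h3 h4; move: h1 h2 h3 h4 h5 h6 rhotau tau0; few_lra.
  + by have := hdl j i; rewrite -sgz_eq0 sx s => /(_ isT); rewrite gtr0_norm; [move: h1 h2 h3 h4 h5 h6 rhodl; few_lra|rewrite -sgz_gt0 sx s].
  + by have := hdl j i; rewrite -sgz_eq0 sx s => /(_ isT); rewrite ltr0_norm; [move: h1 h2 h3 h4 h5 h6 rhodl; few_lra|rewrite -sgz_lt0 sx s].
- move=> ra ra'; have := hb i a; have := hb i a'; rewrite !ltr_norml => /andP[h1 h2] /andP[h3 h4].
  rewrite /excess; move: h1 h2 h3 h4.
  case: (active_forP ra) => -[s av]; case: (active_forP ra') => -[s' av'];
    rewrite /base ?av ?av' /= => h1 h2 h3 h4 h5 h6;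
    try (by apply: val_inj; rewrite /= av av'); try (by rewrite s in s'); exfalso; move: h1 h2 h3 h4 h5 h6 tau0 rhotau; few_lra.
- apply: htau => //.
  have xM l : `|xm 0 l| <= M.
    have B0 : 0 <= k.+1%:R * (M0 + 2) by rewrite mulr_ge0 // ?ler0n //; move: M00; few_lra.
    have hyl i : (y 0 i - ctr th i) ^+ 2 <= (M0 + 2) ^+ 2.
      rewrite -[X in X <= _]real_normK ?num_real // ler_pXn2r ?nnegrE //; last by move: M00; few_lra.
      have -> : y 0 i - ctr th i = x j 0 i - (x j 0 i - y 0 i) - ctr th i by ring.
      apply: le_trans (ler_normB _ _) _; have := hz i.
      have := ler_normB (x j 0 i) (x j 0 i - y 0 i).
      have := hM0 j i; have := xy1 i; move: rho1; few_lra.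
    have : (xm 0 l - ctr th l) ^+ 2 <= (k.+1%:R * (M0 + 2)) ^+ 2.
      apply: (@le_trans _ _ (\sum_i (xm 0 i - ctr th i) ^+ 2)).
        by rewrite (bigD1 l) //= lerDl; apply: sumr_ge0 => i _; exact: sqr_ge0.
      apply: le_trans dx _; apply: (@le_trans _ _ (\sum_(i < k) (M0 + 2) ^+ 2)); first exact: ler_sum.
      rewrite sumr_const card_ord -[X in X <= _]mulr_natl exprMn ler_wpM2r ?sqr_ge0 //.
      by rewrite -natrX ler_nat; apply: leq_trans (leqnSn k) _; rewrite leq_pmulr.
    rewrite -[X in X <= _]real_normK ?num_real // ler_pXn2r ?nnegrE // => h.
    have -> : xm 0 l = (xm 0 l - ctr th l) + ctr th l by ring.
    apply: le_trans (ler_normD _ _) _; have := hz l; rewrite /M; move: h rho1; few_lra.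
  split.
    apply: heta => // l; have := fx l; have := ceta l; rewrite mxE !ltr_norml => /andP[h1 h2] /andP[h3 h4].
    by apply/andP; split; move: h1 h2 h3 h4 epseta; few_lra.
  split=> // i; have hbi a : active_for (sg j i) a -> excess a (pol i).@[xm 0] (base a) < rho + eps.
    move=> ra; have := ex i a ra; have := hb i a; rewrite /excess ltr_norml => /andP[h1 h2].
    by case: (odd a); move: h1 h2; few_lra.
  split=> [s|]; last split=> s.
  + have := hbi (Ordinal (isT : 1 < 4)%N); have := hbi (Ordinal (isT : 2 < 4)%N).
    rewrite s => /(_ isT) h1 /(_ isT); move: h1; rewrite /excess /base /= => h1 h2.
    by rewrite ler_norml; apply/andP; split; move: h1 h2 rhotau epstau; few_lra.
  + have := hbi (Ordinal (isT : 3 < 4)%N).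
    by rewrite s => /(_ isT); rewrite /excess /base /=; move: rhodl epsdl; few_lra.
  + have := hbi (Ordinal (isT : 0 < 4)%N).
    by rewrite s => /(_ isT); rewrite /excess /base /=; move: rhodl epsdl; few_lra.
by exists th'; split=> //; apply: bx_le hth'.
Qed.

Variable e0 : nat.
Hypotheses (hf : forall l, dle e0 (f l)) (ee0 : forall S, (0 < q)%N -> (e0 <= e S)%N).

(** Some parameter is regular and generic for all pieces at once. *)
Lemma count_pieces : (#|J| <= \sum_(S : {set I}) 4 ^ #|S| * lbound k q e0 d e S)%N.
Proof.
have [N [th0 [rho [rho0 Ndis gen]]]] := params_for_pieces.
have greg := generic_regular hf hpol e1 ed ee0.
have [th [hth [reg pieces]]] : exists th : param, bx th0 th rho /\ regular_param f pol e0 d e th /\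
    forall j, bx th0 th rho -> exists psi z, N j (lsubmx z) /\ @critical R k q I f pol psi th z.
  have [|y [r [r0 hy]]] := @generic_all R _ bool (fun b th => if b then regular_param f pol e0 d e th
    else forall j, bx th0 th rho -> exists psi z, N j (lsubmx z) /\ @critical R k q I f pol psi th z) _ th0 rho rho0.
    by case=> //; exact: generic_all gen.
  have [h1 h2] := hy y (bx_refl _ r0); exists y; split=> //.
  by split; [exact: (h2 true)|exact: (h2 false)].
by apply: (count_critical reg Ndis) => j; exact: pieces.
Qed.

End PieceCount.

Lemma count_full e0 : (forall y : 'rV[R]_k, Q.@[y 0] = 0) ->
  (#|J| <= \sum_(S : {set I}) 4 ^ #|S| * lbound k 0 e0 d e S)%N.
Proof.
move=> Q0; apply: (@count_pieces 0 (fun _ => 0)) => //.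
- by move=> M kappa kappa0; exists 1; split=> // y _ _; rewrite Q0 ltW.
- move=> r eta r0 eta0; exists 0, 1; split=> // c _; split=> [[]//|j].
  by exists (x j); split=> [|[]//]; exact: bx_refl.
- by case.
Qed.

(** The polar equations serve as [f]: they control [Q] by [polar_decomp], and
    their fibres come close to the points [x j] by [polar_fibers]. *)
Lemma count_isolated q (W : 'M[R]_(q, k)) e0 rho : row_free W -> (0 < q)%N -> 0 < rho -> dle e0 Q ->
  (forall j (s : 'rV[R]_q), s != 0 -> (forall i, `|s 0 i| <= rho) -> Q.@[(x j + s *m W) 0] <> 0) ->
  (forall S, e0 <= e S)%N ->
  (#|J| <= \sum_(S : {set I}) 4 ^ #|S| * lbound k q e0 d e S)%N.
Proof.
case: q W => // q W /row_freeP[V WV] _ rho0 dQ isol ee0.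
apply: (@count_pieces q.+1 (polar Q W V)) => //; last by move=> l; exact: dle_polar.
- move=> M kappa kappa0.
  have [B [B0 hB]] := finite_bound (fun l : 'I_q.+1 => \sum_i `|V i l|).
  have D0 : 0 < 1 + q%:R * (`|M| * B) by rewrite ltr_wpDr // !mulr_ge0 ?ler0n ?normr_ge0 ?(ltW B0).
  exists (kappa / (1 + q%:R * (`|M| * B))); split; first exact: divr_gt0.
  set eta := kappa / _ => y hy hf.
  have eta0 : 0 < eta by exact: divr_gt0.
  have -> : kappa = eta + \sum_(l < q) (`|M| * B) * eta.
    by rewrite sumr_const card_ord -[X in _ = _ + X]mulr_natl mulrA -[X in _ = X + _]mul1r -mulrDl mulrC divfK // gt_eqF.
  rewrite (polar_decomp Q W V); apply: lerD.
    exact: le_trans (ler_norm _) (ltW (hf _)).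
  apply: ler_sum => l _; apply: le_trans (ler_norm _) _; rewrite normrM.
  apply: ler_pM => //; last exact: ltW (hf _).
  rewrite mxE; apply: (le_trans (ler_norm_sum _ _ _)).
  apply: (@le_trans _ _ (`|M| * \sum_i `|V i (lift ord0 l)|)); last by rewrite ler_wpM2l.
  rewrite mulr_sumr; apply: ler_sum => i _; rewrite normrM ler_wpM2r //.
  by apply: le_trans (hy i) _; exact: ler_norm.
- move=> r eta r0 eta0; pose xs := [seq x j | j <- enum J].
  have xsP z : z \in xs -> exists j, z = x j by move=> /mapP[j _ ->]; exists j.
  have [||c0 [dd [dd0 h]]] := @polar_fibers R k q Q W V WV xs rho Qge0 rho0 _ _ r eta r0 eta0.
  + by move=> z /xsP[j ->]; have [] := CR (Cx j).
  + by move=> z /xsP[j ->]; exact: isol.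
  exists c0, dd; split=> // c /h[h1 h2]; split=> // j; apply: h2.
  by apply: map_f; rewrite mem_enum.
Qed.

(** Restricted to a line on which it does not vanish identically, [Q] has
    isolated zeros. One direction serves for all points [x j], because it only
    has to avoid finitely many proper algebraic subsets. *)
Lemma count_hypersurface e0 (v : 'rV[R]_k) : Q.@[v 0] != 0 -> dle e0 Q -> (forall S, e0 <= e S)%N ->
  (#|J| <= \sum_(S : {set I}) 4 ^ #|S| * lbound k 1 e0 d e S)%N.
Proof.
move=> Qn0 dQ ee0.
case: (posnP #|J|) => [-> //|/card_gt0P[j0 _]].
have [w hw] : exists w : 'rV[R]_k, forall j, Q.@[(x j + w) 0] != 0.
  have gen j : generic (fun w : 'rV[R]_k => Q.@[(x j + w) 0] != 0).
    apply: generic_neq0 => [|z eps eps0].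
      by apply: cont_meval; apply: (contV_add (contV_cst (x j)) (@contV_id R k)).
    have [y [r [r0 hy]]] := generic_meval Qn0 (x j + z) eps0.
    have [h1 h2] := hy y (bx_refl y r0); exists (y - x j); split; last by rewrite subrKC.
    move=> i; have := h1 i; rewrite !mxE; congr (`|_| < _); ring.
  have [y [r [r0 hy]]] := @generic_all R k J _ gen 0 1 ltr01.
  by exists y; have [_] := hy y (bx_refl y r0).
have w0 : w != 0.
  by apply: contraTneq (hw j0) => ->; rewrite addr0 negbK; have [-> _] := CR (Cx j0).
pose g j := linepoly Q (x j) w.
have [rho [rho0 hrho]] : exists rho, 0 < rho /\ forall j s, s != 0 -> `|s| <= rho -> (g j).[s] != 0.
  have [|j|rho [rho0 H]] := @unif_delta R J (fun j rho => forall s, s != 0 -> `|s| <= rho -> (g j).[s] != 0).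
  - by move=> j d1 d2 _ d12 H s s0 hs; apply: H => //; apply: le_trans hs d12.
  - have gn0 : g j != 0.
      by apply: contraNneq (hw j) => g0; rewrite -[w]scale1r -horner_linepoly -/(g j) g0 horner0.
    exact: punctured_nonroot.
  by exists rho.
apply: (@count_isolated 1 w e0 rho) => //.
  by rewrite /row_free rank_rV w0.
move=> j s s0 hs; apply/eqP.
rewrite [s]mx11_scalar mul_scalar_mx -horner_linepoly; apply: hrho; last exact: hs.
by apply: contraNneq s0 => h; rewrite [s]mx11_scalar h raddf0.
Qed.

End CountPieces.

(** * Connected components and splittings *)

Section Components.
Variables (R : rcfType) (k : nat).
Implicit Types S A B : set 'rV[R]_k.

(** Finite decompositions are used instead of components because they can be
    counted before components are known to be finite in number. *)
Definition splits S n := exists C : 'I_n -> set 'rV[R]_k,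
  [/\ forall i, semialgebraic (C i), forall i, closed_in S (C i), forall i, C i !=set0,
      forall i j x, C i x -> C j x -> i = j & forall x, S x <-> exists i, C i x].

Lemma splits_fin S (T : finType) (C : T -> set 'rV[R]_k) :
  (forall i, semialgebraic (C i)) -> (forall i, closed_in S (C i)) -> (forall i, C i !=set0) ->
  (forall i j x, C i x -> C j x -> i = j) -> (forall x, S x <-> exists i, C i x) -> splits S #|T|.
Proof.
move=> h1 h2 h3 h4 h5; exists (C \o enum_val); split=> /= [i|i|i|i j x hi hj|x].
- exact: h1.
- exact: h2.
- exact: h3.
- by apply: enum_val_inj; apply: h4 hi hj.
- split=> [/h5[i Ci]|[i Ci]]; last by apply/h5; exists (enum_val i).
  by exists (enum_rank i); rewrite enum_rankK.
Qed.

Lemma splits0 : splits set0 0.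
Proof.
exists (fun _ => set0); split=> [[]|[]|[]|[]|x] //.
by split=> // -[[]].
Qed.

Lemma splits1 S : semialgebraic S -> S !=set0 -> splits S 1.
Proof.
move=> hS S0; exists (fun _ => S); split=> // [i|i j x _ _|x].
- exists setT; first exact: closedT.
  by rewrite setTI.
- by rewrite !ord1.
- by split=> [Sx|[]//]; exists ord0.
Qed.

Lemma closed_in_sub S A D : closed_in S A -> D `<=` S -> closed_in D (D `&` A).
Proof.
move=> [F cF ->] DS; exists F => //; apply/seteqP; split=> x [h1 h2]; first by case: h2.
by split=> //; split=> //; apply: DS.
Qed.

(** The piece that contains a given point of [D] and the union of the other
    pieces separate [D]. *)
Lemma component_in_split S n D (C : 'I_n -> set 'rV[R]_k) :
  (forall i, semialgebraic (C i)) -> (forall i, closed_in S (C i)) ->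
  (forall i j x, C i x -> C j x -> i = j) -> (forall x, S x <-> exists i, C i x) ->
  D !=set0 -> D `<=` S -> semialg_connected D -> exists i, D `<=` C i.
Proof.
move=> h1 h2 h4 h5 [x Dx] DS [sD cD]; have [i Ci] := (h5 x).1 (DS x Dx); exists i.
pose B := \bigcup_(j in [set j | j != i]) C j.
have [] := cD (D `&` C i) (D `&` B).
- exact: semialgebraic_setI.
- apply: semialgebraic_setI => //.
  apply: (@semialgebraic_ext R k (fun x => exists j, j != i /\ C j x)); last by sa; exact: h1.
  by move=> y; split=> [[j [ji Cj]]|[j ji Cj]]; exists j.
- exact: closed_in_sub.
- apply: closed_in_sub DS.
  have exF j : exists F, closed F /\ C j = F `&` S by have [F cF e] := h2 j; exists F.
  have [F hF] := choice exF.
  exists (\bigcup_(j in [set j | j != i]) F j).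
    by apply: closed_bigcup => [|j _]; [exact: finite_finset|have [] := hF j].
  rewrite setI_bigcupl; apply: eq_bigcupr => j _.
  by have [_] := hF j.
- by apply/seteqP; split=> // y [[_ Ciy] [_ [j ji Cjy]]]; move: ji; rewrite (h4 _ _ _ Ciy Cjy) /= eqxx.
- apply/seteqP; split=> [y [[]|[]]//|y Dy].
  have [j Cj] := (h5 y).1 (DS y Dy); case: (eqVneq j i) => [ji|ji].
    by left; split=> //; rewrite -ji.
  by right; split=> //; exists j.
- by move=> h; have : (D `&` C i) x by []; rewrite h.
move=> h y Dy; have [j Cj] := (h5 y).1 (DS y Dy); case: (eqVneq j i) => [<- //|ji].
by have : (D `&` B) y; [split=> //; exists j|rewrite h].
Qed.

(** Separating a piece would give a splitting with one more piece, so the pieces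
    are connected; a component lies in a piece and equals it by maximality. *)
Lemma components_maximal_split S n : splits S n -> (forall m, splits S m -> (m <= n)%N) ->
  finite_set (components S) /\ (b0 S <= n)%N.
Proof.
move=> [C [h1 h2 h3 h4 h5]] nmax.
have CS i : C i `<=` S by move=> x Cx; apply/h5; exists i.
have conn i : semialg_connected (C i).
  split=> // A B sA sB [FA cFA eA] [FB cFB eB] AB ABC.
  apply: contrapT => /not_orP[/eqP/set0P A0 /eqP/set0P B0].
  have [F cF eF] := h2 i.
  (* The piece C i is replaced by its two parts A and B. *)
  pose C' (o : option 'I_n) := if o is Some j then if j == i then A else C j else B.
  have AC : A `<=` C i by rewrite -ABC; left.
  have BC : B `<=` C i by rewrite -ABC; right.
  suff : splits S #|{: option 'I_n}|.
    by move/nmax; rewrite card_option card_ord ltnn.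
  have dAB x : A x -> ~ B x by move=> Ax Bx; have : (A `&` B) x by []; rewrite AB.
  apply: (@splits_fin _ _ C') => /=.
  - by case=> [j|] //=; case: eqP.
  - case=> [j|] /=; last first.
      exists (FB `&` F); first exact: closedI.
      by rewrite eB -setIA -eF.
    case: eqP => [_|_]; last exact: h2.
    exists (FA `&` F); first exact: closedI.
    by rewrite eA -setIA -eF.
  - by case=> [j|] //=; case: eqP.
  - have CAB j x : C j x -> j != i -> ~ A x /\ ~ B x.
      move=> Cj ji; split=> [/AC|/BC] Ci; by move: ji; rewrite (h4 _ _ _ Cj Ci) eqxx.
    case=> [j|] [j'|] x //=.
    + case: (eqVneq j i) => [->|ji]; case: (eqVneq j' i) => [->|ji'] //.
      * by move=> Ax /CAB/(_ ji')[].
      * by move=> /CAB/(_ ji)[].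
      * by move=> hj hj'; rewrite (h4 _ _ _ hj hj').
    + by case: (eqVneq j i) => [_ /dAB //|ji /CAB/(_ ji)[]].
    + by case: (eqVneq j' i) => [_ Bx /dAB //|ji Bx /CAB/(_ ji)[]].
  - move=> x; split=> [/h5[j Cj]|[[j|]]] /=.
    + case: (eqVneq j i) Cj => [-> Ci|ji Cj]; last by exists (Some j); rewrite /= (negbTE ji).
      move: Ci; rewrite -ABC => -[Ax|Bx]; last by exists None.
      by exists (Some i); rewrite /= eqxx.
    + by case: eqP => [_ /AC/CS|_ /CS].
    + by move/BC/CS.
pose F := [fset x in [seq C i | i <- enum 'I_n]]%fset.
have sub : components S `<=` [set` F].
  move=> D [D0 DS cD Dmax]; have [i Di] := component_in_split h1 h2 h4 h5 D0 DS cD.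
  by rewrite /= inE -(Dmax _ Di (CS i) (conn i)); apply: map_f; rewrite mem_enum.
have fin : finite_set (components S) by exact: finite_subfset sub.
split=> //; rewrite /b0; apply: (@leq_trans #|` F|).
  apply: fsubset_leq_card; rewrite -(set_fsetK F) -fset_set_sub //.
rewrite card_fseq; apply: leq_trans (size_undup _) _.
by rewrite size_map size_enum_ord.
Qed.

(** The bound on all simultaneous splittings shows that each set has a splitting
    with the largest number of pieces. *)
Lemma components_bound (T : finType) (S : T -> set 'rV[R]_k) (B : nat) :
  (forall t, semialgebraic (S t)) ->
  (forall n : T -> nat, (forall t, splits (S t) (n t)) -> (\sum_t n t <= B)%N) ->
  (forall t, finite_set (components (S t))) /\ (\sum_t b0 (S t) <= B)%N.
Proof.
move=> sS hB.
have sp1 t : exists n, splits (S t) n.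
  have [->|/set0P ne] := eqVneq (S t) set0; first by exists 0%N; exact: splits0.
  by exists 1%N; exact: splits1.
have [n1 hn1] := choice sp1.
have bound t m : splits (S t) m -> (m <= B)%N.
  move=> hm; apply: leq_trans (hB (fun u => if u == t then m else n1 u) _); last first.
    by move=> u; case: eqP => [->|].
  by rewrite (bigD1 t) //= eqxx leq_addr.
have hmax t : exists n, splits (S t) n /\ forall m, splits (S t) m -> (m <= n)%N.
  have ex : exists n, `[< splits (S t) n >] by have [n h] := sp1 t; exists n; apply/asboolP.
  have ub m : `[< splits (S t) m >] -> (m <= B)%N by move/asboolP/bound.
  case: (ex_maxnP ex ub) => n /asboolP h1 h2; exists n; split=> // m hm; apply: h2.
  exact/asboolP.
have [n hn] := choice hmax.
split=> [t|]; first by have [h1 h2] := hn t; have [] := components_maximal_split h1 h2.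
apply: leq_trans (hB n _); last by move=> t; have [] := hn t.
by apply: leq_sum => t _; have [h1 h2] := hn t; have [] := components_maximal_split h1 h2.
Qed.

(** The neighbourhoods of the matrix topology are expressed by boxes. *)
Lemma closed_box (F : set 'rV[R]_k) y : closed F -> ~ F y ->
  exists e, 0 < e /\ forall z, bx y z e -> ~ F z.
Proof.
move=> cF nF; have : nbhs y (~` F) by apply: open_nbhs_nbhs; split=> //; exact: closed_openC.
move/nbhs_ballP => [e /= e0 he]; exists e; split=> // z yz; apply: he; split=> // i j.
by rewrite (ord1 i); exact: yz.
Qed.

End Components.

(** * The bound for a real algebraic set *)

Section SumOfSquares.
Variables (R : rcfType) (k : nat) (Q P : {fset {mpoly R[k]}}).

Definition sumsq : {mpoly R[k]} := \sum_(q <- Q) q ^+ 2.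
Definition polyP (p : P) : {mpoly R[k]} := val p.

Lemma sumsqE (x : 'rV[R]_k) : sumsq.@[x 0] = \sum_(q <- Q) q.@[x 0] ^+ 2.
Proof. by rewrite raddf_sum /=; apply: eq_bigr => q _; rewrite rmorphXn. Qed.

Lemma sumsq_ge0 (x : 'rV[R]_k) : 0 <= sumsq.@[x 0].
Proof. by rewrite sumsqE; apply: sumr_ge0 => q _; exact: sqr_ge0. Qed.

Lemma sumsq_eq0 (x : 'rV[R]_k) : sumsq.@[x 0] = 0 <-> Zer Q x.
Proof.
rewrite sumsqE; split=> [/eqP|h]; last first.
  by rewrite big_seq big1 // => q /h ->; rewrite expr0n.
rewrite psumr_eq0 => [/allP h q /h|q _]; last exact: sqr_ge0.
by rewrite sqrf_eq0 => /eqP.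
Qed.

Lemma dle_tdeg d (p : {mpoly R[k]}) : (tdeg p <= d)%N -> dle d p.
Proof. by rewrite /tdeg /dle; case: (msize p). Qed.

Lemma dle_sumsq d : (forall q, q \in Q -> (tdeg q <= d)%N) -> dle (2 * d) sumsq.
Proof.
move=> h; rewrite /sumsq big_seq; elim/big_ind: _ => [|p q|q /h/dle_tdeg hq].
- by rewrite /dle msize0.
- exact: dle_add.
- by rewrite expr2 mul2n -addnn; exact: dle_mul.
Qed.

Lemma realizationE sigma x : realization sigma (Zer Q) x <->
  realize sumsq polyP (fun p : P => val (sigma p)) x.
Proof. by split=> -[/sumsq_eq0]. Qed.

Lemma realization_sa (sigma : {ffun P -> signs}) : semialgebraic (realization sigma (Zer Q)).
Proof.
apply: (@semialgebraic_ext R k (fun x => sumsq.@[x 0] = 0 /\ forall p : P,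
   (val (sigma p) = 0 /\ (polyP p).@[x 0] = 0) \/ (val (sigma p) = 1 /\ 0 < (polyP p).@[x 0])
   \/ (val (sigma p) = -1 /\ (polyP p).@[x 0] < 0))); last by sa.
move=> x; rewrite /realization /=; split=> -[/sumsq_eq0 h1 h2]; split=> // p.
  case: (h2 p) => [[-> e]|[[-> e]|[-> e]]]; last exact: ltr0_sgz.
    by move: e; rewrite /polyP => ->; rewrite sgz0.
  exact: gtr0_sgz.
have := h2 p; rewrite -/(polyP p); case: (ltrgt0P (polyP p).@[x 0]) => [e|e|->].
- by rewrite gtr0_sgz // => <-; right; left.
- by rewrite ltr0_sgz // => <-; right; right.
- by rewrite sgz0 => <-; left.
Qed.

Variables (d0 : nat) (dP : P -> nat).
Hypotheses (hQ : forall q, q \in Q -> (tdeg q <= d0)%N) (hP : forall p : P, tdeg (val p) = dP p).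

Definition maxdeg (S : {set P}) : nat := maxn (2 * d0) (\max_(p in S) dP p).
(** Positive even when all degrees are zero, because the Lagrange equations
    contain the coordinates of the point. *)
Definition edeg (S : {set P}) : nat := maxn 1 (maxdeg S).

Lemma edeg_gt0 S : (0 < edeg S)%N.
Proof. by rewrite /edeg leq_max. Qed.

Lemma edeg_d0 S : (2 * d0 <= edeg S)%N.
Proof. by rewrite /edeg /maxdeg !leq_max leqnn orbT. Qed.

Lemma edeg_dP (S : {set P}) i : i \in S -> (dP i <= edeg S)%N.
Proof. by move=> iS; rewrite /edeg /maxdeg !leq_max (leq_bigmax_cond _ iS) !orbT. Qed.

Lemma dle_polyP p : dle (dP p) (polyP p).
Proof. by apply: dle_tdeg; rewrite hP. Qed.

Definition bound_term (p : nat) (S : {set P}) : nat :=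
  (4 ^ #|S| * ('C(k + 1, (k - p) + #|S| + 1) * (2 * d0) ^ (k - p) *
     (\prod_(i in S) dP i) * maxdeg S ^ (p - #|S|) + 2 * (k - #|S| + 1)))%N.

(** If all degrees are zero, the count is at most 1 and is absorbed by the last
    summand; otherwise the main terms are compared. The second case is a single
    equation in a set whose dimension is only known to be at most [k], where the
    degree of that equation pays for the missing power of [maxdeg S]. *)
Lemma lbound_le_term q p (S : {set P}) : (p <= k)%N -> (q = k - p \/ q = 1 /\ p = k)%N ->
  (4 ^ #|S| * lbound k q (2 * d0) dP edeg S <= if #|S| <= p then bound_term p S else 0)%N.
Proof.
move=> pk hq; rewrite /lbound /bound_term /edeg.
have d0D : (2 * d0 <= maxdeg S)%N by rewrite /maxdeg leq_max leqnn.
have dPD i : i \in S -> (dP i <= maxdeg S)%N.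
  by move=> iS; rewrite /maxdeg leq_max (leq_bigmax_cond _ iS) orbT.
have dP0 : (0 < #|S|)%N -> maxdeg S = 0%N -> (\prod_(i in S) dP i = 0)%N.
  move=> /card_gt0P[i iS] D0; have d0' : dP i = 0%N by apply/eqP; rewrite -leqn0 -D0 dPD.
  by rewrite (bigD1 i iS) /= d0' mul0n.
have dP1 : #|S| = 0%N -> (\prod_(i in S) dP i = 1)%N.
  by move/cards0_eq => ->; rewrite big_set0.
move: d0D dP0 dP1 {dPD}; move: (maxdeg S) (\prod_(i in S) dP i)%N (#|S|) (2 * d0)%N => D X c a aD X0 X1.
have bin_le u : ('C(k, u) <= 'C(k + 1, u + 1))%N by rewrite !addn1 binS leq_addl.
case: (leqP c p) => cp; last first.
  rewrite bin_small ?mul0n ?muln0 //.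
  by case: hq => [->|[-> <-]]; lia.
rewrite leq_mul2l; apply/orP; right.
have [D0|Dpos] := posnP D.
  have a0 : a = 0%N by move: aD; rewrite D0 leqn0 => /eqP.
  case: hq => [->|[-> _]]; last by rewrite a0 expn1 mul0n muln0.
  have [kp|kp] := posnP (k - p)%N; last by rewrite a0 exp0n // mul0n muln0.
  have [c0|c0] := posnP c; last by rewrite (X0 c0 D0) !muln0.
  by rewrite kp c0 D0 (X1 c0) /= exp1n bin0 !mul1n; lia.
rewrite (maxn_idPr Dpos); apply: leq_trans (leq_addr _ _).
case: hq => [->|[-> pk1]].
  have -> : (k - (k - p + c) = p - c)%N by lia.
  apply: (@leq_trans ('C(k + 1, k - p + c + 1) * (D ^ (p - c) * (a ^ (k - p) * X)))); last first.
    by apply: eq_leq; ring.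
  by rewrite -mulnA leq_mul2r bin_le orbT.
move: pk cp; rewrite pk1 => _ cp.
have [pc|pc] := leqP k c; first by rewrite bin_small ?mul0n // add1n ltnS.
rewrite subnn expn0 muln1 add0n expn1.
have -> : (k - c = (k - (1 + c)).+1)%N by lia.
rewrite expnS.
apply: (@leq_trans ('C(k + 1, c + 1) * (D ^ (k - (1 + c)) * (D * X)))); last by apply: eq_leq; ring.
rewrite -mulnA; apply: leq_mul; last by rewrite leq_mul2l leq_mul2r aD !orbT.
by rewrite !addn1 add1n binS leq_addr.
Qed.

(** The pieces of all realizations are counted together. For [p < k] they are
    cut by sections of dimension [k - p]; for [p = k] by lines, unless all
    members of [Q] vanish identically, when no section is needed. *)
Lemma count_realizations p (n : {ffun P -> signs} -> nat) : (p <= k)%N ->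
  ~ cube_embeds p.+1 (Zer Q) ->
  (forall sigma, splits (realization sigma (Zer Q)) (n sigma)) ->
  (\sum_sigma n sigma <= \sum_(S : {set P} | #|S| <= p) bound_term p S)%N.
Proof.
move=> pk nemb hn.
pose CC sigma := sval (cid (hn sigma)).
have CCP sigma := svalP (cid (hn sigma)).
pose J : finType := {sigma : {ffun P -> signs} & 'I_(n sigma)}.
pose C (j : J) : set 'rV[R]_k := CC (tag j) (tagged j).
pose sg (j : J) (i : P) : int := val (tag j i).
have CR j y : C j y -> realize sumsq polyP (sg j) y.
  move=> Cy; apply/realizationE; have [_ _ _ _ h] := CCP (tag j).
  by apply/(h y); exists (tagged j).
have sC j : semialgebraic (C j) by have [h _ _ _ _] := CCP (tag j); exact: h.
have Ccl j y : realize sumsq polyP (sg j) y ->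
    (forall e, 0 < e -> exists z, C j z /\ bx y z e) -> C j y.
  move=> /realizationE ry hy; have [_ h _ _ _] := CCP (tag j).
  have [F cF eF] := h (tagged j); rewrite /C /CC eF; split=> //.
  apply: contrapT => nF; have [e [e0 he]] := closed_box cF nF.
  have [z [Cz yz]] := hy e e0; apply: (he z yz).
  by move: Cz; rewrite /C /CC eF => -[].
have Cop j y : C j y -> exists e, 0 < e /\ forall z, realize sumsq polyP (sg j) z -> bx y z e -> C j z.
  move=> Cy; have [_ h2 _ h4 h5] := CCP (tag j).
  have [|i|e [e0 he]] := @unif_delta R 'I_(n (tag j)) (fun i e => i != tagged j ->
    forall z, CC (tag j) i z -> ~ bx y z e).
  - by move=> i d d' _ dd' H it z Cz yz; apply: (H it z Cz); apply: bx_le yz.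
  - case: (eqVneq i (tagged j)) => [_|it]; first by exists 1.
    have [F cF eF] := h2 i; have nF : ~ F y.
      move=> Fy; move: it; suff -> : i = tagged j by rewrite eqxx.
      apply: (h4 i (tagged j) y) => //; rewrite eF; split=> //; apply/h5.
      by exists (tagged j).
    have [e [e0 he]] := closed_box cF nF; exists e; split=> // _ z Cz yz.
    by apply: (he z yz); move: Cz; rewrite /CC eF => -[].
  exists e; split=> // z /realizationE/h5[i Ci] yz.
  case: (eqVneq i (tagged j)) => [it|it]; first by rewrite it in Ci.
  by case: (he i it z Ci yz).
have Cdis i j y : C i y -> C j y -> i = j.
  move=> Ci Cj; have eij : tag i = tag j.
    apply/ffunP => p0; apply: val_inj; have [_ /(_ p0) h1] := CR _ _ Ci.
    by have [_ /(_ p0) h2] := CR _ _ Cj; rewrite -[LHS]h1 -[RHS]h2.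
  case: i j eij Ci Cj => [si i] [sj j] /= e; subst sj => Ci Cj; congr (existT _ _ _).
  have [_ _ _ h4 _] := CCP si; exact: (h4 i j y).
have exC j : exists y, C j y by have [_ _ h _ _] := CCP (tag j); exact: h.
have [x Cx] := choice exC.
have -> : (\sum_sigma n sigma = #|J|)%N.
  rewrite card_tagged sumnE big_map big_enum; apply: eq_bigr => s _; by rewrite card_ord.
have hpol := dle_polyP.
suff [q [hq hJ]] : exists q, (q = k - p \/ q = 1 /\ p = k)%N /\
    (#|J| <= \sum_(S : {set P}) 4 ^ #|S| * lbound k q (2 * d0) dP edeg S)%N.
  apply: leq_trans hJ _; rewrite [X in (_ <= X)%N]big_mkcond /=; apply: leq_sum => S _.
  exact: lbound_le_term.
case: (ltnP p k) => [ltpk|lekp]; last first.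
  have epk : p = k by apply/eqP; rewrite eqn_leq pk.
  have [[v hv]|nv] := pselect (exists v : 'rV[R]_k, sumsq.@[v 0] <> 0).
    exists 1%N; split; first by right.
    apply: (count_hypersurface sumsq_ge0 sC CR Ccl Cop Cdis hpol edeg_gt0 edeg_dP Cx (v := v)).
    - exact/eqP.
    - exact: dle_sumsq.
    - exact: edeg_d0.
  exists 0%N; split; first by left; rewrite epk subnn.
  apply: (count_full sumsq_ge0 sC CR Ccl Cop Cdis hpol edeg_gt0 edeg_dP Cx) => y.
  by apply: contrapT => hy; apply: nv; exists y.
exists (k - p)%N; split; first by left.
have sZ : semialgebraic (Zer Q).
  by apply: (@semialgebraic_ext R k (fun y => sumsq.@[y 0] = 0)); [exact: sumsq_eq0|sa].
have cZ : cl (Zer Q).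
  move=> y hy; apply/sumsq_eq0.
  have c0 : cl (fun y : 'rV[R]_k => sumsq.@[y 0] = 0) by ct.
  by apply: c0 => e /hy[z [/sumsq_eq0 hz yz]]; exists z.
have [|W [Wfree [rho [rho0 isol]]]] := isolating_subspace sZ cZ nemb [seq x j | j <- enum J] (j := (k - p)%N).
  by rewrite subnK.
apply: (count_isolated sumsq_ge0 sC CR Ccl Cop Cdis hpol edeg_gt0 edeg_dP Cx Wfree _ rho0).
- by rewrite subn_gt0.
- exact: dle_sumsq.
- move=> j s s0 hs /sumsq_eq0; apply: isol s0 hs; apply: map_f; exact: mem_enum.
- exact: edeg_d0.
Qed.

End SumOfSquares.

(** * Sums over sets of polynomials *)

Lemma sum_by_card (T : finType) (n : nat) (p : pred nat) (F : nat -> nat) :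
  (forall c, p c -> (c < n)%N) ->
  (\sum_(S : {set T} | p #|S|) F #|S| = \sum_(j < n | p j) 'C(#|T|, j) * F j)%N.
Proof.
move=> pn; transitivity (\sum_(S : {set T} | p #|S|) \sum_(j < n | j == #|S| :> nat) F j)%N.
  apply: eq_bigr => S /pn lt; by rewrite (big_pred1 (Ordinal lt)).
apply: etrans (exchange_big_dep (fun j : 'I_n => p j) _) _ => [S j pS /eqP -> //|] /=.
apply: eq_bigr => j pj; rewrite -card_draws -sum_nat_const; apply: eq_bigl => S.
by rewrite inE eq_sym; case: eqP => [->|]; rewrite ?andbF ?pj.
Qed.

Local Open Scope nat_scope.

Theorem mainTheorem1 (R : rcfType) (k : nat) (Q P : {fset {mpoly R[k]}})
    (d0 s : nat) (dP : P -> nat) (k' : int)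
    (hQ : forall q : {mpoly R[k]}, q \in Q -> tdeg q <= d0)
    (hP : forall p : P, tdeg (val p) = dP p)
    (hdim : real_dim (Zer Q) k')
    (hk' : (k' <= k%:Z)%R)
    (hs : #|` P| = s) :
  (forall sigma : {ffun P -> signs},
     finite_set (components (realization sigma (Zer Q)))) /\
  \sum_(sigma : {ffun P -> signs}) b0 (realization sigma (Zer Q)) <=
    \sum_(I : {set P} | (#|I|%:Z <= k')%R)
       4 ^ #|I| *
         ('C(k + 1, `|k - k'| + #|I| + 1) * (2 * d0) ^ `|k - k'| *
            (\prod_(p in I) dP p) *
            maxn (2 * d0) (\max_(p in I) dP p) ^ `|k' - #|I| |
          + 2 * (k - #|I| + 1)) /\
  (forall d : nat, (forall p : P, dP p <= d) ->
     \sum_(sigma : {ffun P -> signs}) b0 (realization sigma (Zer Q)) <=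
       \sum_(j < k + 1 | (j%:Z <= k')%R)
          4 ^ j * 'C(s + 1, j) *
            ('C(k + 1, `|k - k'| + j + 1) * (2 * d0) ^ `|k - k'| *
               d ^ j * maxn (2 * d0) d ^ `|k' - j|
             + 2 * (k - j + 1))).
Proof.
have [fin first] : (forall sigma : {ffun P -> signs},
     finite_set (components (realization sigma (Zer Q)))) /\
  \sum_(sigma : {ffun P -> signs}) b0 (realization sigma (Zer Q)) <=
    \sum_(I : {set P} | (#|I|%:Z <= k')%R)
       4 ^ #|I| *
         ('C(k + 1, `|k - k'| + #|I| + 1) * (2 * d0) ^ `|k - k'| *
            (\prod_(p in I) dP p) *
            maxn (2 * d0) (\max_(p in I) dP p) ^ `|k' - #|I| |
          + 2 * (k - #|I| + 1)).
  apply: components_bound => [sigma|n hn]; first exact: realization_sa.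
  case: hdim => [[Z0 _]|[m [k'm _ mmax]]].
    rewrite big1 // => sigma _; have [C [_ _ C0 _ CE]] := hn sigma.
    case: (n sigma) C C0 CE => // n' C C0 CE; have [x Cx] := C0 ord0.
    have [Zx _] : realization sigma (Zer Q) x by apply/CE; exists ord0.
    by move: Zx; rewrite Z0.
  move: hk'; rewrite k'm lez_nat => mk.
  apply: leq_trans (count_realizations hQ hP mk _ hn) _.
    by move/mmax; rewrite ltnn.
  apply: eq_leq; rewrite distnEl //; apply: eq_big => I; first by rewrite lez_nat.
  by move=> Im; rewrite distnEl // /bound_term /maxdeg distnEr.
split=> //; split=> // d dPd; apply: leq_trans first _.
pose u j := 'C(k + 1, `|k - k'| + j + 1) * (2 * d0) ^ `|k - k'| *
  d ^ j * maxn (2 * d0) d ^ `|k' - j| + 2 * (k - j + 1).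
apply: (@leq_trans (\sum_(I : {set P} | (#|I|%:Z <= k')%R) 4 ^ #|I| * u #|I|)).
  apply: leq_sum => I _; rewrite leq_mul2l; apply/orP; right; rewrite /u leq_add2r.
  apply: leq_mul; first rewrite leq_mul2l.
    apply/orP; right; rewrite -prod_nat_const; apply: leq_prod => p _; exact: dPd.
  have le : maxn (2 * d0) (\max_(p in I) dP p) <= maxn (2 * d0) d.
    by rewrite geq_max leq_maxl leq_max; apply/orP; right; apply/bigmax_leqP => p _; exact: dPd.
  by case: `|_|%N => // c; rewrite leq_exp2r.
rewrite (@sum_by_card P (k + 1) (fun c => (c%:Z <= k')%R) (fun c => 4 ^ c * u c)) => [|c ck]; last first.
  by rewrite addn1 ltnS -lez_nat; apply: le_trans ck hk'.
apply: leq_sum => j _; rewrite -cardfE hs -/(u j) mulnCA -[X in _ <= X]mulnA.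
by rewrite leq_mul2l leq_mul2r leq_bin2l ?orbT // addn1.
Qed.
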